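(* Let $(Z_0,Z_1)$ be a coarse simplicial pair of uniformly acyclic complexes, each with bounded geometry. Let $X$ be a coarse $PD(n)$ space and let $f\colon Z_0\to X$ be a coarse embedding. Then the Čech homology sequence \[ \cdots \longrightarrow \check{H}^D_{n-k}\bigl(fZ_1^c,fZ_0^c\bigr) \xrightarrow{\ \partial\ } \check{\widetilde H}{}^D_{n-k-1}\bigl(fZ_0^c\bigr)\longrightarrow \check{\widetilde H}{}^D_{n-k-1}\bigl(fZ_1^c\bigr)\longrightarrow\cdots \] obtained as the inverse limit of the reduced homology long exact sequences of the pairs $(\overline{X-L_1},\overline{X-L_0})$, where $(L_0,L_1)$ ranges over the neighborhoods of the pair $(f(Z_0),f(Z_1))$, is exact.
   Context: All homology and cohomology is simplicial with integer coefficients; $C_\circ(X)$ and $C_c^\circ(X)$ denote simplicial chains and compactly supported simplicial cochains. Reduced homology is the homology of the augmented chain complex (so $\widetilde H_{-1}(\varnothing)=\mathbb{Z}$). A metric simplicial complex is a connected, locally finite simplicial complex with the length metric in which each simplex is isometric to the standard Euclidean simplex with edges of length one. It has bounded geometry if vertex links have a uniformly bounded number of simplices. For a subcomplex $K$ and a positive integer $R$, $N_R(K)$ is the $R$-fold iterated closed star of $K$; for a general subset $K$ it denotes a metric $R$-tubular neighborhood. A map $f\colon Y\to X$ of metric spaces is a coarse embedding if there are unbounded increasing functions $\rho_\pm\colon\mathbb{R}_{\ge0}\to\mathbb{R}_{\ge0}$ with $\rho_-(d(y_1,y_2))\le d(f(y_1),f(y_2))\le\rho_+(d(y_1,y_2))$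 for all $y_1,y_2\in Y$. (It need not be continuous.) A coarse simplicial pair $(Z_0,Z_1)$ is a simplicial pair, $Z_1\subseteq Z_0$, such that $Z_0$ and $Z_1$ are each endowed with a length metric in which each edge has length one, and the inclusion $Z_1\to Z_0$ is a coarse embedding. An $m$-dimensional metric simplicial complex $X$ is uniformly acyclic if for every $j\le m$ and every $R_1>0$ there is $R_2>0$ such that for each subcomplex $K\subset X$ of diameter at most $R_1$ the inclusion $K\to N_{R_2}(K)$ induces zero on $\widetilde H_j$. The support of a subset of $C_\circ(X)$ is the smallest subcomplex carrying it. A homomorphism $h\colon C_i(X)\to C_c^j(X)$ has displacement at most $D$ if for every simplex $\sigma$ the cochain $h(\sigma)$ is supported in $N_D(\sigma)$. A homomorphism $C_c^j(X)\to C_i(X)$ has displacement at most $D$ if for each simplex $\sigma$ the image of the composition $C_c^j(\bar\sigma)\to C_c^j(X)\to C_i(X)$ has support in $N_D(\sigma)$, where the first map is extension by zero outside the subcomplex $\bar\sigma$. A chain map or chain homotopy $h$ is $D$-controlled if for each simplex $\sigma$ the support of $h(C_\circ(\sigma))$ has diameter at most $D$; similarly for cochain maps and cochain homotopies. A coarse $PD(n)$ space is a bounded geometry, uniformly acyclic, metric simplicial complex $X$ equipped with cochain maps $C_{n-\circ}(X)\xrightarrow{\bar P}C_c^\circ(X)\xrightarrow{P}C_{n-\circ}(X)$ such that for some integer constant $E_0$, both $P$ and $\bar P$ have displacement at most $E_0$, and $\bar P\circ P$ and $P\circ\bar P$ are cochain homotopic to the identity by $E_0$-controlled cochain homotopies.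 For a subset $K\subseteq X$, a neighborhood of $K$ is a subcomplex $L$ of $X$ contained in $N_R(K)$ for some $R<\infty$; $\mathcal N(K)$ is the set of these, directed by inclusion. For subsets $K_1\subseteq K_0$, a neighborhood of $(K_0,K_1)$ is a pair of subcomplexes $L_1\subseteq L_0$ with $L_i\subseteq N_R(K_i)$ for some $R$. Define the inverse limits (over neighborhoods, with bonding maps induced by inclusion) \[\check{\widetilde H}{}^D_i(K^c)=\varprojlim_{L}\widetilde H_i(\overline{X-L}),\qquad \check H^D_i(K_1^c,K_0^c)=\varprojlim_{(L_0,L_1)}H_i(\overline{X-L_1},\overline{X-L_0}).\] Here $fZ_i^c$ is short for $(f(Z_i))^c$. *)

(* Defs.v *)
From HB Require Import structures.
From mathcomp Require Import all_boot all_order all_algebra finmap.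
From mathcomp Require Import boolp classical_sets functions cardinality fsbigop reals.
From mathcomp Require Import freeg zify.

Set Implicit Arguments.
Unset Strict Implicit.
Unset Printing Implicit Defensive.

Import Order.TTheory GRing.Theory Num.Theory.

Local Open Scope quotient_scope.
Local Open Scope classical_set_scope.
Local Open Scope ring_scope.

Section Complexes.
Context {d : Order.disp_t} {V : orderType d}.
Implicit Types (S X K L : set {fset V}) (s t : {fset V}) (u v : V).

(* A simplex is its finite set of vertices; the empty set is not a simplex of
   a complex.  It is added, in dimension -1, by [aug] to form the augmented
   chain complex. *)
Definition is_complex S : Prop :=
  ~ S fset0 /\ forall s t, S s -> (t `<=` s)%fset -> t != fset0 -> S t.

Definition subcomplex X K : Prop := is_complex K /\ K `<=` X.

Definition aug K : set {fset V} := K `|` [set fset0].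

Definition closed_simplex s : set {fset V} :=
  [set t | t != fset0 /\ (t `<=` s)%fset].

Definition closed_star X K : set {fset V} :=
  [set t | t != fset0 /\
     exists s v, [/\ X s, (t `<=` s)%fset, v \in s & K [fset v]%fset]].

Definition star_nbhd X (r : nat) K : set {fset V} := iter r (closed_star X) K.

(* The closure of [|X| \ |L|]: an open simplex of X misses a subcomplex L as
   soon as it does not belong to L. *)
Definition closure_compl X L : set {fset V} :=
  [set t | t != fset0 /\ exists s, [/\ X s, ~ L s & (t `<=` s)%fset]].

Definition link X v : set {fset V} :=
  [set s | [/\ X s, v \notin s & X (v |` s)%fset]].

Definition adjacent X : rel V := fun u v => `[< X [fset u; v]%fset >].

Definition connected_complex X : Prop := forall u v,
  X [fset u]%fset -> X [fset v]%fset ->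
  exists p : seq V, path (adjacent X) u p /\ last u p = v.

Definition locally_finite X : Prop :=
  forall v, finite_set [set s | X s /\ v \in s].

Definition bounded_geometry X : Prop :=
  exists B : nat, forall v, X [fset v]%fset -> (link X v #<= `I_B)%card.

(* The empty complex has dimension -1. *)
Definition has_dimension X (m : int) : Prop :=
  (forall s, aug X s -> (#|` s|)%:Z <= m + 1) /\
  (exists2 s, aug X s & (#|` s|)%:Z = m + 1).

End Complexes.

Record metric_complex d (V : orderType d) := MetricComplex {
  simplices :> set {fset V};
  mc_complex : is_complex simplices;
  mc_connected : connected_complex simplices;
  mc_locally_finite : locally_finite simplices }.

Section Metric.
Context {R : realType} {d : Order.disp_t} {V : orderType d}.
Implicit Types (X K L : set {fset V}) (s : {fset V}) (x y : V -> R).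

(* Points are given by their barycentric coordinates. *)
Definition in_simplex s x : Prop :=
  [/\ forall v, 0 <= x v, forall v, v \notin s -> x v = 0
    & \sum_(v <- s) x v = 1].

Definition realization K : set (V -> R) :=
  [set x | exists2 s, K s & in_simplex s x].

(* The factor 1/2 gives the edges length one. *)
Definition euclid x y : R :=
  Num.sqrt (2^-1 * \sum_(v \in [set: V]) (x v - y v) ^+ 2).

Definition cosimplicial X : rel (V -> R) :=
  fun x y => `[< exists s, [/\ X s, in_simplex s x & in_simplex s y] >].

(* Every broken line with consecutive vertices in a common closed simplex is a
   path in X, and such lines suffice to compute the infimum of the lengths of
   all paths. *)
Definition dist X x y : R :=
  inf [set l | exists p : seq (V -> R),
    [/\ path (cosimplicial X) x p, last x p = y
      & l = \sum_(e <- pairmap euclid x p) e]].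

Definition diam_le X K (D : R) : Prop :=
  forall x y, realization K x -> realization K y -> dist X x y <= D.

Definition tube X (r : R) (A : set (V -> R)) : set (V -> R) :=
  [set x | realization X x /\ exists2 a, A a & dist X x a < r].

End Metric.

Section CoarseEmbedding.
Context {R : realType}.

(* An unbounded nondecreasing function from [0, +oo[ to itself. *)
Definition control (rho : R -> R) : Prop :=
  [/\ forall t, 0 <= t -> 0 <= rho t,
      forall t u, 0 <= t -> t <= u -> rho t <= rho u
    & forall M, exists2 t, 0 <= t & M <= rho t].

Definition coarse_embedding (T U : Type) (A : set T) (dA : T -> T -> R)
    (B : set U) (dB : U -> U -> R) (f : T -> U) : Prop :=
  set_fun A B f /\
  exists rhom rhop : R -> R, [/\ control rhom, control rhop &
    forall x y, A x -> A y ->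
      rhom (dA x y) <= dB (f x) (f y) <= rhop (dA x y)].

End CoarseEmbedding.

Record coarse_pair (R : realType) d (V : orderType d)
    (Z0 Z1 : metric_complex V) : Prop := CoarsePair {
  cp_sub : Z1 `<=` Z0;
  cp_coarse : coarse_embedding (realization Z1) (@dist R _ _ Z1)
                               (realization Z0) (@dist R _ _ Z0) id }.

Lemma image_coarse_pair (R : realType) d (V : orderType d)
    (Z0 Z1 : metric_complex V) (T : Type) (f : (V -> R) -> T) :
  coarse_pair R Z0 Z1 -> f @` realization Z1 `<=` f @` realization Z0.
Proof.
by move=> [sZ _]; apply: image_subset => x [s Zs xs]; exists s => //; apply: sZ.
Qed.

Section FreeLift.
Variables (R : nzRingType) (K : choiceType) (M : lmodType R) (f : K -> M).

Lemma fglift_is_zmod_morphism : zmod_morphism (fglift f).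
Proof. exact: lift_is_additive. Qed.

HB.instance Definition _ :=
  GRing.isZmodMorphism.Build {freeg K / R} M (fglift f) fglift_is_zmod_morphism.
End FreeLift.

(* For a set S of finite sets of vertices, [chains S] is the free abelian group
   on S.  For a complex K, [chains K] is the total group of chains of K and
   [chains (aug K)] that of the augmented chain complex.  A compactly supported
   cochain is a finite combination of the basis dual to the simplices, so
   [chains K] is also the total group of compactly supported cochains; only the
   differentials [bd] and [cobd] differ.  The order on V orients the
   simplices. *)
Notation chains S := {freeg (set_type S)}.

Section Chains.
Context {d : Order.disp_t} {V : orderType d}.
Implicit Types (S T : set {fset V}) (s : {fset V}).

Definition generator S s : chains S :=
  if insub s is Some a then [freeg [:: (1%:Z, a)]] else 0.

Definition position (v : V) s : nat := #|` [fset u in s | (u < v)%O]%fset|.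

(* Faces outside S are dropped; when S is a complex this only concerns the
   empty face of a vertex. *)
Definition bd S : chains S -> chains S :=
  fglift (fun a : set_type S => \sum_(v <- val a)
    (-1) ^+ position v (val a) *: generator S (val a `\ v)%fset).

(* The transpose of [bd]. *)
Definition cobd S : chains S -> chains S :=
  fglift (fun b : set_type S =>
    let inc (a : set_type S) := coeff b (bd (generator S (val a))) in
    \sum_(a <- fset_set [set a | inc a != 0]) inc a *: generator S (val a)).

(* The inclusion of chains when S is contained in T, and extension by zero on
   cochains. *)
Definition push S T : chains S -> chains T :=
  fglift (fun a : set_type S => generator T (val a)).

HB.instance Definition _ S := GRing.Additive.on (@bd S).
HB.instance Definition _ S := GRing.Additive.on (@cobd S).
HB.instance Definition _ S T := GRing.Additive.on (@push S T).

Definition carried S T (c : chains S) : Prop :=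
  forall a, coeff a c != 0 -> T (val a).

Definition has_degree S (i : int) (c : chains S) : Prop :=
  forall a, coeff a c != 0 -> (#|` val a|)%:Z = i + 1.

End Chains.
Section ChainLemmas.
Context {d : Order.disp_t} {V : orderType d}.
Implicit Types (S T : set {fset V}) (s : {fset V}) (i : int).

Definition face_closed S : Prop :=
  forall s t, S s -> (t `<=` s)%fset -> S t.

Lemma face_closed_aug S : is_complex S -> face_closed (aug S).
Proof.
move=> [_ cS] s t [Ss|->] ts; last by right; apply/eqP; rewrite -fsubset0.
by have [->|t0] := eqVneq t fset0; [right|left; apply: cS ts t0].
Qed.

Lemma generatorE S (a : set_type S) :
  generator S (val a) = [freeg [:: (1%:Z, a)]].
Proof. by rewrite /generator valK. Qed.

Lemma generator_out S s : ~ S s -> generator S s = 0.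
Proof.
move=> Ss; rewrite /generator; case: insubP => // a sS.
by case: Ss; apply: set_mem.
Qed.

Lemma bd_generator S (a : set_type S) : bd (generator S (val a)) =
  \sum_(v <- val a)
    (-1) ^+ position v (val a) *: generator S (val a `\ v)%fset.
Proof. by rewrite generatorE /bd liftU scale1r. Qed.

Lemma push_generator S T (a : set_type S) :
  push T (generator S (val a)) = generator T (val a).
Proof. by rewrite generatorE /push liftU scale1r. Qed.

Lemma chain_ind S (M : zmodType) (f g : {additive chains S -> M}) :
  (forall a : set_type S, f (generator S (val a)) = g (generator S (val a))) ->
  f =1 g.
Proof.
move=> fg c; rewrite -[c]freeg_sumE !raddf_sum; apply: eq_bigr => a _.
have -> : [freeg [:: (coeff a c, a)]] = [freeg [:: (1%:Z, a)]] *~ coeff a c.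
  by rewrite freegU_mulz intz.
by rewrite !raddfMz -generatorE fg.
Qed.

Lemma carried0 S T : carried T (0 : chains S).
Proof. by move=> a; rewrite coeff0 eqxx. Qed.

Lemma carriedB S T (b c : chains S) :
  carried T b -> carried T c -> carried T (b - c).
Proof.
move=> hb hc a; rewrite coeffB; case: (eqVneq (coeff a b) 0) => [-> |/hb //].
by rewrite sub0r oppr_eq0 => /hc.
Qed.

Lemma has_degree0 S i : has_degree i (0 : chains S).
Proof. by move=> a; rewrite coeff0 eqxx. Qed.

Lemma has_degreeB S i (b c : chains S) :
  has_degree i b -> has_degree i c -> has_degree i (b - c).
Proof.
move=> hb hc a; rewrite coeffB; case: (eqVneq (coeff a b) 0) => [-> |/hb //].
by rewrite sub0r oppr_eq0 => /hc.
Qed.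

End ChainLemmas.

Section BoundarySquare.
Context {d : Order.disp_t} {V : orderType d}.
Implicit Types (S T : set {fset V}) (s : {fset V}) (i : int).

Lemma positionD1 (v w : V) s : v \in s ->
  position w s = (position w (s `\ v)%fset + (v < w)%O)%N.
Proof.
move=> vs; rewrite /position.
have [vw|vw] := boolP (v < w)%O.
  rewrite (cardfsD1 v) !inE /= vs vw /= addnC; congr (_ + _)%N.
  by congr (#|` _|); apply/fsetP => u; rewrite !inE andbA.
rewrite addn0; congr (#|` _|); apply/fsetP => u; rewrite !inE.
have [->|//] := eqVneq u v; by rewrite (negbTE vw) andbF.
Qed.

Lemma face_in S (fS : face_closed S) (a : set_type S) t :
  (t `<=` val a)%fset -> exists b : set_type S, val b = t.
Proof.
move=> ta; have St : S t by apply: fS ta; apply: set_mem (valP a).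
by exists (exist _ t (mem_set St)).
Qed.

Lemma bd_bd S (c : chains S) : face_closed S -> bd (bd c) = 0.
Proof.
move=> fS; move: c.
apply: (@chain_ind _ _ _ _ (@bd _ _ S \o @bd _ _ S) \0) => a /=.
rewrite bd_generator raddf_sum /=.
pose F v w : chains S := ((-1) ^+ position v (val a)
   * (-1) ^+ position w (val a `\ v)%fset) *: generator S (val a `\ v `\ w)%fset.
have -> : \sum_(v <- val a) bd ((-1) ^+ position v (val a) *:
     generator S (val a `\ v)%fset) =
   \sum_(v <- val a) \sum_(w <- val a | w != v) F v w.
  apply: eq_bigr => v _.
  have [b bE] : exists b : set_type S, val b = (val a `\ v)%fset.
    exact: face_in (fsubD1set _ _).
  rewrite -bE raddfZsign /= bd_generator bE scaler_sumr -[RHS]big_filter.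
  rewrite (perm_big [seq w <- val a | w != v]) /=; last first.
    apply: uniq_perm; rewrite ?filter_uniq ?fset_uniq // => w.
    by rewrite mem_filter !inE.
  by apply: eq_bigr => w _; rewrite scalerA.
set D := LHS; suff DN : D = - D.
  apply/eqP/freeg_eqP => b; rewrite coeff0.
  by have /(congr1 (coeff b)) := DN; rewrite coeffN; lia.
rewrite {1}/D (exchange_big_dep xpredT) //= -sumrN big_seq [RHS]big_seq.
apply: eq_bigr => w wa; rewrite -sumrN big_seq_cond [RHS]big_seq_cond.
apply: eq_big => v; first by rewrite eq_sym.
move=> /andP[va vw]; rewrite /F fsetDDl fsetUC -fsetDDl -scaleNr.
congr (_ *: _); rewrite (positionD1 w va) (positionD1 v wa) !exprD.
have [lvw|lwv|e] := ltgtP v w; last by rewrite e eqxx in vw.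
  by rewrite expr0 expr1 mulr1 mulrN1 mulNr opprK mulrC.
by rewrite expr0 expr1 mulr1 mulrN1 mulNr mulrC.
Qed.
End BoundarySquare.

Section Homology.
Context {d : Order.disp_t} {V : orderType d}.
Variables (S T : set {fset V}) (i : int).

Definition cycles : {pred chains S} :=
  fun z => `[< has_degree i z /\ carried T (bd z) >].

Lemma cycles_zmod_closed : zmod_closed cycles.
Proof.
split=> [|y z].
  by apply/asboolP; split; [exact: has_degree0|rewrite raddf0; exact: carried0].
move=> /asboolP[dy cy] /asboolP[dz cz]; apply/asboolP; split.
  exact: has_degreeB.
by rewrite raddfB; exact: carriedB.
Qed.

HB.instance Definition _ :=
  GRing.isZmodClosed.Build (chains S) cycles cycles_zmod_closed.

Definition cycle_group : Type := {z : chains S | cycles z}.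

HB.instance Definition _ := SubType.on cycle_group.
HB.instance Definition _ := [Choice of cycle_group by <:].
HB.instance Definition _ := [SubChoice_isSubZmodule of cycle_group by <:].

Definition is_boundary (z : chains S) : Prop := exists w t : chains S,
  [/\ has_degree (i + 1) w, has_degree i t, carried T t & z = bd w + t].

Definition boundaries : {pred cycle_group} := fun z => `[< is_boundary (val z) >].

Lemma boundaries_zmod_closed : zmod_closed boundaries.
Proof.
split=> [|y z].
  apply/asboolP; exists 0, 0; split; rewrite ?raddf0 ?addr0 //;
    [exact: has_degree0|exact: has_degree0|exact: carried0].
move=> /asboolP[w [t [dw dt ct E]]] /asboolP[w' [t' [dw' dt' ct' E']]].
apply/asboolP; exists (w - w'), (t - t'); split.
- exact: has_degreeB.
- exact: has_degreeB.
- exact: carriedB.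
- by rewrite !raddfB /= E E' opprD addrACA.
Qed.

HB.instance Definition _ :=
  GRing.isZmodClosed.Build cycle_group boundaries boundaries_zmod_closed.

(* Chains of S with boundary in T, modulo boundaries of chains of S and chains
   of T. *)
Definition homology : zmodType := Quotient.quot boundaries.

Definition homology_class (z : chains S) : homology :=
  \pi_(Quotient.quot boundaries) (insubd (0 : cycle_group) z).

Definition representative (x : homology) : chains S :=
  val (repr (x : Quotient.quot boundaries)).

Lemma representative_cycle x : cycles (representative x).
Proof. exact: valP. Qed.

Lemma representativeK x : homology_class (representative x) = x.
Proof. by rewrite /homology_class /representative valKd reprK. Qed.

Lemma homology_class_eq y z : cycles y -> cycles z ->
  homology_class y = homology_class z <-> is_boundary (y - z).
Proof.
move=> cy cz; rewrite /homology_class.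
split=> [/eqP|b]; [|apply/eqP]; rewrite -Quotient.idealrBE.
  by move/asboolP; rewrite raddfB /= !insubdK.
by apply/asboolP; rewrite raddfB /= !insubdK.
Qed.

Lemma homology_classB y z : cycles y -> cycles z ->
  homology_class (y - z) = homology_class y - homology_class z.
Proof.
move=> cy cz; rewrite /homology_class -raddfB; congr (\pi _).
by apply: val_inj; rewrite raddfB /= !insubdK // (rpredB cy cz).
Qed.

End Homology.

Section HomologyMaps.
Context {d : Order.disp_t} {V : orderType d}.
Implicit Types (S T K L : set {fset V}) (i j : int).

(* The map induced by a homomorphism that respects cycles and boundaries. *)
Definition homology_map S T i S' T' i' (F : chains S -> chains S')
  (x : homology S T i) : homology S' T' i' :=
  homology_class T' i' (F (representative x)).

Definition respectful S T i S' T' i' (F : chains S -> chains S') : Prop :=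
  (forall z, cycles T i z -> cycles T' i' (F z)) /\
  (forall z, is_boundary T i z -> is_boundary T' i' (F z)).

Lemma homology_mapE S T i S' T' i' (F : {additive chains S -> chains S'}) z :
  respectful T i T' i' F -> cycles T i z ->
  homology_map T' i' F (homology_class T i z) = homology_class T' i' (F z).
Proof.
move=> [Fc Fb] cz; apply/homology_class_eq; rewrite -?raddfB.
- exact/Fc/representative_cycle.
- exact: Fc.
- apply/Fb/homology_class_eq => //; first exact: representative_cycle.
  exact: representativeK.
Qed.

Lemma homology_map_is_zmod_morphism S T i S' T' i'
    (F : {additive chains S -> chains S'}) :
  respectful T i T' i' F ->
  zmod_morphism (@homology_map S T i S' T' i' F).
Proof.
move=> rF x y; rewrite -{1}[x]representativeK -{1}[y]representativeK.
have [cx cy] := (representative_cycle x, representative_cycle y).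
rewrite -homology_classB // homology_mapE //; last exact: rpredB cx cy.
by rewrite raddfB homology_classB //; apply: rF.1.
Qed.

End HomologyMaps.

Section InducedMaps.
Context {d : Order.disp_t} {V : orderType d}.
Implicit Types (S T : set {fset V}) (s : {fset V}) (i j : int).

Lemma coeff_generator S (b : set_type S) s :
  coeff b (generator S s) != 0 -> val b = s.
Proof.
rewrite /generator; case: insubP => [a _ <-|_]; last by rewrite coeff0 eqxx.
by rewrite coeffU mul1r; have [->|] := eqVneq a b; rewrite ?eqxx.
Qed.

Lemma coeff_fglift S T (f : set_type S -> chains T) (c : chains S) b :
  coeff b (fglift f c) != 0 ->
  exists2 a, coeff a c != 0 & coeff b (f a) != 0.
Proof.
move=> bc; apply: contrapT => H; move/negP: bc; apply; apply/eqP.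
rewrite -[c]freeg_sumE !raddf_sum big_seq big1 // => a; rewrite mem_dom => ac.
rewrite /= liftU coeffZ; have [->|ba] := eqVneq (coeff b (f a)) 0.
  exact: mulr0.
by case: H; exists a.
Qed.

Lemma coeff_push S T (c : chains S) b : coeff b (push T c) != 0 ->
  exists2 a, coeff a c != 0 & val b = val a.
Proof. by move=> /coeff_fglift[a ac /coeff_generator]; exists a. Qed.

Lemma coeff_bd S (c : chains S) b : coeff b (bd c) != 0 ->
  exists a v, [/\ coeff a c != 0, v \in val a & val b = (val a `\ v)%fset].
Proof.
move=> /coeff_fglift[a ac]; rewrite raddf_sum => H.
apply: contrapT => H'; move/negP: H; apply; apply/eqP.
rewrite big_seq big1 // => v va; apply/eqP; apply: contraT.
rewrite /= coeffZ mulf_eq0 negb_or => /andP[_ /coeff_generator bE].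
by case: H'; exists a, v.
Qed.

Lemma has_degree_push S T i (c : chains S) :
  has_degree i c -> has_degree i (push T c).
Proof. by move=> dc b /coeff_push[a /dc + ->]. Qed.

Lemma carried_push S T U (c : chains S) : carried U c -> carried U (push T c).
Proof. by move=> cc b /coeff_push[a /cc + ->]. Qed.

Lemma has_degree_bd S i (c : chains S) :
  has_degree (i + 1) c -> has_degree i (bd c).
Proof.
move=> dc b /coeff_bd[a [v [/dc da va ->]]].
by move: da; rewrite (cardfsD1 v) va; lia.
Qed.

Lemma push_bd S T (c : chains S) : S `<=` T -> face_closed S ->
  push T (bd c) = bd (push T c).
Proof.
move=> ST cS; move: c.
apply: (@chain_ind _ _ _ _ (@push _ _ S T \o @bd _ _ S)
                           (@bd _ _ T \o @push _ _ S T)) => a /=.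
have [b bE] : exists b : set_type T, val b = val a.
  by exists (exist _ (val a) (mem_set (ST _ (set_mem (valP a))))).
rewrite bd_generator push_generator -bE bd_generator raddf_sum bE.
apply: eq_big_seq => v va /=; rewrite raddfZsign /=; congr (_ *: _).
have [e eE] := face_in cS (fsubD1set (val a) v).
by rewrite -eE push_generator.
Qed.

Lemma push_push S T U (c : chains S) : carried T c ->
  push U (push T c) = push U c.
Proof.
move=> cT; rewrite -[c]freeg_sumE !raddf_sum.
apply: eq_big_seq => a; rewrite mem_dom => /cT Ta.
have -> : [freeg [:: (coeff a c, a)]] = [freeg [:: (1%:Z, a)]] *~ coeff a c.
  by rewrite freegU_mulz intz.
rewrite !raddfMz /= -generatorE !push_generator; congr (_ *~ _).
have [b bE] : exists b : set_type T, val b = val a.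
  by exists (exist _ (val a) (mem_set Ta)).
by rewrite -bE push_generator.
Qed.

Lemma push_id S (c : chains S) : push S c = c.
Proof.
move: c; apply: (@chain_ind _ _ _ _ (@push _ _ S S) idfun) => a /=.
exact: push_generator.
Qed.

Lemma carried_pushK S T (c : chains S) : carried T c ->
  push S (push T c) = c.
Proof. by move=> cT; rewrite push_push // push_id. Qed.

Lemma carried_sub S T (c : chains S) : S `<=` T -> carried T c.
Proof. by move=> ST a _; apply/ST/set_mem/(valP a). Qed.

Lemma pushK S T (c : chains S) : S `<=` T -> push S (push T c) = c.
Proof. by move=> ST; apply: carried_pushK; apply: carried_sub. Qed.

Lemma respectful_push S T S' T' i : face_closed S -> S `<=` S' -> T `<=` T' ->
  respectful T i T' i (@push _ _ S S').
Proof.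
move=> cS SS' TT'; split=> z.
  move=> /asboolP[dz cz]; apply/asboolP; split; first exact: has_degree_push.
  by rewrite -push_bd //; apply: carried_push => a /cz/TT'.
move=> [w [t [dw dt ct ->]]]; exists (push S' w), (push S' t); split.
- exact: has_degree_push.
- exact: has_degree_push.
- by apply: carried_push => a /ct/TT'.
- by rewrite raddfD /= push_bd.
Qed.

Lemma respectful_push_bd S T i : face_closed S -> face_closed T -> T `<=` S ->
  respectful T (i + 1) set0 i (@push _ _ S T \o @bd _ _ S).
Proof.
move=> cS cT TS; split=> z /=.
  move=> /asboolP[dz cz]; apply/asboolP; split.
    exact/has_degree_push/has_degree_bd.
  suff -> : bd (push T (bd z)) = 0 by apply: carried0.
  rewrite -[LHS](pushK _ TS) push_bd // carried_pushK // bd_bd //.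
  exact: raddf0.
move=> [w [t [dw dt ct ->]]]; exists (push T t), 0; split.
- exact: has_degree_push.
- exact: has_degree0.
- exact: carried0.
- rewrite raddfD /= bd_bd // add0r addr0 -{1}[t](carried_pushK ct).
  by rewrite -push_bd // pushK.
Qed.

End InducedMaps.

(* The sum defining [cobd] is finite on a locally finite complex. *)
Lemma finite_cofaces d (V : orderType d) (X : metric_complex V)
    (b : set_type (simplices X)) :
  finite_set [set a : set_type (simplices X) |
              coeff b (bd (generator X (val a))) != 0].
Proof.
have Xb : simplices X (val b) by apply: set_mem (valP b).
have [v vb] : exists v, v \in val b.
  apply/fset0Pn; apply/eqP => b0; apply: (mc_complex X).1.
  by rewrite -b0.
have fv := mc_locally_finite X v.
apply: (@sub_finite_set _ _
  ((fun a : set_type (simplices X) => val a) @^-1` [set s | simplices X s /\ v \in s])).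
  move=> a /= /coeff_bd[a' [w [/coeff_generator aE _ bE]]].
  split; first exact: set_mem (valP a).
  rewrite aE in bE.
  by move: vb; rewrite bE !inE => /andP[].
by apply: finite_preimage => // x y _ _; exact: val_inj.
Qed.

Section SimplicialHomology.
Context {d : Order.disp_t} {V : orderType d}.
Implicit Types (A B K L : set {fset V}) (i : int).

Definition reduced_homology K i : zmodType := homology (aug K) set0 i.

(* The empty simplex contributes to both terms of the pair and cancels, so this
   is also the unreduced relative homology. *)
Definition relative_homology A B i : zmodType := homology (aug A) (aug B) i.

Definition reduced_incl K L i :
    reduced_homology K i -> reduced_homology L i :=
  homology_map set0 i (@push _ _ (aug K) (aug L)).

Definition relative_incl A B A' B' i :
    relative_homology A B i -> relative_homology A' B' i :=
  homology_map (aug B') i (@push _ _ (aug A) (aug A')).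

Definition to_relative A B i :
    reduced_homology A i -> relative_homology A B i :=
  homology_map (aug B) i (@push _ _ (aug A) (aug A)).

(* The class of a relative cycle z goes to that of its boundary. *)
Definition connecting A B i :
    relative_homology A B (i + 1) -> reduced_homology B i :=
  homology_map set0 i (@push _ _ (aug A) (aug B) \o @bd _ _ (aug A)).

Lemma aug_sub A B : A `<=` B -> aug A `<=` aug B.
Proof. by move=> AB; apply: setSU. Qed.

End SimplicialHomology.

Section HomologyHomomorphisms.
Context {d : Order.disp_t} {V : orderType d}.
Implicit Types (A B K L : set {fset V}) (i : int).

Lemma respectful_incl A B A' B' i : is_complex A -> A `<=` A' -> B `<=` B' ->
  respectful (aug B) i (aug B') i (@push _ _ (aug A) (aug A')).
Proof.
by move=> cA AA' BB'; apply: respectful_push;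
  [exact: face_closed_aug|exact: aug_sub|exact: aug_sub].
Qed.

Lemma respectful_reduced K L i : is_complex K -> K `<=` L ->
  respectful set0 i set0 i (@push _ _ (aug K) (aug L)).
Proof.
by move=> cK KL; apply: respectful_push;
  [exact: face_closed_aug|exact: aug_sub|].
Qed.

Lemma respectful_to_relative A B i : is_complex A ->
  respectful set0 i (aug B) i (@push _ _ (aug A) (aug A)).
Proof.
by move=> cA; apply: respectful_push; [exact: face_closed_aug| |exact: sub0set].
Qed.

Lemma respectful_connecting A B i : is_complex A -> is_complex B -> B `<=` A ->
  respectful (aug B) (i + 1) set0 i (@push _ _ (aug A) (aug B) \o @bd _ _ (aug A)).
Proof.
by move=> cA cB BA; apply: respectful_push_bd;
  [exact: face_closed_aug|exact: face_closed_aug|exact: aug_sub].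
Qed.

Lemma reduced_incl_id K i (x : reduced_homology K i) : reduced_incl K x = x.
Proof.
rewrite -[RHS]representativeK /reduced_incl /homology_map.
by rewrite push_id.
Qed.

Lemma reduced_inclE K L i z : is_complex K -> K `<=` L -> cycles set0 i z ->
  reduced_incl L (homology_class set0 i z : reduced_homology K i) =
  homology_class set0 i (push (aug L) z).
Proof. by move=> cK KL; apply: homology_mapE; apply: respectful_reduced. Qed.

Lemma relative_inclE A B A' B' i z :
  is_complex A -> A `<=` A' -> B `<=` B' -> cycles (aug B) i z ->
  relative_incl A' B' (homology_class (aug B) i z : relative_homology A B i) =
  homology_class (aug B') i (push (aug A') z).
Proof. by move=> cA AA' BB'; apply: homology_mapE; apply: respectful_incl. Qed.

Lemma to_relativeE A B i z : is_complex A -> cycles set0 i z ->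
  to_relative B (homology_class set0 i z : reduced_homology A i) =
  homology_class (aug B) i z.
Proof.
move=> cA cz; rewrite -[in RHS](push_id z).
by apply: homology_mapE cz; apply: respectful_to_relative.
Qed.

Lemma connectingE A B i z : is_complex A -> is_complex B -> B `<=` A ->
  cycles (aug B) (i + 1) z ->
  connecting (homology_class (aug B) (i + 1) z : relative_homology A B (i + 1)) =
  homology_class set0 i (push (aug B) (bd z)).
Proof.
move=> cA cB BA cz.
by rewrite /connecting homology_mapE //; apply: respectful_connecting.
Qed.

Lemma connecting_incl A B A' B' i (x : relative_homology A B (i + 1)) :
  is_complex A -> is_complex B -> is_complex A' -> is_complex B' ->
  B `<=` A -> B' `<=` A' -> A `<=` A' -> B `<=` B' ->
  connecting (relative_incl A' B' x) = reduced_incl B' (connecting x).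
Proof.
move=> cA cB cA' cB' BA BA' AA' BB'.
rewrite -[x]representativeK; have cz := representative_cycle x.
move: (representative x) cz => z cz.
rewrite relative_inclE // connectingE //; last first.
  exact: (respectful_incl (i + 1) cA AA' BB').1.
rewrite connectingE // reduced_inclE //; last first.
  exact: (respectful_connecting i cA cB BA).1.
congr homology_class.
rewrite -push_bd; [|exact: aug_sub|exact: face_closed_aug].
have /asboolP[_ cbz] := cz.
by rewrite !push_push //; exact: carried_sub (aug_sub AA').
Qed.

Lemma to_relative_incl A B A' B' i (x : reduced_homology A i) :
  is_complex A -> is_complex A' -> A `<=` A' -> B `<=` B' ->
  relative_incl A' B' (to_relative B x) = to_relative B' (reduced_incl A' x).
Proof.
move=> cA cA' AA' BB'.
rewrite -[x]representativeK; have cz := representative_cycle x.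
move: (representative x) cz => z cz.
rewrite to_relativeE // relative_inclE //; last first.
  by rewrite -[z]push_id; exact: (respectful_to_relative B i cA).1.
rewrite reduced_inclE // to_relativeE //.
exact: (respectful_reduced i cA AA').1.
Qed.

End HomologyHomomorphisms.

Record inverse_system := InverseSystem {
  is_index : Type;
  is_le : is_index -> is_index -> Prop;
  is_group : is_index -> zmodType;
  is_bond : forall a b, is_le a b -> {additive is_group b -> is_group a} }.

Definition product (I : Type) (G : I -> zmodType) : Type := forall a, G a.

Section Product.
Variables (I : Type) (G : I -> zmodType).
Implicit Types x y z : product G.

HB.instance Definition _ := gen_eqMixin (product G).
HB.instance Definition _ := gen_choiceMixin (product G).

Definition product_zero : product G := fun=> 0.
Definition product_opp x : product G := fun a => - x a.
Definition product_add x y : product G := fun a => x a + y a.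

Lemma product_addA : associative product_add.
Proof. by move=> x y z; apply: functional_extensionality_dep => a; apply: addrA. Qed.

Lemma product_addC : commutative product_add.
Proof. by move=> x y; apply: functional_extensionality_dep => a; apply: addrC. Qed.

Lemma product_add0 : left_id product_zero product_add.
Proof. by move=> x; apply: functional_extensionality_dep => a; apply: add0r. Qed.

Lemma product_addN : left_inverse product_zero product_opp product_add.
Proof. by move=> x; apply: functional_extensionality_dep => a; apply: addNr. Qed.

HB.instance Definition _ := GRing.isZmodule.Build (product G)
  product_addA product_addC product_add0 product_addN.

End Product.

Section InverseLimit.
Variable s : inverse_system.

Definition compatible : {pred product (@is_group s)} := fun x =>
  `[< forall a b (h : is_le a b), is_bond h (x b) = x a >].

Lemma compatible_zmod_closed : zmod_closed compatible.
Proof.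
split=> [|x y /asboolP hx /asboolP hy]; apply/asboolP => a b h.
  exact: raddf0.
by rewrite -[(x - y) b]/(x b - y b) raddfB hx hy.
Qed.

HB.instance Definition _ := GRing.isZmodClosed.Build (product (@is_group s))
  compatible compatible_zmod_closed.

Definition inverse_limit : Type :=
  {x : product (@is_group s) | compatible x}.

HB.instance Definition _ := SubType.on inverse_limit.
HB.instance Definition _ := [Choice of inverse_limit by <:].
HB.instance Definition _ := [SubChoice_isSubZmodule of inverse_limit by <:].

Lemma bond_val a b (h : is_le a b) (x : inverse_limit) :
  is_bond h (val x b) = val x a.
Proof. by have /asboolP := valP x; apply. Qed.

Definition inverse_limit_of (x : product (@is_group s))
    (hx : forall a b (h : is_le a b), is_bond h (x b) = x a) : inverse_limit :=
  exist _ x (asboolT hx).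

End InverseLimit.

Section Cech.
Context {R : realType} {d : Order.disp_t} {V : orderType d}.
Variable X : metric_complex V.
Implicit Types (A : set (V -> R)) (i : int).

Definition neighborhood A (L : set {fset V}) : Prop :=
  subcomplex X L /\ exists r : R, realization L `<=` tube X r A.

Definition neighborhood_pair A0 A1 (L : set {fset V} * set {fset V}) : Prop :=
  [/\ neighborhood A0 L.1, neighborhood A1 L.2 & L.2 `<=` L.1].

Definition neighborhoods A : Type := {L : set {fset V} | neighborhood A L}.

Definition neighborhood_pairs A0 A1 : Type :=
  {L : set {fset V} * set {fset V} | neighborhood_pair A0 A1 L}.

Lemma closure_compl_complex L : is_complex (closure_compl X L).
Proof.
split=> [[/eqP//]|t u [t0 [s [Xs Ls ts]]] ut u0]; split => //.
by exists s; split => //; apply: fsubset_trans ts.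
Qed.

Lemma closure_compl_sub L L' : L `<=` L' ->
  closure_compl X L' `<=` closure_compl X L.
Proof.
by move=> LL' t [t0 [s [Xs Ls ts]]]; split=> //; exists s; split=> // /LL'.
Qed.

Section ReducedBond.
Variables (A : set (V -> R)) (i : int) (L L' : neighborhoods A).
Hypothesis LL' : sval L `<=` sval L'.

Definition reduced_bond :
    reduced_homology (closure_compl X (sval L')) i ->
    reduced_homology (closure_compl X (sval L)) i :=
  let _ := LL' in @reduced_incl _ _ _ _ i.

Lemma reduced_bond_is_zmod_morphism : zmod_morphism reduced_bond.
Proof.
exact: homology_map_is_zmod_morphism (respectful_reduced i
  (@closure_compl_complex _) (closure_compl_sub LL')).
Qed.

HB.instance Definition _ := GRing.isZmodMorphism.Build
  (reduced_homology (closure_compl X (sval L')) i)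
  (reduced_homology (closure_compl X (sval L)) i)
  reduced_bond reduced_bond_is_zmod_morphism.
End ReducedBond.

Section RelativeBond.
Variables (A0 A1 : set (V -> R)) (i : int) (L L' : neighborhood_pairs A0 A1).
Hypothesis LL' : (sval L).1 `<=` (sval L').1 /\ (sval L).2 `<=` (sval L').2.

Definition relative_bond :
    relative_homology (closure_compl X (sval L').2)
                      (closure_compl X (sval L').1) i ->
    relative_homology (closure_compl X (sval L).2)
                      (closure_compl X (sval L).1) i :=
  let _ := LL' in @relative_incl _ _ _ _ _ _ i.

Lemma relative_bond_is_zmod_morphism : zmod_morphism relative_bond.
Proof.
exact: homology_map_is_zmod_morphism (respectful_incl i
  (@closure_compl_complex _) (closure_compl_sub LL'.2)
  (closure_compl_sub LL'.1)).
Qed.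

HB.instance Definition _ := GRing.isZmodMorphism.Build
  (relative_homology (closure_compl X (sval L').2)
                     (closure_compl X (sval L').1) i)
  (relative_homology (closure_compl X (sval L).2)
                     (closure_compl X (sval L).1) i)
  relative_bond relative_bond_is_zmod_morphism.
End RelativeBond.

Definition reduced_system A i : inverse_system :=
  {| is_index := neighborhoods A;
     is_le := fun L L' => sval L `<=` sval L';
     is_group := fun L => reduced_homology (closure_compl X (sval L)) i;
     is_bond := fun L L' h => @reduced_bond A i L L' h |}.

Definition relative_system A0 A1 i : inverse_system :=
  {| is_index := neighborhood_pairs A0 A1;
     is_le := fun L L' =>
       (sval L).1 `<=` (sval L').1 /\ (sval L).2 `<=` (sval L').2;
     is_group := fun L => relative_homology (closure_compl X (sval L).2)
                                            (closure_compl X (sval L).1) i;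
     is_bond := fun L L' h => @relative_bond A0 A1 i L L' h |}.

Definition cech_reduced A i : zmodType := inverse_limit (reduced_system A i).

Definition cech_relative A1 A0 i : zmodType :=
  inverse_limit (relative_system A0 A1 i).

Definition first A0 A1 (L : neighborhood_pairs A0 A1) : neighborhoods A0 :=
  exist _ (sval L).1 (let: And3 h _ _ := svalP L in h).

Definition second A0 A1 (L : neighborhood_pairs A0 A1) : neighborhoods A1 :=
  exist _ (sval L).2 (let: And3 _ h _ := svalP L in h).

End Cech.

Section CechMaps.
Context {R : realType} {d : Order.disp_t} {V : orderType d}.
Variables (X : metric_complex V) (A0 A1 : set (V -> R)).
Hypothesis A10 : A1 `<=` A0.
Implicit Types i : int.

Lemma neighborhood_widen L : neighborhood X A1 L -> neighborhood X A0 L.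
Proof.
move=> [sL [r Lr]]; split=> //; exists r => x /Lr[Xx [a Aa ax]].
by split=> //; exists a => //; apply: A10.
Qed.

Definition widen (L : neighborhoods X A1) : neighborhoods X A0 :=
  exist _ (sval L) (neighborhood_widen (svalP L)).

Lemma neighborhood_pair_set0 (L : neighborhoods X A0) :
  neighborhood_pair X A0 A1 (sval L, set0).
Proof.
split; [exact: (svalP L)| |exact: sub0set].
by split; [split; [split=> // s t []|exact: sub0set]|exists 0 => x [s []]].
Qed.

Definition pair_with_empty (L : neighborhoods X A0) :
    neighborhood_pairs X A0 A1 :=
  exist _ (sval L, set0) (neighborhood_pair_set0 L).

Lemma cech_incl_compatible i (x : cech_reduced X A0 i) :
  forall L L' (h : @is_le (reduced_system X A1 i) L L'),
  is_bond h (val x (widen L')) = val x (widen L).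
Proof.
by move=> L L' h; exact: (@bond_val (reduced_system X A0 i) (widen L) (widen L')).
Qed.

Definition cech_incl i (x : cech_reduced X A0 i) : cech_reduced X A1 i :=
  inverse_limit_of (@cech_incl_compatible i x).

Lemma val_cech_incl i (x : cech_reduced X A0 i)
    (L : neighborhood_pairs X A0 A1) :
  val (cech_incl x) (second L) = reduced_incl _ (val x (first L)).
Proof.
have h : @is_le (reduced_system X A0 i) (widen (second L)) (first L).
  by case: L => L [].
by rewrite /= -[LHS](bond_val h).
Qed.

Lemma cech_to_relative_compatible i (x : cech_reduced X A1 i) :
  forall L L' (h : @is_le (relative_system X A0 A1 i) L L'),
  is_bond h (to_relative _ (val x (second L'))) =
  to_relative _ (val x (second L)).
Proof.
move=> L L' h.
have h2 : @is_le (reduced_system X A1 i) (second L) (second L') by case: h.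
rewrite -[val x (second L)](bond_val h2).
apply: to_relative_incl; try exact: closure_compl_complex.
- exact: closure_compl_sub h.2.
- exact: closure_compl_sub h.1.
Qed.

Definition cech_to_relative i (x : cech_reduced X A1 i) :
    cech_relative X A1 A0 i :=
  inverse_limit_of (@cech_to_relative_compatible i x).

Lemma val_cech_to_relative i (x : cech_reduced X A1 i)
    (L : neighborhood_pairs X A0 A1) :
  val (cech_to_relative x) L = to_relative _ (val x (second L)).
Proof. by []. Qed.

Lemma connecting_first i (x : cech_relative X A1 A0 (i + 1))
    (L : neighborhood_pairs X A0 A1) (L0 : neighborhoods X A0) :
  sval L0 `<=` (sval L).1 ->
  reduced_incl (closure_compl X (sval L0)) (connecting (val x L)) =
  connecting (val x (pair_with_empty L0)).
Proof.
move=> h; have h' : @is_le (relative_system X A0 A1 (i + 1)) (pair_with_empty L0) L.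
  by split=> //; exact: sub0set.
rewrite -[val x (pair_with_empty L0)](bond_val h') /=.
have [sL [_ _ L10]] := (h, svalP L).
apply/esym/connecting_incl; try exact: closure_compl_complex;
  apply: closure_compl_sub => //; exact: sub0set.
Qed.

Lemma cech_connecting_compatible i (x : cech_relative X A1 A0 (i + 1)) :
  forall L L' (h : @is_le (reduced_system X A0 i) L L'),
  is_bond h (connecting (val x (pair_with_empty L'))) =
  connecting (val x (pair_with_empty L)).
Proof. by move=> L L' h; exact: (@connecting_first i x (pair_with_empty L')). Qed.

(* Any neighborhood pair with first term L0 gives the same value at L0, see
   [val_cech_connecting]. *)
Definition cech_connecting i (x : cech_relative X A1 A0 (i + 1)) :
    cech_reduced X A0 i :=
  inverse_limit_of (@cech_connecting_compatible i x).

Lemma val_cech_connecting i (x : cech_relative X A1 A0 (i + 1))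
    (L : neighborhood_pairs X A0 A1) :
  val (cech_connecting x) (first L) = connecting (val x L).
Proof.
rewrite -[RHS]reduced_incl_id.
exact/esym/(@connecting_first i x L (first L)).
Qed.

Lemma cech_incl_is_zmod_morphism i : zmod_morphism (@cech_incl i).
Proof. by move=> x y; apply: val_inj. Qed.

Lemma cech_to_relative_is_zmod_morphism i : zmod_morphism (@cech_to_relative i).
Proof.
move=> x y; apply: val_inj; apply: functional_extensionality_dep => L.
exact: (homology_map_is_zmod_morphism
  (respectful_to_relative _ i (@closure_compl_complex _ _ _ _))).
Qed.

Lemma cech_connecting_is_zmod_morphism i : zmod_morphism (@cech_connecting i).
Proof.
move=> x y; apply: val_inj; apply: functional_extensionality_dep => L.
apply: (homology_map_is_zmod_morphism (respectful_connecting i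
  (@closure_compl_complex _ _ _ _) (@closure_compl_complex _ _ _ _) _)).
exact: closure_compl_sub (@sub0set _ _).
Qed.

HB.instance Definition _ i := GRing.isZmodMorphism.Build
  (cech_reduced X A0 i) (cech_reduced X A1 i) (@cech_incl i)
  (@cech_incl_is_zmod_morphism i).
HB.instance Definition _ i := GRing.isZmodMorphism.Build
  (cech_reduced X A1 i) (cech_relative X A1 A0 i) (@cech_to_relative i)
  (@cech_to_relative_is_zmod_morphism i).
HB.instance Definition _ i := GRing.isZmodMorphism.Build
  (cech_relative X A1 A0 (i + 1)) (cech_reduced X A0 i) (@cech_connecting i)
  (@cech_connecting_is_zmod_morphism i).

End CechMaps.

Arguments cech_incl {R d V} X {A0 A1} A10 i x.
Arguments cech_to_relative {R d V} X A0 A1 i x.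
Arguments cech_connecting {R d V} X A0 A1 i x.

Definition exact_at (G H K : zmodType) (f : {additive G -> H})
    (g : {additive H -> K}) : Prop :=
  forall y, g y = 0 <-> exists x, f x = y.

Section CoarsePD.
Context (R : realType) {d : Order.disp_t} {V : orderType d}.
Implicit Types X : metric_complex V.

(* The empty subcomplex is excluded: it has reduced homology in degree -1
   whatever the neighborhood. *)
Definition uniformly_acyclic X : Prop :=
  exists2 m : int, has_dimension X m &
  forall (j : int) (r1 : R), j <= m -> 0 < r1 ->
  exists2 r2 : nat, (0 < r2)%N &
  forall K, subcomplex X K -> K !=set0 -> diam_le X K r1 ->
  forall x : reduced_homology K j, reduced_incl (star_nbhd X r2 K) x = 0.

Section Control.
Variable X : metric_complex V.

Definition support (A : set (chains X)) : set {fset V} :=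
  [set t | t != fset0 /\
     exists c a, [/\ A c, coeff a c != 0 & (t `<=` val a)%fset]].

Definition chain_displacement (D : nat) (h : chains X -> chains X) : Prop :=
  forall s, simplices X s ->
  support [set h (generator X s)] `<=` star_nbhd X D (closed_simplex s).

Definition on_simplex (s : {fset V}) (h : chains X -> chains X) :
    set (chains X) :=
  [set h (push X c) | c in [set: chains (closed_simplex s)]].

Definition cochain_displacement (D : nat) (h : chains X -> chains X) : Prop :=
  forall s, simplices X s ->
  support (on_simplex s h) `<=` star_nbhd X D (closed_simplex s).

Definition controlled (D : nat) (h : chains X -> chains X) : Prop :=
  forall s, simplices X s -> diam_le X (support (on_simplex s h)) (D%:R : R).

End Control.

(* The cochain complex C_{n-*} has the chains of degree n - k in degree k. *)
Record coarse_PD (n : nat) X : Type := CoarsePD {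
  pd_geometry : bounded_geometry X;
  pd_acyclic : uniformly_acyclic X;
  pd_Pbar : {additive chains X -> chains X};
  pd_P : {additive chains X -> chains X};
  pd_Pbar_degree : forall (k : int) c,
    has_degree (n%:Z - k) c -> has_degree k (pd_Pbar c);
  pd_P_degree : forall (k : int) u,
    has_degree k u -> has_degree (n%:Z - k) (pd_P u);
  pd_Pbar_cochain : forall c, pd_Pbar (bd c) = cobd (pd_Pbar c);
  pd_P_cochain : forall u, pd_P (cobd u) = bd (pd_P u);
  pd_E0 : nat;
  pd_Pbar_displacement : chain_displacement pd_E0 pd_Pbar;
  pd_P_displacement : cochain_displacement pd_E0 pd_P;
  pd_homotopy_cochain : exists H : {additive chains X -> chains X},
    [/\ forall (k : int) u, has_degree k u -> has_degree (k - 1) (H u),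
        forall u, pd_Pbar (pd_P u) - u = cobd (H u) + H (cobd u)
      & controlled pd_E0 H];
  pd_homotopy_chain : exists H : {additive chains X -> chains X},
    [/\ forall (k : int) c, has_degree k c -> has_degree (k + 1) (H c),
        forall c, pd_P (pd_Pbar c) - c = bd (H c) + H (bd c)
      & controlled pd_E0 H] }.

End CoarsePD.

(* Main.v *)
(* The limit of a tower of long exact sequences is exact as soon as the towers
   of kernels satisfy the Mittag-Leffler condition.  For the homology of the
   complements of the r-neighborhoods of f(Z) this comes from Alexander duality,
   in the following chain-level form.  Filling cycles by uniform acyclicity gives
   chain maps C(X) -> C(Z) -> C(X) whose composite Phi has its image near f(Z),
   and a homotopy h from the identity to Phi which is controlled on each
   neighborhood of f(Z).  A cycle z far from f(Z) bounds some w in X, and z is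
   homologous, far from f(Z), to the boundary of P c for the cochain c = Pbar w.
   The coboundary of c vanishes near f(Z), so that up to a coboundary and an error
   supported far away c can be replaced with the pullback of c by Phi, cut off at
   an arbitrarily large distance.  This pulled back cochain is closed up to that
   distance, hence z is homologous to a cycle as far away as desired; and it is
   zero when w, and thus c, vanishes near f(Z), in which case z bounds far away. *)

(* The neighborhoods of the image are replaced with a cofinal sequence of full subcomplexes, the
   level sets, since the Mittag-Leffler condition lifts elements to the limit only along a sequence.
   As [f] need not be continuous, levels are measured from a map [F] of vertices, the same for [Z0]
   and [Z1], so that the two sequences form pairs. The kernels of [connecting] and [to_relative] are
   images of reduced homology groups and inherit stability from them. The kernel of the map from the
   complements for [Z0] to those for [Z1] is not of this kind: there [boundaries_lift] is needed as
   well. The obstacle on chains is that [Phi] collapses all of X to a neighborhood of the image. It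
   can be controlled only level by level, and the pullback of a compactly supported cochain need not
   have compact support. The cut-off restores compactness, at the price of a coboundary beyond the
   cut-off level; this coboundary is what carries the cycle away. *)
Require Import Defs.
From HB Require Import structures.
From mathcomp Require Import all_boot all_order all_algebra finmap.
From mathcomp Require Import boolp classical_sets functions cardinality reals.
From mathcomp Require Import fsbigop freeg zify lra.

Set Implicit Arguments.
Unset Strict Implicit.
Unset Printing Implicit Defensive.

Import Order.TTheory GRing.Theory Num.Theory.
Local Open Scope classical_set_scope.
Local Open Scope ring_scope.

(** * Chains and their coefficients *)

Section Coefficients.
Context {d : Order.disp_t} {V : orderType d}.
Implicit Types (S T : set {fset V}) (s t : {fset V}).

(** Indexing coefficients by all finite sets, with value 0 outside [S], lets chains over different
    [S] be compared without transporting simplices between subtypes. *)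
Definition coefs S (c : chains S) s : int :=
  if insub s is Some a then coeff a c else 0.

Lemma coefs_val S (c : chains S) (a : set_type S) : coefs c (val a) = coeff a c.
Proof. by rewrite /coefs valK. Qed.

Lemma coefs_out S (c : chains S) s : ~ S s -> coefs c s = 0.
Proof.
move=> Ss; rewrite /coefs; case: insubP => // a sS _.
by case: Ss; apply: set_mem.
Qed.

Lemma set_typeP S s : S s -> exists a : set_type S, val a = s.
Proof. by move=> Ss; exists (exist _ s (mem_set Ss)). Qed.

Lemma coefs_in S (c : chains S) s : coefs c s != 0 -> S s.
Proof. by move=> c0; apply: contrapT => /(coefs_out c) E; rewrite E eqxx in c0. Qed.

Lemma coefs_ext S (c c' : chains S) : coefs c =1 coefs c' -> c = c'.
Proof. by move=> E; apply/eqP/freeg_eqP => a; rewrite -!coefs_val E. Qed.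

Lemma coefs0 S s : coefs (0 : chains S) s = 0.
Proof. by rewrite /coefs; case: insubP => // a _ _; rewrite coeff0. Qed.

Lemma coefsB S (b c : chains S) s : coefs (b - c) s = coefs b s - coefs c s.
Proof.
by rewrite /coefs; case: insubP => [a _ _|_]; rewrite ?coeffB ?subr0.
Qed.

Lemma coefsN S (c : chains S) s : coefs (- c) s = - coefs c s.
Proof. by rewrite -sub0r coefsB coefs0 sub0r. Qed.

Lemma coefsD S (b c : chains S) s : coefs (b + c) s = coefs b s + coefs c s.
Proof. by rewrite -{1}[c]opprK coefsB coefsN opprK. Qed.

Lemma coefsZ S (k : int) (c : chains S) s : coefs (k *: c) s = k * coefs c s.
Proof.
by rewrite /coefs; case: insubP => [a _ _|_]; rewrite ?coeffZ ?mulr0.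
Qed.

Lemma coefs_sum S (I : Type) (r : seq I) (P : pred I) (F : I -> chains S) s :
  coefs (\sum_(i <- r | P i) F i) s = \sum_(i <- r | P i) coefs (F i) s.
Proof.
by apply: (big_morph (fun c => coefs c s)) => [b c|]; rewrite ?coefsD ?coefs0.
Qed.

Lemma coefs_generator S s t : S s -> coefs (generator S s) t = (s == t)%:R.
Proof.
move=> /set_typeP[a <-]; rewrite generatorE /coefs.
case: insubP => [b _ <-|tS]; first by rewrite coeffU mul1r.
case: eqP => // E; case/negP: tS; rewrite -E; exact: valP.
Qed.

Lemma coefs_generator_neq0 S s t : coefs (generator S s) t != 0 -> s = t /\ S s.
Proof.
have [Ss|/generator_out ->] := pselect (S s); last by rewrite coefs0 eqxx.
by rewrite coefs_generator //; have [<-|_] := eqVneq s t; rewrite ?eqxx.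
Qed.

(** Differences suffice: they give opposites and sums, hence all integer multiples of generators. *)
Lemma chain_span S (P : chains S -> Prop) : P 0 ->
  (forall s, S s -> P (generator S s)) ->
  (forall b c, P b -> P c -> P (b - c)) -> forall c, P c.
Proof.
move=> P0 PG PB c.
have PN b : P b -> P (- b) by rewrite -sub0r; exact: PB.
have PD b b' : P b -> P b' -> P (b + b').
  by move=> hb /PN hb'; rewrite -[b']opprK; exact: PB.
rewrite -[c]freeg_sumE; apply: big_ind => // a _.
have -> : [freeg [:: (coeff a c, a)]] = generator S (val a) *~ coeff a c.
  by rewrite generatorE freegU_mulz intz.
have Pa : P (generator S (val a)) by apply: PG; apply: set_mem (valP a).
have Pn n : P (generator S (val a) *+ n).
  by elim: n => [|n IH]; rewrite ?mulr0n ?mulrS //; exact: PD.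
by case: (coeff a c) => n; [exact: Pn|rewrite NegzE mulrNz; exact/PN/Pn].
Qed.

Lemma coefs_push S T (c : chains S) s : T s -> coefs (push T c) s = coefs c s.
Proof.
move=> Ts; move: c; apply: chain_span => [|t St|b c Hb Hc].
- by rewrite raddf0 !coefs0.
- have [a E] := set_typeP St; rewrite -E push_generator E (coefs_generator _ St).
  have [Tt|Tt] := pselect (T t); first by rewrite coefs_generator.
  by rewrite generator_out // coefs0; case: eqP Tt => // ->.
- by rewrite raddfB !coefsB Hb Hc.
Qed.

Lemma push_generator_in S T s : S s -> push T (generator S s) = generator T s.
Proof. by move=> /set_typeP[a <-]; exact: push_generator. Qed.

Lemma bd_generator_in S s : S s -> bd (generator S s) =
  \sum_(v <- s) (-1) ^+ position v s *: generator S (s `\ v)%fset.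
Proof. by move=> /set_typeP[a <-]; exact: bd_generator. Qed.

Lemma carriedP S T (c : chains S) :
  carried T c <-> forall s, coefs c s != 0 -> T s.
Proof.
split=> [H s cs|H a]; last by rewrite -coefs_val; exact: H.
have [a E] := set_typeP (coefs_in cs); rewrite -E in cs *.
by apply: H; rewrite -coefs_val.
Qed.

Lemma has_degreeP S i (c : chains S) :
  has_degree i c <-> forall s, coefs c s != 0 -> (#|` s|)%:Z = i + 1.
Proof.
split=> [H s cs|H a]; last by rewrite -coefs_val; exact: H.
have [a E] := set_typeP (coefs_in cs); rewrite -E in cs *.
by apply: H; rewrite -coefs_val.
Qed.

Lemma has_degreeD S i (b c : chains S) :
  has_degree i b -> has_degree i c -> has_degree i (b + c).
Proof.
move=> hb hc; rewrite -[c]opprK -[- c]sub0r; apply: has_degreeB => //.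
by apply: has_degreeB => //; exact: has_degree0.
Qed.

Lemma has_degreeN S i (c : chains S) : has_degree i c -> has_degree i (- c).
Proof. by move=> hc; rewrite -sub0r; apply: has_degreeB => //; exact: has_degree0. Qed.

Lemma carriedN S T (c : chains S) : carried T c -> carried T (- c).
Proof. by move=> hc; rewrite -sub0r; apply: carriedB => //; exact: carried0. Qed.

Lemma has_degree_generator S s : has_degree ((#|` s|)%:Z - 1) (generator S s).
Proof. by apply/has_degreeP => t /coefs_generator_neq0[-> _]; rewrite subrK. Qed.

Lemma carried_set0 S (c : chains S) : carried set0 c -> c = 0.
Proof.
move=> /carriedP H; apply: coefs_ext => s; rewrite coefs0; apply/eqP.
by apply: contrapT => /negP /H.
Qed.

Lemma coefs_bd_neq0 S (c : chains S) t : coefs (bd c) t != 0 ->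
  exists s v, [/\ coefs c s != 0, v \in s & t = (s `\ v)%fset].
Proof.
move=> ct; have [b E] := set_typeP (coefs_in ct).
move: ct; rewrite -E coefs_val => /coeff_bd[a [v [ac va bE]]].
by exists (val a), v; split; rewrite ?coefs_val.
Qed.

(* The value of a possibly infinite cochain [u] on a chain. *)
Definition ev S (u : {fset V} -> int) : chains S -> int :=
  fglift (fun a : set_type S => u (val a) : int^o).

HB.instance Definition _ S u :=
  GRing.isZmodMorphism.Build (chains S) int (@ev S u)
    (fglift_is_zmod_morphism (fun a : set_type S => u (val a) : int^o)).

Lemma ev_generator S u s : S s -> ev u (generator S s) = u s.
Proof. by move=> /set_typeP[a <-]; rewrite generatorE /ev liftU scale1r. Qed.

Lemma ev_coefs_generator S s (c : chains S) :
  ev (fun t => (s == t)%:R) c = coefs c s.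
Proof.
elim/chain_span: c => [|t St|b c Hb Hc]; first by rewrite raddf0 coefs0.
  by rewrite ev_generator // coefs_generator // eq_sym.
by rewrite raddfB coefsB /= Hb Hc.
Qed.

Lemma ev_neq0 S u (c : chains S) : ev u c != 0 ->
  exists s, coefs c s != 0 /\ u s != 0.
Proof.
move=> uc; apply: contrapT => H; move/negP: uc; apply; apply/eqP.
rewrite -[c]freeg_sumE raddf_sum big_seq big1 // => a; rewrite mem_dom => ac.
have -> : [freeg [:: (coeff a c, a)]] = generator S (val a) *~ coeff a c.
  by rewrite generatorE freegU_mulz intz.
rewrite raddfMz /= ev_generator; last exact: set_mem (valP a).
have -> : u (val a) = 0; last by rewrite mul0rz.
by apply: contrapT => /eqP ua; apply: H; exists (val a); rewrite coefs_val.
Qed.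

Lemma eq_ev S u u' (c : chains S) :
  (forall s, coefs c s != 0 -> u s = u' s) -> ev u c = ev u' c.
Proof.
move=> E; rewrite -[c]freeg_sumE !raddf_sum big_seq [RHS]big_seq.
apply: eq_bigr => a; rewrite mem_dom => ac.
have -> : [freeg [:: (coeff a c, a)]] = generator S (val a) *~ coeff a c.
  by rewrite generatorE freegU_mulz intz.
have Sa : S (val a) by exact: set_mem (valP a).
by rewrite !raddfMz /= !ev_generator // E // coefs_val.
Qed.

Lemma evBl S u u' (c : chains S) : ev (fun s => u s - u' s) c = ev u c - ev u' c.
Proof.
elim/chain_span: c => [|t St|b c Hb Hc]; first by rewrite !raddf0 subr0.
  by rewrite !ev_generator.
by rewrite !raddfB /= Hb Hc; lia.
Qed.

Lemma ev_push S T u (c : chains S) : (forall s, ~ T s -> u s = 0) ->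
  ev u (push T c) = ev u c.
Proof.
move=> uT; elim/chain_span: c => [|t St|b c Hb Hc]; first by rewrite !raddf0.
  rewrite push_generator_in //; have [Tt|Tt] := pselect (T t).
    by rewrite !ev_generator.
  by rewrite generator_out // raddf0 ev_generator // uT.
by rewrite !raddfB /= Hb Hc.
Qed.

(** The cochain on the left is the transpose of [f] applied to [u]; this adjunction is behind the
    pullbacks of cochains. *)
Lemma ev_comp S T u (f : {additive chains S -> chains T}) (c : chains S) :
  ev (fun s => ev u (f (generator S s))) c = ev u (f c).
Proof.
elim/chain_span: c => [|t St|b c Hb Hc]; first by rewrite !raddf0.
  by rewrite ev_generator.
by rewrite !raddfB /= Hb Hc.
Qed.

(* The chain with coefficients [u], junk when [u] has infinite support in [S]. *)
Definition mkchain S (u : {fset V} -> int) : chains S :=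
  \sum_(a <- fset_set [set a : set_type S | u (val a) != 0])
    u (val a) *: generator S (val a).

Lemma coefs_mkchain S u s : finite_set [set s | S s /\ u s != 0] -> S s ->
  coefs (mkchain S u) s = u s.
Proof.
move=> fu Ss; have fa : finite_set [set a : set_type S | u (val a) != 0].
  apply: (@sub_finite_set _ _ (val @^-1` [set s | S s /\ u s != 0])).
    by move=> a /= ua; split=> //; exact: set_mem (valP a).
  by apply: finite_preimage fu => x y _ _; exact: val_inj.
have [b Eb] := set_typeP Ss; rewrite -Eb /mkchain coefs_sum.
have Sv (a : set_type S) : S (val a) by exact: set_mem (valP a).
under eq_bigr do rewrite coefsZ coefs_generator //.
have [bs|bs] := boolP (b \in fset_set [set a : set_type S | u (val a) != 0]).
  rewrite (bigD1_seq b) ?fset_uniq //= eqxx mulr1 big1 ?addr0 // => a ab.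
  by case: eqP => [E|_]; rewrite ?mulr0 //; case/eqP: ab; exact: val_inj.
have -> : u (val b) = 0.
  by apply: contrapT => /eqP ub; move/negP: bs; apply; rewrite in_fset_set // inE.
rewrite big_seq big1 // => a ab.
by case: eqP => [E|_]; rewrite ?mulr0 //; case/negP: bs; rewrite -(_ : a = b) //; exact: val_inj.
Qed.

End Coefficients.

(** Reduces the support of an image to the images of single simplices, for which displacement and
    tameness are stated. *)
Lemma coefs_additive_neq0 d d' (V : orderType d) (W : orderType d')
    (S : set {fset V}) (T : set {fset W}) (f : {additive chains S -> chains T}) c t :
  coefs (f c) t != 0 ->
  exists s, coefs c s != 0 /\ coefs (f (generator S s)) t != 0.
Proof.
move=> fc; apply: contrapT => H; move/negP: fc; apply; apply/eqP.
rewrite -[c]freeg_sumE raddf_sum coefs_sum big_seq big1 // => a; rewrite mem_dom => ac.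
have -> : [freeg [:: (coeff a c, a)]] = generator S (val a) *~ coeff a c.
  by rewrite generatorE freegU_mulz intz.
rewrite raddfMz -scaler_int coefsZ; apply/eqP; rewrite mulf_eq0; apply/orP; right.
apply: contrapT => /negP H'; apply: H; exists (val a); split => //.
by rewrite coefs_val.
Qed.

(** * The coboundary as the transpose of the boundary *)

Section Coboundary.
Context {d : Order.disp_t} {V : orderType d}.
Variable X : metric_complex V.

Lemma coefs_cobd (c : chains X) s : simplices X s ->
  coefs (cobd c) s = ev (coefs c) (bd (generator X s)).
Proof.
move=> Xs; move: c; apply: (@chain_span _ _ X) => [|t Xt|b c Hb Hc].
- rewrite raddf0 coefs0 (@eq_ev _ _ _ _ (fun=> 0)) => [|t _]; last exact: coefs0.
  by apply/esym/eqP; apply: contraT => /ev_neq0[t []]; rewrite eqxx.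
- have [b Eb] := set_typeP Xt; have [a Ea] := set_typeP Xs.
  rewrite -Eb generatorE /cobd liftU scale1r /= -Ea.
  rewrite (_ : ev _ _ = coeff b (bd (generator X (val a)))); last first.
    rewrite -coefs_val -ev_coefs_generator; apply: eq_ev => r _.
    by rewrite -generatorE coefs_generator // Eb.
  (* On one simplex [cobd] unfolds to [mkchain] of the incidence function [u], which has finite
     support by [finite_cofaces]. *)
  pose u (t : {fset V}) : int := coeff b (bd (generator X t)).
  rewrite -[RHS]/(u (val a)) -[X in coefs X _]/(mkchain X u) coefs_mkchain //.
    have := finite_cofaces b; move=> /(finite_image val); apply: sub_finite_set.
    by move=> r /= [/set_typeP[e <-] ue]; exists e.
  by rewrite Ea.
- rewrite raddfB coefsB /= Hb Hc -evBl; apply: eq_ev => r _; exact/esym/coefsB.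
Qed.

End Coboundary.

(** * Edge paths and the length metric *)

Section EdgePaths.
Context {d : Order.disp_t} {V : orderType d}.
Implicit Types (X : metric_complex V) (u v w : V) (k l : nat) (s t : {fset V}).

(** Control is measured by edge paths in the 1-skeleton; [dist_near] and [near_dist_lt] compare this
    with the length metric. *)
Definition near X k u v : Prop :=
  exists p : seq V, [/\ path (adjacent X) u p, last u p = v & (size p <= k)%N].

Lemma near0 X k u : near X k u u.
Proof. by exists [::]. Qed.

Lemma near_trans X k l u v w : near X k u v -> near X l v w -> near X (k + l) u w.
Proof.
move=> [p [pp lp sp]] [q [pq lq sq]]; exists (p ++ q).
by rewrite cat_path last_cat pp lp pq size_cat leq_add.
Qed.

Lemma near_le X k l u v : (k <= l)%N -> near X k u v -> near X l u v.
Proof. by move=> kl [p [pp lp sp]]; exists p; split=> //; exact: leq_trans kl. Qed.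

Lemma adjacentC X u v : adjacent X u v = adjacent X v u.
Proof. by rewrite /adjacent fsetUC. Qed.

Lemma near_sym X k u v : near X k u v -> near X k v u.
Proof.
move=> [p [pp <- sp]]; exists (rev (belast u p)).
rewrite rev_path size_rev size_belast; split=> //.
- by apply: sub_path pp => x y; rewrite adjacentC.
- by case: p {pp sp} => //= a p; rewrite rev_cons last_rcons.
Qed.

Lemma face_simplex X s t : simplices X s -> (t `<=` s)%fset -> t != fset0 ->
  simplices X t.
Proof. by move=> Xs ts t0; exact: (mc_complex X).2 Xs ts t0. Qed.

Lemma vertex_simplex X s u : simplices X s -> u \in s -> simplices X [fset u]%fset.
Proof.
move=> Xs us; apply: face_simplex Xs _ _; first by rewrite fsub1set.
by apply/fset0Pn; exists u; rewrite in_fset1.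
Qed.

Lemma simplex_vertex X s : simplices X s -> exists u, u \in s.
Proof.
move=> Xs; apply/fset0Pn/eqP => s0; apply: (mc_complex X).1.
by rewrite -s0.
Qed.

Lemma near_simplex X s u v : simplices X s -> u \in s -> v \in s -> near X 1 u v.
Proof.
move=> Xs us vs; exists [:: v]; split=> //=; rewrite andbT; apply/asboolP.
apply: face_simplex Xs _ _; last by apply/fset0Pn; exists u; rewrite !inE eqxx.
by apply/fsubsetP => w; rewrite !inE => /orP[] /eqP ->.
Qed.

Lemma connected_near X u v : simplices X [fset u]%fset -> simplices X [fset v]%fset ->
  exists k, near X k u v.
Proof.
by move=> Xu Xv; have [p [pp lp]] := mc_connected Xu Xv; exists (size p), p.
Qed.

(** By local finiteness each further edge reaches only finitely many new vertices. This is the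
    source of the compact support of cut-off pullbacks. *)
Lemma finite_simplices_near X k u : simplices X [fset u]%fset ->
  finite_set [set s | simplices X s /\ exists2 v, v \in s & near X k u v].
Proof.
move=> Xu.
have fs v : finite_set [set s | simplices X s /\ v \in s] by exact: mc_locally_finite.
have fb : finite_set [set v | near X k u v].
  elim: k => [|k IH].
    by apply: sub_finite_set (finite_set1 u) => v [[|a p] [_ <- //]].
  apply: (@sub_finite_set _ _
    (\bigcup_(v in [set v | near X k u v])
       ([set v] `|` \bigcup_(s in [set s | simplices X s /\ v \in s]) [set` s]))).
    move=> w [p [pp lp sp]]; case/lastP: p => [|p x] in pp lp sp.
      by exists u; [exact: near0|left; rewrite -lp].
    rewrite rcons_path last_rcons size_rcons in pp lp sp.
    case/andP: pp => pp /asboolP ax; exists (last u p); first by exists p.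
    right; exists [fset last u p; x]%fset; first by split; rewrite ?inE ?eqxx.
    by rewrite /= -lp !inE eqxx orbT.
  apply: bigcup_finite => // v _; rewrite finite_setU; split; first exact: finite_set1.
  by apply: bigcup_finite => // s _; exact: finite_fset.
apply: (@sub_finite_set _ _
  (\bigcup_(v in [set v | near X k u v]) [set s | simplices X s /\ v \in s])).
  by move=> s [Xs [v vs uv]]; exists v.
exact: bigcup_finite.
Qed.

Lemma near_star_nbhd X K r s v : is_complex K -> star_nbhd X r K s -> v \in s ->
  exists2 w, K [fset w]%fset & near X r w v.
Proof.
move=> cK; elim: r s v => [|r IH] s v /=.
  move=> Ks vs; exists v; last exact: near0.
  by apply: cK.2 Ks _ _; rewrite ?fsub1set //; apply/fset0Pn; exists v; rewrite inE.
move=> [s0 [t [u [Xt st ut Ku]]]] vs.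
have [|w Kw wu] := IH _ u Ku; first by rewrite inE.
exists w => //; rewrite -addn1; apply: near_trans wu _.
by apply: near_simplex Xt ut _; exact: (fsubsetP st).
Qed.

End EdgePaths.

Section Distances.
Context {R : realType} {d : Order.disp_t} {V : orderType d}.
Implicit Types (X : metric_complex V) (u v w : V) (k l : nat) (s t : {fset V}).
Implicit Types (x y z : V -> R).

Definition vertex_point u : V -> R := fun v => (v == u)%:R.

Lemma in_simplex_vertex s u : u \in s -> in_simplex s (vertex_point u).
Proof.
move=> us; split=> [v|v vs|]; rewrite /vertex_point ?ler0n //.
  by case: eqP vs => // ->; rewrite us.
rewrite (big_fsetD1 u) //= eqxx big1_seq ?addr0 // => v.
by rewrite !inE => /= /andP[/negbTE ->].
Qed.

Lemma realization_vertex X u : simplices X [fset u]%fset ->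
  realization X (vertex_point u).
Proof. by move=> Xu; exists [fset u]%fset => //; apply: in_simplex_vertex; rewrite inE. Qed.

Lemma sum_in_simplex s (F : V -> R) : (forall v, v \notin s -> F v = 0) ->
  \sum_(v \in [set: V]) F v = \sum_(v <- s) F v.
Proof.
move=> F0; rewrite -(@fsbig_widen _ _ _ _ [set` s]) //.
  by rewrite fsbig_finite //= ?set_fsetK //; exact: finite_fset.
by move=> v [_ /= /negP]; exact: F0.
Qed.

Lemma euclid_sqr s x y : in_simplex s x -> in_simplex s y ->
  euclid x y = Num.sqrt (2^-1 * \sum_(v <- s) (x v - y v) ^+ 2).
Proof.
move=> [_ x0 _] [_ y0 _]; rewrite /euclid (sum_in_simplex (s := s)) // => v vs.
by rewrite x0 // y0 // subrr expr0n.
Qed.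

Lemma in_simplex_le1 s x v : in_simplex s x -> x v <= 1.
Proof.
move=> [xp x0 x1]; have [vs|/x0 -> //] := boolP (v \in s).
rewrite -x1 (big_fsetD1 v) //= lerDl; exact: sumr_ge0.
Qed.

Lemma euclid_le1 s x y : in_simplex s x -> in_simplex s y -> euclid x y <= 1.
Proof.
move=> sx sy; rewrite (euclid_sqr sx sy) -[leRHS]sqrtr1 ler_sqrt //.
rewrite ler_pdivrMl ?ltr0n // mulr1.
have [[xp _ x1] [yp _ y1]] := (sx, sy).
(* For coordinates in [0, 1] one has [(x - y)^2 <= x + y], and the sum of the right-hand sides is
   2. *)
suff : \sum_(v <- s) (x v - y v) ^+ 2 <= \sum_(v <- s) (x v + y v).
  by rewrite big_split /= x1 y1.
apply: ler_sum => v _; have := in_simplex_le1 v sx; have := in_simplex_le1 v sy.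
have := xp v; have := yp v; rewrite expr2; nra.
Qed.

Lemma euclid_ge0 x y : 0 <= euclid x y.
Proof. exact: sqrtr_ge0. Qed.

Definition path_length x (p : seq (V -> R)) : R := \sum_(e <- pairmap euclid x p) e.

Lemma path_length_ge0 x p : 0 <= path_length x p.
Proof.
elim: p x => [|y p IH] x; rewrite /path_length /= ?big_nil // big_cons.
by rewrite addr_ge0 ?euclid_ge0 //; exact: IH.
Qed.

Lemma path_length_cat x p q :
  path_length x (p ++ q) = path_length x p + path_length (last x p) q.
Proof. by rewrite /path_length pairmap_cat big_cat. Qed.

Lemma dist_le X x y p : path (cosimplicial X) x p -> last x p = y ->
  dist X x y <= path_length x p.
Proof.
move=> pp lp; apply: ge_inf; last by exists p.
by exists 0 => _ [q [_ _ ->]]; exact: path_length_ge0.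
Qed.

Lemma dist_simplex X s x y : simplices X s -> in_simplex s x -> in_simplex s y ->
  dist X x y <= 1.
Proof.
move=> Xs sx sy; apply: le_trans (@dist_le X x y [:: y] _ _) _ => //=.
  by rewrite andbT; apply/asboolP; exists s.
by rewrite /path_length /= big_seq1; exact: euclid_le1 sx sy.
Qed.

Lemma dist_near_path X k u v : near X k u v ->
  exists p, [/\ path (cosimplicial X) (vertex_point u) p,
    last (vertex_point u) p = vertex_point v & path_length (vertex_point u) p <= k%:R].
Proof.
move=> [p [pp <- sp]]; exists (map vertex_point p); split.
- rewrite path_map; apply: sub_path pp => a b /asboolP ab.
  by apply/asboolP; exists [fset a; b]%fset; split=> //;
    apply: in_simplex_vertex; rewrite !inE eqxx ?orbT.
- exact: last_map.
- apply: le_trans (_ : (size p)%:R <= _); last by rewrite ler_nat.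
  elim: p u pp {sp} => [|w p IH] u /=; first by rewrite /path_length big_nil.
  move=> /andP[/asboolP uw /IH]; rewrite /path_length /= big_cons => h.
  rewrite -addn1 natrD [leRHS]addrC; apply: lerD h; apply: (@euclid_le1 [fset u; w]%fset);
    by apply: in_simplex_vertex; rewrite !inE eqxx ?orbT.
Qed.

Lemma dist_near X k u v : near X k u v ->
  dist X (vertex_point u) (vertex_point v) <= k%:R.
Proof. by move=> /dist_near_path[p [pp lp]]; apply: le_trans; exact: dist_le. Qed.

(** By connectedness the set of lengths that defines [dist] is nonempty; the infimum of the empty
    set would be the default value 0. *)
Lemma realization_path X x y : realization X x -> realization X y ->
  exists p, path (cosimplicial X) x p /\ last x p = y.
Proof.
move=> [s Xs sx] [t Xt ty].
have [u us] := simplex_vertex Xs; have [v vt] := simplex_vertex Xt.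
have [k /dist_near_path[p [pp lp _]]] :=
  connected_near (vertex_simplex Xs us) (vertex_simplex Xt vt).
exists (vertex_point u :: rcons p y); rewrite /= rcons_path last_rcons pp lp.
split=> //; apply/and3P; split=> //.
  by apply/asboolP; exists s; split=> //; exact: in_simplex_vertex.
by apply/asboolP; exists t; split=> //; exact: in_simplex_vertex.
Qed.

Lemma dist_lt_path X x y r : realization X x -> realization X y ->
  dist X x y < r -> exists p, [/\ path (cosimplicial X) x p, last x p = y
    & path_length x p < r].
Proof.
move=> Xx Xy /inf_lt[|l [p [pp lp ->]] lr]; last by exists p.
have [p [pp lp]] := realization_path Xx Xy.
by exists (path_length x p), p.
Qed.

Lemma dist_triangle X x y z : realization X x -> realization X y ->
  realization X z -> dist X x z <= dist X x y + dist X y z.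
Proof.
move=> Xx Xy Xz; apply/ler_addgt0Pr => e e0; have e20 : 0 < e / 2 by rewrite divr_gt0.
have [p [pp lp p1]] := @dist_lt_path X x y (dist X x y + e / 2) Xx Xy (ltr_pwDr e20 (lexx _)).
have [q [pq lq q1]] := @dist_lt_path X y z (dist X y z + e / 2) Xy Xz (ltr_pwDr e20 (lexx _)).
apply: le_trans (@dist_le X x z (p ++ q) _ _) _; rewrite ?cat_path ?last_cat ?lp ?pp //.
rewrite path_length_cat lp [e]splitr addrACA; apply: lerD; exact: ltW.
Qed.

Section LowerBound.
Variables (X : metric_complex V) (m : int) (u : V).
Hypotheses (dimX : has_dimension X m) (Xu : simplices X [fset u]%fset).

Let edge_dist v : nat :=
  if pselect (exists k, `[< near X k u v >]) is left h then ex_minn h else 0%N.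

Let edge_distP v : simplices X [fset v]%fset ->
  near X (edge_dist v) u v /\ forall k, near X k u v -> (edge_dist v <= k)%N.
Proof.
move=> Xv; rewrite /edge_dist; case: pselect => [h|[]]; last first.
  by have [k uv] := connected_near Xu Xv; exists k; apply/asboolP.
by case: ex_minnP => k /asboolP uk mk; split=> // l ul; apply/mk/asboolP.
Qed.

(** The edge distance to [u], extended affinely over each simplex. Once it is known to be Lipschitz,
    its increment along a path bounds the edge distance by a multiple of the length. *)
Let height x : R := \sum_(v \in [set: V]) x v * (edge_dist v)%:R.

Let height_vertex v : height (vertex_point v) = (edge_dist v)%:R.
Proof.
rewrite /height (sum_in_simplex (s := [fset v]%fset)) => [|w].
  by rewrite big_seq_fset1 /vertex_point eqxx mul1r.
by rewrite inE /vertex_point => /negbTE ->; rewrite mul0r.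
Qed.

(** A simplex has at most [m + 1] vertices. Because of the factor 1/2 in [euclid], a coordinate
    changes by at most [sqrt 2] times [euclid], for which 2 is a convenient bound. *)
Let width : R := 2 * (absz (m + 1))%:R.

Let width_ge0 : 0 <= width.
Proof. by rewrite mulr_ge0. Qed.

(* Subtracting a constant from the height on a simplex does not change its
   increments, because barycentric coordinates add up to 1. *)
Let height_lipschitz s x y : simplices X s -> in_simplex s x -> in_simplex s y ->
  height y - height x <= width * euclid x y.
Proof.
move=> Xs sx sy; have [_ x0 x1] := sx; have [_ y0 y1] := sy.
have [w ws] := simplex_vertex Xs.
have E z : in_simplex s z ->
    height z = \sum_(v <- s) z v * ((edge_dist v)%:R - (edge_dist w)%:R) + (edge_dist w)%:R.
  move=> [_ z0 z1]; rewrite /height (sum_in_simplex (s := s)); last first.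
    by move=> v /z0 ->; rewrite mul0r.
  under [X in _ = X + _]eq_bigr do rewrite mulrBr.
  by rewrite sumrB -mulr_suml z1 mul1r subrK.
rewrite (E _ sx) (E _ sy) opprD addrACA subrr addr0 -sumrB.
apply: (@le_trans _ _ (\sum_(v <- s) 2 * euclid x y)); last first.
  rewrite big_const_seq count_predT iter_addr_0 -[leLHS]mulr_natl mulrA [_ * 2]mulrC.
  rewrite ler_wpM2r ?euclid_ge0 // ler_wpM2l // ler_nat.
  by have := dimX.1 s (or_introl Xs); rewrite -/(size s); lia.
rewrite big_seq [leRHS]big_seq; apply: ler_sum => v vs.
rewrite -mulrBl; apply: le_trans (ler_norm _) _; rewrite normrM.
(* Two vertices of one simplex are joined by at most one edge, so their edge distances to [u] differ
   by at most 1. *)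
apply: (@le_trans _ _ (`|y v - x v| * 1)).
  apply: ler_wpM2l => //; rewrite ler_norml; apply/andP.
  have [nv mv] := edge_distP (vertex_simplex Xs vs).
  have [nw mw] := edge_distP (vertex_simplex Xs ws).
  have := mv _ (near_trans nw (near_simplex Xs ws vs)).
  have := mw _ (near_trans nv (near_simplex Xs vs ws)).
  by rewrite -!(ler_nat R) !natrD; split; lra.
rewrite mulr1 (euclid_sqr sx sy).
rewrite -[leRHS]ger0_norm ?mulr_ge0 ?sqrtr_ge0 //.
rewrite -ler_sqr ?nnegrE ?normr_ge0 // !real_normK ?num_real //.
rewrite exprMn sqr_sqrtr; last first.
  by apply: mulr_ge0; [rewrite invr_ge0|apply: sumr_ge0 => a _; exact: sqr_ge0].
rewrite mulrA (big_fsetD1 v) //= -sqrrN opprB.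
have h : 0 <= \sum_(i <- (s `\ v)%fset) (x i - y i) ^+ 2.
  by apply: sumr_ge0 => a _; exact: sqr_ge0.
have h2 : 0 <= (x v - y v) ^+ 2 by exact: sqr_ge0.
lra.
Qed.

Lemma near_dist_lt v k : simplices X [fset v]%fset ->
  dist X (vertex_point u) (vertex_point v) < k%:R ->
  near X (2 * absz (m + 1)%R * k) u v.
Proof.
move=> Xv /(dist_lt_path (realization_vertex Xu) (realization_vertex Xv)).
move=> [p [pp lp pk]]; have [uv _] := edge_distP Xv.
apply: near_le uv; rewrite -(ler_nat R) -height_vertex.
suff H : height (vertex_point v) - height (vertex_point u)
         <= width * path_length (vertex_point u) p.
  have u0 : height (vertex_point u) = 0.
    rewrite height_vertex; have [_ /(_ 0%N (near0 _ _ _))] := edge_distP Xu.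
    by rewrite leqn0 => /eqP ->.
  rewrite u0 subr0 in H; apply: le_trans H _; rewrite natrM natrM.
  by rewrite ler_wpM2l // ltW.
rewrite -lp; elim: p (vertex_point u) pp {lp pk} => [|y p IH] x /=.
  by rewrite /path_length big_nil subrr mulr0.
move=> /andP[/asboolP[s [Xs sx sy]] /IH].
rewrite /path_length /= big_cons mulrDr => H.
have := height_lipschitz Xs sx sy; lra.
Qed.

End LowerBound.
End Distances.

(** * Controlled fillings *)

Section Filling.
Context {d : Order.disp_t} {V : orderType d}.
Implicit Types (X : metric_complex V) (u v w : V) (k l : nat) (s t : {fset V}).

Lemma coefs_push_neq0 (S T : set {fset V}) (c : chains S) s :
  coefs (push T c) s != 0 -> coefs c s != 0.
Proof. by move=> cs; have Ts := coefs_in cs; rewrite coefs_push in cs. Qed.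

Lemma chain_neq0 (S : set {fset V}) (c : chains S) : c <> 0 ->
  exists s, coefs c s != 0.
Proof.
move=> c0; apply: contrapT => H; apply: c0; apply: coefs_ext => s; rewrite coefs0.
by apply/eqP; apply: contrapT => /negP ?; apply: H; exists s.
Qed.

Lemma chain_support (S : set {fset V}) (c : chains S) :
  exists l : seq {fset V}, forall s, coefs c s != 0 -> s \in l.
Proof.
exists [seq val a | a <- dom c] => s cs; have [a E] := set_typeP (coefs_in cs).
by rewrite -E; apply: map_f; rewrite mem_dom -coefs_val E.
Qed.

Lemma homology_class0 (S T : set {fset V}) i : homology_class T i (0 : chains S) = 0.
Proof.
have c0 : cycles T i (0 : chains S) by exact: rpred0.
by rewrite -[X in homology_class T i X](subrr 0) homology_classB // subrr.
Qed.

Lemma has_degree_empty (S : set {fset V}) i (c : chains S) s :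
  has_degree i c -> 0 <= i -> coefs c s != 0 -> s != fset0.
Proof.
move=> /has_degreeP dc i0 /dc; case: eqP => // ->; rewrite cardfs0; lia.
Qed.

Lemma aug_simplex X s : aug X s -> s != fset0 -> simplices X s.
Proof. by case=> // ->; rewrite eqxx. Qed.

Lemma face_closed_augX X : face_closed (aug X).
Proof. exact/face_closed_aug/mc_complex. Qed.

Definition spread X k (z : chains (aug X)) : Prop := forall s t u v,
  coefs z s != 0 -> coefs z t != 0 -> u \in s -> v \in t -> near X k u v.

Definition close_to X k (w z : chains (aug X)) : Prop := forall s t u v,
  coefs w s != 0 -> coefs z t != 0 -> u \in s -> v \in t -> near X k v u.

Lemma exists_spread X (z : chains (aug X)) : exists k, spread k z.
Proof.
have [[s0 [u0 [zs0 us0]]]|H] := pselect (exists s u, coefs z s != 0 /\ u \in s); last first.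
  by exists 0%N => s t u v zs zt us vt; case: H; exists s, u.
have aX s u : coefs z s != 0 -> u \in s -> simplices X [fset u]%fset.
  move=> zs us; apply: vertex_simplex (us); apply: aug_simplex (coefs_in zs) _.
  by apply/fset0Pn; exists u.
suff [k Hk] : exists k, forall s u, coefs z s != 0 -> u \in s -> near X k u0 u.
  exists (k + k)%N => s t u v zs zt us vt.
  by apply: near_trans (Hk _ _ zt vt); apply: near_sym; exact: Hk us.
have [l Hl] := chain_support z.
suff [k Hk] : exists k, forall s u, s \in l -> coefs z s != 0 -> u \in s -> near X k u0 u.
  by exists k => s u zs us; apply: (Hk s u) => //; exact: Hl.
elim: l {Hl} => [|s l [k IH]]; first by exists 0%N.
have [[u [zs us]]|H] := pselect (exists u, coefs z s != 0 /\ u \in s); last first.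
  exists k => t v; rewrite inE => /orP[/eqP -> zs vs|]; last exact: IH.
  by case: H; exists v.
have [j Hj] := connected_near (aX _ _ zs0 us0) (aX _ _ zs us).
exists (j + 1 + k)%N => t v; rewrite inE => /orP[/eqP -> _ vs|tl zt vt].
  apply: near_le (near_trans Hj (near_simplex _ us vs)); first exact: leq_addr.
  by apply: aug_simplex (coefs_in zs) _; apply/fset0Pn; exists u.
by apply: near_le (IH _ _ tl zt vt); exact: leq_addl.
Qed.

Lemma closed_star_complex X K : is_complex (closed_star X K).
Proof.
split=> [[/eqP//]|s t [s0 [s1 [v [Xs1 ss1 vs1 Kv]]]] ts t0]; split=> //.
by exists s1, v; split=> //; exact: fsubset_trans ss1.
Qed.

Lemma closed_star_sub X K : closed_star X K `<=` X.
Proof. by move=> t [t0 [s [v [Xs ts _ _]]]]; exact: face_simplex ts t0. Qed.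

Lemma sub_closed_star X K : subcomplex X K -> K `<=` closed_star X K.
Proof.
move=> [cK KX] t Kt; have [v vt] := simplex_vertex (KX _ Kt).
have t0 : t != fset0 by apply/fset0Pn; exists v.
split=> //; exists t, v; split=> //; first exact: KX.
by apply: cK.2 Kt _ _; rewrite ?fsub1set //; apply/fset0Pn; exists v; rewrite inE.
Qed.

Lemma star_nbhd_subcomplex X r K : subcomplex X K ->
  subcomplex X (star_nbhd X r K) /\ K `<=` star_nbhd X r K.
Proof.
move=> sK; elim: r => [|r [sr Kr]]; [by split|split].
  by split; [exact: closed_star_complex|exact: closed_star_sub].
by apply: subset_trans Kr _; exact: sub_closed_star.
Qed.

Section SpanOfChain.
Variables (X : metric_complex V) (z : chains (aug X)).

Definition carrier : set {fset V} :=
  [set t | t != fset0 /\ exists2 s, coefs z s != 0 & (t `<=` s)%fset].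

Lemma carrier_subcomplex : subcomplex X carrier.
Proof.
split; first split=> [[/eqP//]|s t [s0 [s1 zs1 ss1]] ts t0].
  by split=> //; exists s1 => //; exact: fsubset_trans ss1.
move=> t [t0 [s zs ts]]; apply: (face_simplex _ ts t0); apply: aug_simplex (coefs_in zs) _.
by apply/fset0Pn; have /fset0Pn[v vt] := t0; exists v; exact: (fsubsetP ts).
Qed.

Lemma aug_carrier s : coefs z s != 0 -> aug carrier s.
Proof.
move=> zs; have [->|s0] := eqVneq s fset0; [by right|left].
by split=> //; exists s.
Qed.

(** The two additional units lead from the points to vertices of their simplices. *)
Lemma carrier_diam (R : realType) k : spread k z -> diam_le X carrier (k.+2%:R : R).
Proof.
move=> sz x y [s Ks sx] [t Kt ty]; have [cK KX] := carrier_subcomplex.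
have [Xs Xt] := (KX _ Ks, KX _ Kt).
have [u us] := simplex_vertex Xs; have [v vt] := simplex_vertex Xt.
have [Xu Xv] := (vertex_simplex Xs us, vertex_simplex Xt vt).
have [Ru Rv] := (realization_vertex (R := R) Xu, realization_vertex (R := R) Xv).
have [Rx Ry] : realization X x /\ realization X y by split; [exists s|exists t].
have uv : near X k u v.
  have [[_ [s1 zs1 ss1]] [_ [t1 zt1 tt1]]] := (Ks, Kt).
  by apply: sz zs1 zt1 _ _; [exact: (fsubsetP ss1)|exact: (fsubsetP tt1)].
have := dist_near (R := R) uv.
have := dist_simplex Xs sx (in_simplex_vertex us).
have := dist_simplex Xt (in_simplex_vertex vt) ty.
have := dist_triangle Rx Ru Ry; have := dist_triangle Ru Rv Ry.
rewrite -addn2 natrD; lra.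
Qed.

End SpanOfChain.

(** The last clause is not implied by [close_to], which is vacuous when [z] has empty support. *)
Definition fillable X j k k' : Prop := forall z : chains (aug X),
  has_degree j z -> bd z = 0 -> spread k z -> exists w : chains (aug X),
  [/\ has_degree (j + 1) w, bd w = z, close_to k' w z & z = 0 -> w = 0].

Lemma fillable_le X j k k1 k2 : (k1 <= k2)%N -> fillable X j k k1 -> fillable X j k k2.
Proof.
move=> le H z dz bz sz; have [w [dw bw cw w0]] := H z dz bz sz.
by exists w; split=> // s t u v ws zt us vt; apply: near_le le _; exact: cw us vt.
Qed.

Lemma acyclic_fillable (R : realType) X j k : uniformly_acyclic R X -> 0 <= j ->
  exists k', fillable X j k k'.
Proof.
move=> [m [dimX _] acX] j0; have [jm|jm] := leP j m; last first.
  exists 0%N => z /has_degreeP dz _ _; have z0 : z = 0.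
    apply: contrapT => /chain_neq0[s zs].
    have := dimX _ (coefs_in zs); rewrite (dz _ zs); lia.
  exists 0; rewrite z0; split=> //; [exact: has_degree0|exact: raddf0|].
  by move=> s t u v; rewrite coefs0 eqxx.
have [|r2 r20 H] := acX j k.+2%:R jm; first by rewrite ltr0n.
(* An edge path of length [k] joins any two vertices of the carrier, and each of the [r2] stars
   costs one more edge. *)
exists (k + r2)%N => z dz bz sz.
have [->|z0] := pselect (z = 0).
  exists 0; split=> //; [exact: has_degree0|exact: raddf0|].
  by move=> s t u v; rewrite coefs0 eqxx.
set K := carrier z; have sK := carrier_subcomplex z; have [cK KX] := sK.
have [[cN NX] KN] := star_nbhd_subcomplex r2 sK.
have cz : carried (aug K) z by apply/carriedP => s; exact: aug_carrier.
pose z' := push (aug K) z.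
have dz' : has_degree j z' by exact: has_degree_push.
have bz' : bd z' = 0.
  rewrite -[bd z'](pushK _ (aug_sub KX)) push_bd; last exact: face_closed_aug.
    by rewrite carried_pushK // bz raddf0.
  exact: aug_sub.
have Cz' : cycles set0 j z'.
  by apply/asboolP; split=> //; rewrite bz'; exact: carried0.
(* Here the degree matters: for [0 <= j] the simplices of a nonzero chain are not the empty one, so
   they contribute to the carrier. *)
have K0 : K !=set0.
  have [s zs] := chain_neq0 z0; exists s; split; last by exists s.
  exact: has_degree_empty dz j0 zs.
have := H K sK K0 (carrier_diam (R := R) sz) (homology_class set0 j z').
rewrite reduced_inclE // -(homology_class0 _ set0 j) => /homology_class_eq[].
- exact: (respectful_reduced j cK KN).1.
- exact: rpred0.
move=> w' [t [dw' _ /carried_set0 -> ]]; rewrite subr0 addr0 => E.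
exists (push (aug X) w'); split=> //.
- exact: has_degree_push.
- rewrite -push_bd; [|exact: aug_sub|exact: face_closed_aug].
  rewrite -E push_push; last exact: carried_sub (aug_sub KN).
  exact: carried_pushK.
- move=> s t' u v /coefs_push_neq0 ws zt us vt.
  have [|w [_ [s1 zs1 ws1]] wu] := near_star_nbhd (X := X) (s := s) (r := r2) cK _ us.
    by case: (coefs_in ws) => // s0; move: us; rewrite s0.
  apply: near_trans wu; apply: sz zt zs1 vt _.
  by apply: (fsubsetP ws1); rewrite inE.
Qed.

(** One operator for all degrees, with control independent of the degree. It is merely a choice of
    fillings and need not be additive, so it is applied to the images of single simplices and
    extended linearly. *)
Definition filling X (fill : int -> chains (aug X) -> chains (aug X)) : Prop :=
  (forall j z, 0 <= j -> has_degree j z -> bd z = 0 ->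
     [/\ has_degree (j + 1) (fill j z), bd (fill j z) = z & z = 0 -> fill j z = 0]) /\
  (forall k, exists k', forall j z, 0 <= j -> has_degree j z -> bd z = 0 ->
     spread k z -> close_to k' (fill j z) z).

Lemma bounded_choice (P : nat -> nat -> Prop) (M : nat) :
  (forall j k l, (k <= l)%N -> P j k -> P j l) ->
  (forall j, exists k, P j k) -> exists k, forall j, (j < M)%N -> P j k.
Proof.
move=> Pm Pe; elim: M => [|M [k IH]]; first by exists 0%N.
have [l Pl] := Pe M; exists (maxn k l) => j; rewrite ltnS leq_eqVlt => /orP[/eqP ->|jM].
  exact: Pm (leq_maxr _ _) Pl.
exact: Pm (leq_maxl _ _) (IH _ jM).
Qed.

Lemma acyclic_filling (R : realType) X : uniformly_acyclic R X ->
  exists fill, filling (X := X) fill.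
Proof.
move=> aX; have [m [dimX _] _] := aX.
have /choice[kappa Hk] k : exists k', forall j, 0 <= j -> fillable X j k k'.
  have [k' H] := @bounded_choice (fun j => fillable X j%:Z k) (absz m).+1
    (fun j => @fillable_le X j k) (fun j => acyclic_fillable k aX (j := j%:Z) isT).
  exists k' => -[j _|//]; have [/H//|jm] := ltnP j (absz m).+1.
  move=> z /has_degreeP dz _ _; have z0 : z = 0.
    apply: contrapT => /chain_neq0[s zs].
    have := dimX _ (coefs_in zs); rewrite (dz _ zs); lia.
  exists 0; rewrite z0; split=> //; [exact: has_degree0|exact: raddf0|].
  by move=> s t u v; rewrite coefs0 eqxx.
have H (jz : int * chains (aug X)) : exists w : chains (aug X),
    0 <= jz.1 -> has_degree jz.1 jz.2 -> bd jz.2 = 0 ->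
    [/\ has_degree (jz.1 + 1) w, bd w = jz.2, jz.2 = 0 -> w = 0
      & forall k, spread k jz.2 -> exists2 k0, (k0 <= k)%N & close_to (kappa k0) w jz.2].
  case: jz => j z /=; have [[j0 dz bz]|N] := pselect [/\ 0 <= j, has_degree j z & bd z = 0].
    (* The filling is chosen for the least bound [k0] on the spread of [z], so that one chain serves
       every larger bound. *)
    have e : exists k, `[< spread k z >] by have [k sk] := exists_spread z; exists k; apply/asboolP.
    case: (ex_minnP e) => k0 /asboolP sk0 mink.
    have [w [dw bw cw w0]] := Hk k0 j j0 z dz bz sk0.
    by exists w => _ _ _; split=> // k sk; exists k0 => //; apply/mink/asboolP.
  by exists 0 => *; case: N.
have [fill Hfill] := choice H.
exists (fun j z => fill (j, z)); split=> [j z j0 dz bz|k].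
  by have [] := Hfill (j, z) j0 dz bz.
(* The maximum is taken because [k0] can be any number up to [k] and [kappa] is not known to be
   monotone. *)
exists (\max_(i < k.+1) kappa i) => j z j0 dz bz sk.
have [_ _ _ /(_ k sk)[k0 k0k ck]] := Hfill (j, z) j0 dz bz.
move=> s t u v ws zt us vt; apply: near_le (ck _ _ _ _ ws zt us vt).
exact: (@leq_bigmax_cond _ xpredT (fun i : 'I_k.+1 => kappa i) (Ordinal (k0k : (k0 < k.+1)%N))).
Qed.

(** The displacement bounds the distance from some vertex of [s]; one more edge leads to that vertex
    from the given [v]. *)
Lemma near_displaced X (D : nat) (c : chains X) (A : set (chains X)) s t v w :
  simplices X s -> Defs.support A `<=` star_nbhd X D (closed_simplex s) ->
  A c -> coefs c t != 0 -> v \in s -> w \in t -> near X D.+1 v w.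
Proof.
move=> Xs sub Ac ct vs wt; have Xt : simplices X t := coefs_in ct.
have [a E] := set_typeP Xt.
have st : Defs.support A t.
  split; first by apply/fset0Pn; exists w.
  by exists c, a; rewrite -coefs_val E; split.
have cs : is_complex (closed_simplex s).
  split=> [[/eqP//]|t1 t2 [_ t1s] t21 t20]; split=> //; exact: fsubset_trans t1s.
have [w0 [_ w0s] nw0] := near_star_nbhd cs (sub _ st) wt.
rewrite -add1n; apply: near_trans nw0; apply: near_simplex Xs vs _.
by apply: (fsubsetP w0s); rewrite inE.
Qed.

Lemma chain_displaced X (D : nat) (h : chains X -> chains X) s t v w :
  chain_displacement (X := X) D h ->
  simplices X s -> coefs (h (generator X s)) t != 0 -> v \in s -> w \in t ->
  near X D.+1 v w.
Proof. by move=> H Xs; apply: near_displaced Xs (H s Xs) _. Qed.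

Lemma cochain_displaced X (D : nat) (h : chains X -> chains X) s t v w :
  cochain_displacement (X := X) D h ->
  simplices X s -> coefs (h (generator X s)) t != 0 -> v \in s -> w \in t ->
  near X D.+1 v w.
Proof.
move=> H Xs ht vs wt.
have ss : closed_simplex s s by split=> //; apply/fset0Pn; exists v.
apply: (near_displaced Xs (H s Xs) _ ht vs wt).
by exists (generator (closed_simplex s) s) => //; rewrite push_generator_in.
Qed.

End Filling.

(** * Controlled chain maps and homotopies *)

Lemma additive_scale (U U' : lmodType int) (f : {additive U -> U'}) k c :
  f (k *: c) = k *: f c.
Proof. by rewrite -[k]intz !scaler_int raddfMz. Qed.

Lemma has_degreeZ d (V : orderType d) (S : set {fset V}) i k (c : chains S) :
  has_degree i c -> has_degree i (k *: c).
Proof.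
move=> /has_degreeP dc; apply/has_degreeP => s; rewrite coefsZ => H.
by apply: dc; apply: contraNneq H => ->; rewrite mulr0.
Qed.

Lemma has_degree_sum d (V : orderType d) (S : set {fset V}) i (I : eqType)
    (r : seq I) (F : I -> chains S) :
  (forall x, x \in r -> has_degree i (F x)) -> has_degree i (\sum_(x <- r) F x).
Proof.
move=> H; rewrite big_seq; apply: (big_ind (@has_degree _ _ S i)) => //.
  exact: has_degree0.
exact: has_degreeD.
Qed.

Section Extension.
Context {d : Order.disp_t} {V : orderType d} {d' : Order.disp_t} {W : orderType d'}.
Variables (X : metric_complex V) (Y : metric_complex W).

(* The image of a simplex [s] lies near [p s], uniformly on each level set. *)
Definition tame (p : V -> W) (level : nat -> V -> Prop)
    (h : chains (aug X) -> chains (aug Y)) : Prop :=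
  forall r, exists k, forall s t v w, simplices X s ->
    (forall u, u \in s -> level r u) -> coefs (h (generator (aug X) s)) t != 0 ->
    v \in s -> w \in t -> near Y k (p v) w.

Variables (fill : int -> chains (aug Y) -> chains (aug Y)) (M : nat).
Hypotheses (fillY : filling (X := Y) fill)
  (dimX : forall s, simplices X s -> (#|` s| <= M)%N).
Variables (e s : int) (g : {additive chains (aug X) -> chains (aug Y)}).
(** Values on the empty simplex and on vertices are prescribed: for [e = 0] the chain to be filled
    for a vertex has degree -1, where [filling] says nothing. Applying [bd] to the equation
    [bd h = g + s h bd] shows that [g_bd] is forced. *)
Variable b : {fset V} -> chains (aug Y).
Hypotheses (e0 : 0 <= e)
  (g_degree : forall i c, has_degree i c -> has_degree (i + e - 1) (g c))
  (g_bd : forall c, bd (g c) = - (s *: g (bd c)))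
  (b_degree : forall a, aug X a -> (#|` a| <= 1)%N ->
     has_degree ((#|` a|)%:Z - 1 + e) (b a))
  (b_bd : forall a, aug X a -> (#|` a| <= 1)%N ->
     bd (b a) = g (generator (aug X) a) +
       s *: \sum_(v <- a) (-1) ^+ position v a *: b (a `\ v)%fset).

(* Solves [bd h = g + s h bd] by induction on dimension: [s = 1] and [g = 0] for
   chain maps, [s = -1] for homotopies of [g] to zero. *)
Fixpoint ext_rec (n : nat) (a : {fset V}) : chains (aug Y) :=
  if n is m.+1 then
    if m == 0%N then b a else
    fill (m%:Z - 1 + e) (g (generator (aug X) a) +
       s *: \sum_(v <- a) (-1) ^+ position v a *: ext_rec m (a `\ v)%fset)
  else b a.

Definition ext : chains (aug X) -> chains (aug Y) :=
  fglift (fun a : set_type (aug X) => ext_rec #|` val a| (val a)).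

HB.instance Definition _ := GRing.Additive.on ext.

Lemma ext_generator a : aug X a -> ext (generator (aug X) a) = ext_rec #|` a| a.
Proof. by move=> /set_typeP[x <-]; rewrite generatorE /ext liftU scale1r. Qed.

Lemma ext_base a : aug X a -> (#|` a| <= 1)%N -> ext (generator (aug X) a) = b a.
Proof. by move=> Xa; rewrite ext_generator //; case: #|` a| => [|[|n]]. Qed.

Lemma ext_bd_generator a : aug X a -> ext (bd (generator (aug X) a)) =
  \sum_(v <- a) (-1) ^+ position v a *: ext (generator (aug X) (a `\ v)%fset).
Proof.
move=> Xa; rewrite bd_generator_in // raddf_sum; apply: eq_bigr => v _.
by rewrite raddfZsign.
Qed.

Lemma ext_rec_step a n : aug X a -> #|` a| = n.+2 ->
  ext (generator (aug X) a) = fill (n%:Z + e)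
    (g (generator (aug X) a) + s *: ext (bd (generator (aug X) a))).
Proof.
move=> Xa an; rewrite [LHS]ext_generator // an /= ext_bd_generator //.
congr (fill _ (_ + _ *: _)); first by lia.
apply: eq_big_seq => v va.
have Xf : aug X (a `\ v)%fset by apply: face_closed_augX Xa (fsubD1set _ _).
rewrite ext_generator //; have -> // : #|` (a `\ v)%fset| = n.+1.
by have := an; rewrite (cardfsD1 v) va; lia.
Qed.

Lemma shift_ge0 (n : nat) : 0 <= n%:Z + e.
Proof. by apply: addr_ge0. Qed.

Lemma ext_spec a : aug X a ->
  has_degree ((#|` a|)%:Z - 1 + e) (ext (generator (aug X) a)) /\
  bd (ext (generator (aug X) a)) =
    g (generator (aug X) a) + s *: ext (bd (generator (aug X) a)).
Proof.
have [n] := ubnP #|` a|; elim: n a => // n IH a an Xa.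
have fa v : aug X (a `\ v)%fset by apply: face_closed_augX Xa (fsubD1set _ _).
have [a1|a1] := leqP #|` a| 1.
  rewrite ext_base // b_bd //; split; first exact: b_degree.
  rewrite ext_bd_generator //; congr (_ + _ *: _); apply: eq_big_seq => v va.
  by rewrite ext_base //; apply: leq_trans a1; apply: fsubset_leq_card; exact: fsubD1set.
have [m am] : exists m, #|` a| = m.+2 by exists (#|` a|.-2); lia.
have cf v : v \in a -> #|` (a `\ v)%fset| = m.+1.
  by move=> va; have := am; rewrite (cardfsD1 v) va; lia.
have IHv v : v \in a ->
    has_degree (m%:Z + e) (ext (generator (aug X) (a `\ v)%fset)) /\
    bd (ext (generator (aug X) (a `\ v)%fset)) = g (generator (aug X) (a `\ v)%fset) +
      s *: ext (bd (generator (aug X) (a `\ v)%fset)).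
  move=> va; have [|dv bv] := IH (a `\ v)%fset _ (fa v).
    by rewrite cf //; lia.
  split=> //; have -> // : m%:Z + e = (#|` (a `\ v)%fset|)%:Z - 1 + e.
  by rewrite cf //; lia.
rewrite (ext_rec_step Xa am).
set z := g _ + _.
have dz : has_degree (m%:Z + e) z.
  apply: has_degreeD.
    have := g_degree (@has_degree_generator _ _ (aug X) a).
    by rewrite am; congr has_degree; lia.
  apply: has_degreeZ; rewrite ext_bd_generator //; apply: has_degree_sum => v va.
  by apply: has_degreeZ; have [] := IHv v va.
(* The induction hypothesis on the faces turns the boundary of the second summand into [s] times [g]
   of the boundary, which [g_bd] cancels. *)
have bz : bd z = 0.
  rewrite /z raddfD /= additive_scale /= g_bd.
  suff -> : bd (ext (bd (generator (aug X) a))) = g (bd (generator (aug X) a)).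
    by rewrite addNr.
  transitivity (g (bd (generator (aug X) a)) + s *: ext (bd (bd (generator (aug X) a)))).
    rewrite ext_bd_generator // raddf_sum bd_generator_in // !raddf_sum.
    rewrite -big_split; apply: eq_big_seq => v va /=.
    by rewrite !raddfZsign /= (IHv v va).2 scalerDr scalerA mulrC -scalerA.
  by rewrite bd_bd ?raddf0 ?scaler0 ?addr0 //; exact: face_closed_augX.
have [d1 b1 _] := fillY.1 (m%:Z + e) z (shift_ge0 _) dz bz.
split=> //; move: d1; rewrite am; congr has_degree; lia.
Qed.

Lemma ext_degree i c : has_degree i c -> has_degree (i + e) (ext c).
Proof.
move=> /has_degreeP dc; apply/has_degreeP => t H.
have [a [ca ta]] := coefs_additive_neq0 H.
have [/has_degreeP/(_ t ta) -> _] := ext_spec (coefs_in ca).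
by rewrite (dc a ca); lia.
Qed.

Lemma bd_ext c : bd (ext c) = g c + s *: ext (bd c).
Proof.
move: c; apply: (@chain_span _ _ (aug X)) => [|a Xa|c c' Hc Hc'].
- by rewrite !raddf0 ?scaler0 ?addr0.
- by have [] := ext_spec Xa.
- by rewrite !raddfB /= Hc Hc' ?scalerBr opprD addrACA.
Qed.

(** By induction on dimension the cycle to be filled lies near the points [p u] for vertices [u] of
    the simplex. These are close to each other on a level set, so the cycle has bounded spread and
    its filling stays near it. The dimension being bounded, finitely many steps suffice. *)
Lemma tame_ext (p : V -> W) (level : nat -> V -> Prop) :
  (forall r, exists k, forall u v, simplices X [fset u; v]%fset ->
     level r u -> level r v -> near Y k (p u) (p v)) ->
  tame p level g ->
  (forall r, exists k, forall t v w, simplices X [fset v]%fset -> level r v ->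
     coefs (b [fset v]%fset) t != 0 -> w \in t -> near Y k (p v) w) ->
  tame p level ext.
Proof.
move=> tp tg tb r; have [kp Hp] := tp r; have [kg Hg] := tg r; have [kb Hb] := tb r.
suff H m : exists k, forall a t v w, simplices X a -> (#|` a| <= m)%N ->
    (forall u, u \in a -> level r u) -> coefs (ext (generator (aug X) a)) t != 0 ->
    v \in a -> w \in t -> near Y k (p v) w.
  by have [k Hk] := H M; exists k => a t v w Xa; apply: Hk => //; exact: dimX.
elim: m => [|m [k IH]].
  by exists 0%N => a t v w Xa; rewrite leqn0 cardfs_eq0 => /eqP ->.
pose kk := maxn kg (kp + k)%N; have [l Hl] := fillY.2 (kk + kp + kk)%N.
exists (maxn kb (kp + kk + l))%N => a t v w Xa am lev eat va wt.
have Xa' : aug X a by left.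
have [a1|a1] := leqP #|` a| 1.
  have aE : a = [fset v]%fset.
    by apply/eqP; rewrite eq_sym eqEfcard fsub1set va cardfs1.
  rewrite ext_base // in eat; subst a; apply: near_le (leq_maxl _ _) _.
  exact: (Hb t v w Xa (lev v va)).
have [n an] : exists n, #|` a| = n.+2 by exists (#|` a|.-2); lia.
move: eat; rewrite (ext_rec_step Xa' an); set z := g _ + _ => zt.
have [da ba] := ext_spec Xa'.
have dz : has_degree (n%:Z + e) z.
  rewrite /z -ba; apply: has_degree_bd; move: da; rewrite an; congr has_degree; lia.
have bz : bd z = 0 by rewrite /z -ba bd_bd //; exact: face_closed_augX.
have nz t1 w1 : coefs z t1 != 0 -> w1 \in t1 -> exists2 u, u \in a & near Y kk (p u) w1.
  rewrite /z coefsD coefsZ; have [gt _|gt] := boolP (coefs (g (generator (aug X) a)) t1 != 0).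
    by move=> wt1; exists v => //; apply: near_le (leq_maxl _ _) _; exact: (Hg a t1 v w1).
  rewrite negbK in gt; rewrite (eqP gt) add0r mulf_eq0 negb_or => /andP[_].
  move=> H' wt1; have [f [fa H]] := coefs_additive_neq0 H'.
  have [a' [v' [aa' va' fE]]] := coefs_bd_neq0 fa.
  have [aE _] := coefs_generator_neq0 aa'; subst f a'.
  have f0 : (a `\ v')%fset != fset0.
    by rewrite -cardfs_gt0; have := an; rewrite (cardfsD1 v') va'; lia.
  have fs := fsubD1set a v'.
  have [u uf] := fset0Pn _ f0; have ua := fsubsetP fs _ uf.
  exists u => //; apply: near_le (leq_trans (leq_addl kp k) (leq_maxr _ _)) _.
  apply: (IH (a `\ v')%fset t1 u w1) => //.
  - exact: face_simplex Xa fs f0.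
  - by have := am; rewrite (cardfsD1 v') va'; lia.
  - by move=> u1 /(fsubsetP fs); exact: lev.
have pp u1 u2 : u1 \in a -> u2 \in a -> near Y kp (p u1) (p u2).
  move=> u1a u2a; apply: Hp; [|exact: lev|exact: lev].
  apply: face_simplex Xa _ _; last by apply/fset0Pn; exists u1; rewrite !inE eqxx.
  by apply/fsubsetP => x; rewrite !inE => /orP[] /eqP ->.
have sz : spread (kk + kp + kk)%N z.
  move=> t1 t2 w1 w2 z1 z2 w1t w2t.
  have [u1 u1a n1] := nz _ _ z1 w1t; have [u2 u2a n2] := nz _ _ z2 w2t.
  apply: near_trans n2; apply: near_trans (pp _ _ u1a u2a); exact: near_sym.
(* [close_to] locates the filling only relative to a simplex of [z], so one has to exist; otherwise
   the filling would be 0 and [t] could not occur in it. *)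
have z0 : z <> 0.
  move=> z0; have [_ _ /(_ z0) E] := fillY.1 (n%:Z + e) z (shift_ge0 _) dz bz.
  by rewrite E coefs0 eqxx in zt.
have [t1 z1] := chain_neq0 z0.
have [w1 w1t] : exists w1, w1 \in t1.
  by apply/fset0Pn; apply: has_degree_empty dz _ z1; exact: shift_ge0.
have [u ua nu] := nz _ _ z1 w1t.
have nw := Hl _ z (shift_ge0 _) dz bz sz _ _ _ _ zt z1 wt w1t.
have nz' : near Y (kp + kk) (p v) w1 by exact: near_trans (pp _ _ va ua) nu.
by apply: near_le (leq_maxr _ _) _; exact: near_trans nw.
Qed.

End Extension.

Lemma position_fset1 d (V : orderType d) (v : V) : position v [fset v]%fset = 0%N.
Proof.
rewrite /position; apply/eqP; rewrite cardfs_eq0; apply/eqP/fsetP => u.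
by rewrite !inE; have [->|] := eqVneq u v; rewrite ?ltxx.
Qed.

Lemma sum_faces_fset1 d (V : orderType d) (U : lmodType int) (v : V)
    (F : {fset V} -> U) :
  \sum_(w <- [fset v]%fset) (-1) ^+ position w [fset v]%fset *: F ([fset v] `\ w)%fset
  = F fset0.
Proof. by rewrite big_seq_fset1 position_fset1 expr0 scale1r fsetDv. Qed.

Lemma cardfs_le1 (T : choiceType) (a : {fset T}) : (#|` a| <= 1)%N ->
  a = fset0 \/ exists v, a = [fset v]%fset.
Proof.
case: (fset_0Vmem a) => [->|[v va] a1]; [by left|right; exists v].
by apply/eqP; rewrite eq_sym eqEfcard fsub1set va cardfs1.
Qed.

Lemma aug0 d (V : orderType d) (S : set {fset V}) : aug S fset0.
Proof. by right. Qed.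

Lemma bd_generator0 d (V : orderType d) (S : set {fset V}) : S fset0 ->
  bd (generator S fset0) = 0.
Proof. by move=> S0; rewrite bd_generator_in // big_seq_fset0. Qed.

Lemma bd_generator1 d (V : orderType d) (S : set {fset V}) v : S [fset v]%fset ->
  bd (generator S [fset v]%fset) = generator S fset0.
Proof. by move=> Sv; rewrite bd_generator_in // sum_faces_fset1. Qed.

Section ChainMaps.
Context {d : Order.disp_t} {V : orderType d} {d' : Order.disp_t} {W : orderType d'}.
Variables (X : metric_complex V) (Y : metric_complex W).
Variables (fill : int -> chains (aug Y) -> chains (aug Y)) (M : nat).
Hypotheses (fillY : filling (X := Y) fill)
  (dimX : forall s, simplices X s -> (#|` s| <= M)%N).

Lemma exists_chain_map (p : V -> W) :
  (forall v, simplices X [fset v]%fset -> simplices Y [fset p v]%fset) ->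
  exists phi : {additive chains (aug X) -> chains (aug Y)},
  [/\ forall i c, has_degree i c -> has_degree i (phi c),
      forall c, bd (phi c) = phi (bd c),
      phi (generator (aug X) fset0) = generator (aug Y) fset0
    & forall level, (forall r, exists k, forall u v, simplices X [fset u; v]%fset ->
         level r u -> level r v -> near Y k (p u) (p v)) -> tame p level phi].
Proof.
move=> pXY; pose b (a : {fset V}) := generator (aug Y) [fset p v | v in a]%fset.
have b0 : b fset0 = generator (aug Y) fset0 by rewrite /b imfset0.
have b1 v : b [fset v]%fset = generator (aug Y) [fset p v]%fset by rewrite /b imfset_fset1.
have b_degree a : aug X a -> (#|` a| <= 1)%N -> has_degree ((#|` a|)%:Z - 1 + 0) (b a).
  move=> _ /cardfs_le1[->|[v ->]]; rewrite ?b0 ?b1 addr0.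
    by rewrite cardfs0 -(cardfs0 W); exact: has_degree_generator.
  by rewrite cardfs1 -(cardfs1 (p v)); exact: has_degree_generator.
have b_bd a : aug X a -> (#|` a| <= 1)%N -> bd (b a) =
    (\0 : {additive chains (aug X) -> chains (aug Y)}) (generator (aug X) a) +
    1 *: \sum_(v <- a) (-1) ^+ position v a *: b (a `\ v)%fset.
  move=> Xa /cardfs_le1[a0|[v av]]; subst a; rewrite scale1r add0r.
    by rewrite b0 bd_generator0 ?big_seq_fset0 //; exact: aug0.
  rewrite sum_faces_fset1 b0 b1 bd_generator1 //; left; apply: pXY.
  by case: Xa => // /eqP; rewrite -cardfs_eq0 cardfs1.
have g_degree i (c : chains (aug X)) : has_degree i c ->
    has_degree (i + 0 - 1) ((\0 : {additive chains (aug X) -> chains (aug Y)}) c).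
  by move=> _; exact: has_degree0.
have g_bd (c : chains (aug X)) :
    bd ((\0 : {additive chains (aug X) -> chains (aug Y)}) c) =
    - (1 *: (\0 : {additive chains (aug X) -> chains (aug Y)}) (bd c)).
  by rewrite /= raddf0 scaler0 oppr0.
exists (@ext _ _ _ _ X Y fill 0 1 \0 b); split.
- move=> i c /(ext_degree fillY (lexx 0) g_degree g_bd b_degree b_bd).
  by rewrite addr0.
- move=> c; rewrite (bd_ext fillY (lexx 0) g_degree g_bd b_degree b_bd).
  by rewrite add0r scale1r.
- by rewrite /= ext_base ?cardfs0 //; exact: aug0.
- move=> level Hp.
  apply: (tame_ext fillY dimX (lexx 0) g_degree g_bd b_degree b_bd) => // r.
    by exists 0%N => s t v w _ _ /=; rewrite coefs0 eqxx.
  exists 0%N => t v w Xv lv; rewrite b1 => /coefs_generator_neq0[<- _].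
  by rewrite inE => /eqP ->; exact: near0.
Qed.

End ChainMaps.

Section Homotopies.
Context {d : Order.disp_t} {V : orderType d}.
Variables (X : metric_complex V).
Variables (fill : int -> chains (aug X) -> chains (aug X)) (M : nat).
Hypotheses (fillX : filling (X := X) fill)
  (dimX : forall s, simplices X s -> (#|` s| <= M)%N).

Lemma exists_homotopy (g : {additive chains (aug X) -> chains (aug X)}) :
  (forall i c, has_degree i c -> has_degree i (g c)) ->
  (forall c, bd (g c) = g (bd c)) -> g (generator (aug X) fset0) = 0 ->
  exists h : {additive chains (aug X) -> chains (aug X)},
  [/\ forall i c, has_degree i c -> has_degree (i + 1) (h c),
      forall c, bd (h c) + h (bd c) = g c,
      h (generator (aug X) fset0) = 0
    & forall level, tame id level g -> tame id level h].
Proof.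
move=> gd gb g0.
(* As [g] kills the empty simplex, it sends a vertex to a cycle of the augmented complex of degree
   0, which can be filled. *)
pose b (a : {fset V}) := if a == fset0 then 0 else fill 0 (g (generator (aug X) a)).
have b0 : b fset0 = 0 by rewrite /b eqxx.
have b1 v : b [fset v]%fset = fill 0 (g (generator (aug X) [fset v]%fset)).
  by rewrite /b -cardfs_eq0 cardfs1.
have dv v : has_degree 0 (g (generator (aug X) [fset v]%fset)).
  apply: gd; have := @has_degree_generator _ _ (aug X) [fset v]%fset.
  by rewrite cardfs1.
have bv v : aug X [fset v]%fset -> bd (g (generator (aug X) [fset v]%fset)) = 0.
  by move=> Xv; rewrite gb bd_generator1.
have b_degree a : aug X a -> (#|` a| <= 1)%N -> has_degree ((#|` a|)%:Z - 1 + 1) (b a).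
  move=> Xa /cardfs_le1[a0|[v av]]; subst a; first by rewrite b0; exact: has_degree0.
  by rewrite b1 cardfs1; have [] := fillX.1 0 _ (lexx 0) (dv v) (bv v Xa).
have b_bd a : aug X a -> (#|` a| <= 1)%N -> bd (b a) = g (generator (aug X) a) +
    -1 *: \sum_(v <- a) (-1) ^+ position v a *: b (a `\ v)%fset.
  move=> Xa /cardfs_le1[a0|[v av]]; subst a.
    by rewrite b0 g0 raddf0 big_seq_fset0 scaler0 addr0.
  rewrite sum_faces_fset1 b0 scaler0 addr0 b1.
  by have [] := fillX.1 0 _ (lexx 0) (dv v) (bv v Xa).
have g_degree i (c : chains (aug X)) : has_degree i c -> has_degree (i + 1 - 1) (g c).
  by rewrite addrK; exact: gd.
have g_bd c : bd (g c) = - (-1 *: g (bd c)) by rewrite scaleN1r opprK.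
exists (@ext _ _ _ _ X X fill 1 (-1) g b); split.
- by move=> i c /(ext_degree fillX ler01 g_degree g_bd b_degree b_bd).
- move=> c; rewrite (bd_ext fillX ler01 g_degree g_bd b_degree b_bd).
  by rewrite scaleN1r subrK.
- by rewrite /= ext_base ?cardfs0 //; exact: aug0.
- move=> level tg.
  apply: (tame_ext fillX dimX ler01 g_degree g_bd b_degree b_bd) => // r.
    by exists 1%N => u v Xuv _ _; apply: near_simplex Xuv _ _; rewrite !inE eqxx ?orbT.
  have [k Hk] := tg r; have [l Hl] := fillX.2 (k + k)%N.
  exists (k + l)%N => t v w Xv lv; rewrite b1; set z := g _ => zt wt.
  have nv t1 w1 : coefs z t1 != 0 -> w1 \in t1 -> near X k v w1.
    move=> zt1 wt1; apply: (Hk [fset v]%fset t1 v w1) => //; last by rewrite inE.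
    by move=> u; rewrite inE => /eqP ->.
  have bz : bd z = 0 by apply: bv; left.
  have sz : spread (k + k)%N z.
    move=> t1 t2 w1 w2 z1 z2 w1t w2t.
    by apply: near_trans (nv _ _ z2 w2t); apply/near_sym/(nv _ _ z1 w1t).
  have z0 : z <> 0.
    move=> z0; have [_ _ /(_ z0) E] := fillX.1 0 z (lexx 0) (dv v) bz.
    by rewrite E coefs0 eqxx in zt.
  have [t1 z1] := chain_neq0 z0.
  have [w1 w1t] : exists w1, w1 \in t1.
    by apply/fset0Pn; exact: has_degree_empty (dv v) (lexx 0) z1.
  by apply: near_trans (nv _ _ z1 w1t) _; exact: (Hl 0 z _ (dv v) bz sz t t1 w w1).
Qed.

End Homotopies.

(** * Contraction of the chains of X to a neighborhood of the image *)

Section Contraction.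
Context {d : Order.disp_t} {V : orderType d} {d' : Order.disp_t} {W : orderType d'}.
Variables (X : metric_complex V) (Z : metric_complex W) (F : W -> V).

Definition level (r : nat) (v : V) : Prop :=
  exists z, simplices Z [fset z]%fset /\ near X r v (F z).

Lemma level_near k r u v : level r u -> near X k v u -> level (k + r) v.
Proof. by move=> [z [Zz nz]] nv; exists z; split=> //; exact: near_trans nz. Qed.

Lemma level_le r r' v : (r <= r')%N -> level r v -> level r' v.
Proof. by move=> le [z [Zz nz]]; exists z; split=> //; exact: near_le nz. Qed.

Definition coarse_vertex_map : Prop :=
  [/\ forall z, simplices Z [fset z]%fset -> simplices X [fset F z]%fset,
      forall k, exists k', forall y z, simplices Z [fset y]%fset ->
        simplices Z [fset z]%fset -> near Z k y z -> near X k' (F y) (F z)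
    & forall k, exists k', forall y z, simplices Z [fset y]%fset ->
        simplices Z [fset z]%fset -> near X k (F y) (F z) -> near Z k' y z].

Variables (fillX_op : int -> chains (aug X) -> chains (aug X)) (MX : nat).
Hypotheses (fillX : filling (X := X) fillX_op)
  (dimX : forall s, simplices X s -> (#|` s| <= MX)%N).
Variables (fillZ_op : int -> chains (aug Z) -> chains (aug Z)) (MZ : nat).
Hypotheses (fillZ : filling (X := Z) fillZ_op)
  (dimZ : forall s, simplices Z s -> (#|` s| <= MZ)%N).
Hypotheses (FZ : coarse_vertex_map) (Z0 : exists z, simplices Z [fset z]%fset).

(** A point [z] that realizes the least level of [v] is at the same time good for all the levels
    that contain [v]. *)
Lemma exists_projection : exists p : V -> W,
  forall v, simplices X [fset v]%fset -> simplices Z [fset p v]%fset /\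
    forall r, level r v -> near X r v (F (p v)).
Proof.
have [FX _ _] := FZ.
suff H v : exists z, simplices X [fset v]%fset -> simplices Z [fset z]%fset /\
    forall r, level r v -> near X r v (F z) by have [p Hp] := choice H; exists p.
have [z0 Zz0] := Z0.
have [Xv|] := pselect (simplices X [fset v]%fset); last by exists z0.
have e : exists r, `[< level r v >].
  have [k nk] := connected_near Xv (FX _ Zz0).
  by exists k; apply/asboolP; exists z0.
case: (ex_minnP e) => r /asboolP[z [Zz nz]] mr; exists z => _; split=> // r' lr'.
by apply: near_le nz; apply/mr/asboolP.
Qed.

(** [Phi] is the composite of an extension [phi] of the projection [p] and an extension [psi] of
    [F]. Its image consists of chains [psi] of simplices of [Z], hence lies within the displacement
    [R0] of [psi] from the image of [F]. The projection is coarse only on level sets, which is why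
    [Phi] and [h] are merely tame. *)
Lemma exists_contraction : exists (Phi h : {additive chains (aug X) -> chains (aug X)})
    (R0 : nat),
  [/\ [/\ forall i c, has_degree i c -> has_degree i (Phi c),
      forall c, bd (Phi c) = Phi (bd c) &
      forall s t w, simplices X s -> coefs (Phi (generator (aug X) s)) t != 0 ->
        w \in t -> level R0 w],
      tame id level Phi,
      forall i c, has_degree i c -> has_degree (i + 1) (h c),
      forall c, bd (h c) + h (bd c) = Phi c - c
    & h (generator (aug X) fset0) = 0 /\ tame id level h].
Proof.
have [FX Fup Fdown] := FZ; have [p Hp] := exists_projection.
have [phi [phid phib phi0 phit]] :=
  exists_chain_map fillZ dimX (p := p) (fun v Xv => (Hp v Xv).1).
have [psi [psid psib psi0 psit]] := exists_chain_map fillX dimZ FX.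
have {}phit : tame p level phi.
  (* The path from [F (p u)] to [F (p v)] passes through [u] and [v]. *)
  apply: phit => r; have [k Hk] := Fdown (r + (1 + r))%N; exists k => u v Xuv lu lv.
  have [us vs] : u \in [fset u; v]%fset /\ v \in [fset u; v]%fset.
    by rewrite !inE !eqxx orbT.
  have [Zu nu] := Hp u (vertex_simplex Xuv us).
  have [Zv nv] := Hp v (vertex_simplex Xuv vs).
  apply: Hk => //; apply: near_trans (near_sym (nu _ lu)) _.
  by apply: near_trans (near_simplex Xuv us vs) (nv _ lv).
have {psit}[R0 psit] : exists k, forall s t v w, simplices Z s ->
    coefs (psi (generator (aug Z) s)) t != 0 -> v \in s -> w \in t -> near X k (F v) w.
  (* [F] is coarse on all of [Z], so the trivial level gives a uniform bound. *)
  have [|k Hk] := psit (fun _ _ => True) _ 0%N; last first.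
    by exists k => s t v w Zs; exact: Hk.
  move=> r; have [k Hk] := Fup 1%N; exists k => u v Zuv _ _.
  have [us vs] : u \in [fset u; v]%fset /\ v \in [fset u; v]%fset.
    by rewrite !inE !eqxx orbT.
  by apply: Hk; [exact: vertex_simplex us|exact: vertex_simplex vs|exact: near_simplex us vs].
have compP s t : simplices X s -> coefs (psi (phi (generator (aug X) s))) t != 0 ->
    exists t', [/\ simplices Z t', t' != fset0,
      coefs (phi (generator (aug X) s)) t' != 0
      & coefs (psi (generator (aug Z) t')) t != 0].
  move=> Xs H; have [t' [pt' st]] := coefs_additive_neq0 H; exists t'.
  have t'0 : t' != fset0.
    apply: has_degree_empty (phid _ _ (@has_degree_generator _ _ (aug X) s)) _ pt'.
    by rewrite subr_ge0 lez_nat cardfs_gt0; apply/fset0Pn/(simplex_vertex Xs).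
  by split=> //; exact: aug_simplex (coefs_in pt') t'0.
have tPhi : tame id level (psi \o phi).
  move=> r; have [k1 H1] := phit r; have [k2 H2] := Fup k1.
  exists (r + (k2 + R0))%N => s t v w Xs lev H vs wt.
  have [t' [Zt' /fset0Pn[w' wt'] pt' st]] := compP s t Xs H.
  have [Zp np] := Hp v (vertex_simplex Xs vs).
  apply: near_trans (np _ (lev v vs)) _.
  apply: near_trans (psit _ _ _ _ Zt' st wt' wt).
  by apply: H2 => //; [exact: vertex_simplex wt'|exact: (H1 s t' v w')].
pose g : {additive chains (aug X) -> chains (aug X)} := (psi \o phi) \- idfun.
have gd i c : has_degree i c -> has_degree i (g c).
  by move=> dc; apply: has_degreeB => //=; exact/psid/phid.
have gb c : bd (g c) = g (bd c) by rewrite /= raddfB /= psib phib.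
have g0 : g (generator (aug X) fset0) = 0 by rewrite /= phi0 psi0 subrr.
have [h [hd hb h0 ht]] := exists_homotopy fillX dimX gd gb g0.
exists (psi \o phi), h, R0; split=> //.
- split=> [i c dc|c|s t w Xs H wt]; [exact/psid/phid|by rewrite /= psib phib|].
  have [t' [Zt' /fset0Pn[w' wt'] _ st]] := compP s t Xs H.
  exists w'; split; first exact: vertex_simplex wt'.
  by apply: near_sym; exact: psit Zt' st wt' wt.
- split=> //; apply: ht => r; have [k Hk] := tPhi r; exists (k + 1)%N.
  move=> s t v w Xs lev; rewrite /= coefsB => H vs wt.
  have [E|E] := eqVneq (coefs (psi (phi (generator (aug X) s))) t) 0; last first.
    by apply: near_le (leq_addr _ _) _; exact: (Hk s t v w).
  move: H; rewrite E sub0r oppr_eq0 => /coefs_generator_neq0[st _]; subst t.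
  by apply: near_le (leq_addl _ _) _; exact: near_simplex Xs vs wt.
Qed.

End Contraction.

(** * Alexander duality on chains *)

Section Augmentation.
Context {d : Order.disp_t} {V : orderType d}.
Variable X : metric_complex V.

Lemma not_simplex0 : ~ simplices X fset0.
Proof. exact: (mc_complex X).1. Qed.

Lemma coefs_fset0 (c : chains X) : coefs c fset0 = 0.
Proof. by apply: coefs_out; exact: not_simplex0. Qed.

Lemma aug_ext (b c : chains (aug X)) : push X b = push X c ->
  coefs b fset0 = coefs c fset0 -> b = c.
Proof.
move=> E E0; apply: coefs_ext => s; have [Xs|Xs] := pselect (simplices X s).
  by rewrite -[LHS](coefs_push _ Xs) E coefs_push.
have [->//|s0] := eqVneq s fset0.
by rewrite !coefs_out // => -[//|s0']; rewrite s0' eqxx in s0.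
Qed.

Lemma push_drop_bd (c : chains (aug X)) : push X (bd c) = bd (push X c).
Proof.
move: c; apply: (@chain_span _ _ (aug X)) => [|s Xs|b c Hb Hc].
- by rewrite !raddf0.
- case: (Xs) => [Xs'|s0].
    rewrite push_generator_in // !bd_generator_in // raddf_sum.
    apply: eq_bigr => v _; rewrite raddfZsign /= push_generator_in //.
    exact: face_closed_augX Xs (fsubD1set _ _).
  rewrite s0 bd_generator0 ?push_generator_in ?generator_out ?raddf0 //;
    [exact: not_simplex0|exact: aug0|exact: aug0].
- by rewrite !raddfB /= Hb Hc.
Qed.

Lemma push_augK (c : chains X) : push X (push (aug X) c) = c.
Proof. by apply: pushK => s; left. Qed.

(** Poincaré duality lives on chains of X, fillings on augmented chains. Extension by zero does not
    commute with boundaries in degree 0, where a vertex acquires the empty face; in positive degree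
    that face is excluded by its dimension. *)
Lemma push_aug_bd i (c : chains X) : has_degree i c -> 0 < i ->
  push (aug X) (bd c) = bd (push (aug X) c).
Proof.
move=> dc i0; apply: aug_ext; first by rewrite push_drop_bd !push_augK.
rewrite coefs_push ?coefs_fset0; last exact: aug0.
apply/esym/eqP; apply: contraT => H.
have db : has_degree (i - 1) (bd (push (aug X) c)).
  by apply/has_degree_bd/has_degree_push; rewrite subrK.
by have := has_degree_empty db _ H; rewrite eqxx; apply; lia.
Qed.

Lemma push_dropK i (c : chains (aug X)) : has_degree i c -> 0 <= i ->
  push (aug X) (push X c) = c.
Proof.
move=> dc i0; apply: aug_ext; first by rewrite push_augK.
rewrite coefs_push ?coefs_fset0; last exact: aug0.
apply/esym/eqP; apply: contraT => H.
by have := has_degree_empty dc i0 H; rewrite eqxx.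
Qed.

Lemma ev_bd (c : chains X) (y : chains (aug X)) :
  ev (coefs c) (bd y) = ev (coefs (cobd c)) y.
Proof.
rewrite -ev_comp; apply: eq_ev => s /coefs_in Xs.
rewrite -(@ev_push _ _ (aug X) X) => [|t]; last exact: coefs_out.
rewrite push_drop_bd push_generator_in //; case: Xs => [Xs|->].
  exact/esym/coefs_cobd.
rewrite coefs_fset0 generator_out ?raddf0 //; exact: not_simplex0.
Qed.

Lemma bd_bd_simplices (c : chains X) : bd (bd c) = 0.
Proof.
rewrite -[c]push_augK -!push_drop_bd bd_bd ?raddf0 //; exact: face_closed_augX.
Qed.

End Augmentation.

Section Duality.
Context {R : realType} {d : Order.disp_t} {V : orderType d}.
Context {d' : Order.disp_t} {W : orderType d'}.
Variables (X : metric_complex V) (Z : metric_complex W) (F : W -> V).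
Variables (n : nat) (hX : coarse_PD R n X).

Local Notation level := (level X Z F).
Local Notation P := (pd_P hX).
Local Notation Pbar := (pd_Pbar hX).

Let D := (pd_E0 hX).+1.

Definition level_set r : set {fset V} :=
  [set s | simplices X s /\ forall v, v \in s -> level r v].

Definition vanishes r (c : chains X) : Prop :=
  forall s, level_set r s -> coefs c s = 0.

Definition far (S : set {fset V}) r (c : chains S) : Prop :=
  forall s v, coefs c s != 0 -> v \in s -> ~ level r v.

Lemma near_P s t v w : simplices X s -> coefs (P (generator X s)) t != 0 ->
  v \in s -> w \in t -> near X D v w.
Proof.
move=> Xs st vs wt; apply: (cochain_displaced _ Xs st vs wt).
exact: pd_P_displacement.
Qed.

Lemma near_Pbar s t v w : simplices X s -> coefs (Pbar (generator X s)) t != 0 ->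
  v \in s -> w \in t -> near X D v w.
Proof.
move=> Xs st vs wt; apply: (chain_displaced _ Xs st vs wt).
exact: pd_Pbar_displacement.
Qed.

Lemma far_le (S : set {fset V}) r r' (c : chains S) : (r <= r')%N ->
  far r' c -> far r c.
Proof. by move=> le fc s v cs vs lv; apply: (fc s v cs vs); exact: level_le lv. Qed.

Lemma farD (S : set {fset V}) r (b c : chains S) : far r b -> far r c -> far r (b + c).
Proof.
move=> fb fc s v; rewrite coefsD; have [->|/fb] := eqVneq (coefs b s) 0; last by auto.
by rewrite add0r; exact: fc.
Qed.

Lemma farN (S : set {fset V}) r (c : chains S) : far r c -> far r (- c).
Proof. by move=> fc s v; rewrite coefsN oppr_eq0; exact: fc. Qed.

Lemma far_push (S T : set {fset V}) r (c : chains S) : far r c -> far r (push T c).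
Proof. by move=> fc s v /coefs_push_neq0; exact: fc. Qed.

(** Displacement holds for every pair of vertices of a simplex and of its image: one vertex of the
    image in level [r] puts the whole simplex into level [D + r]. This exchanges [far] and
    [vanishes], here and in [vanishes_Pbar]. *)
Lemma far_P r c : vanishes (D + r) c -> far r (P c).
Proof.
move=> vc t w H wt lw; have [s [cs st]] := coefs_additive_neq0 H.
have Xs := coefs_in cs; apply/negP: cs; rewrite negbK; apply/eqP/vc; split=> // v vs.
by apply: level_near lw _; exact: near_P st vs wt.
Qed.

Lemma vanishes_Pbar r c : far (D + r) c -> vanishes r (Pbar c).
Proof.
move=> fc t [Xt lt]; apply/eqP; apply: contraT => H.
have [s [cs st]] := coefs_additive_neq0 H; have Xs := coefs_in cs.
have [v vs] := simplex_vertex Xs; have [w wt] := simplex_vertex Xt.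
case: (fc s v cs vs); apply: level_near (lt w wt) _.
exact: near_Pbar st vs wt.
Qed.

(** The closure of a complement still touches the level set. A simplex in it is a face of one with a
    vertex outside, and that vertex is one edge away; hence the shift by 1. *)
Lemma carried_far r z : carried (aug (closure_compl X (level_set r.+1))) z ->
  far r (z : chains (aug X)).
Proof.
move=> /carriedP cz s v /cz [[_ [t [Xt Lt st]]]|-> //] vs lv.
apply: Lt; split=> // u ut; rewrite -add1n; apply: level_near lv _.
by apply: near_simplex Xt ut _; exact: (fsubsetP st).
Qed.

Lemma far_carried r z : far r (z : chains (aug X)) ->
  carried (aug (closure_compl X (level_set r))) z.
Proof.
move=> fz; apply/carriedP => s zs; have [->|s0] := eqVneq s fset0; [by right|left].
have Xs := aug_simplex (coefs_in zs) s0; have [v vs] := simplex_vertex Xs.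
by split=> //; exists s; split=> // -[_ /(_ v vs)]; exact: fz zs vs.
Qed.

Lemma P_degree i k u : n%:Z - k = i -> has_degree k u -> has_degree i (P u).
Proof. by move=> <-; exact: pd_P_degree. Qed.

Lemma Pbar_degree i k c : n%:Z - k = i -> has_degree i c -> has_degree k (Pbar c).
Proof. by move=> <-; exact: pd_Pbar_degree. Qed.

Lemma P_Pbar_bd c : P (Pbar (bd c)) = bd (P (Pbar c)).
Proof. by rewrite pd_Pbar_cochain pd_P_cochain. Qed.

(** The homotopy in [hX] makes the difference the boundary of a 1-chain, so [P Pbar] preserves the
    augmentation. *)
Lemma bd_P_Pbar_vertex v : simplices X [fset v]%fset ->
  bd (push (aug X) (P (Pbar (generator X [fset v]%fset)) - generator X [fset v]%fset)) = 0.
Proof.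
move=> Xv; have [H [dH HE _]] := pd_homotopy_chain hX.
rewrite HE bd_generator1 // (generator_out (@not_simplex0 _ _ X)) raddf0 addr0.
rewrite (push_aug_bd (i := 1)) //; first by rewrite bd_bd //; exact: face_closed_augX.
apply: (dH 0); have := @has_degree_generator _ _ X [fset v]%fset.
by rewrite cardfs1.
Qed.

(* The homotopy is rebuilt by filling, because the control on the one in [hX]
   bounds the diameter of the image of a simplex, not its distance to the
   simplex. *)
Lemma exists_duality_homotopy (fill : int -> chains (aug X) -> chains (aug X)) (M : nat) :
  filling (X := X) fill -> (forall s, simplices X s -> (#|` s| <= M)%N) ->
  exists (k : {additive chains (aug X) -> chains (aug X)}) (D2 : nat),
  [/\ forall i c, has_degree i c -> has_degree (i + 1) (k c),
    forall c, bd (k c) + k (bd c) =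
      push (aug X) (P (Pbar (push X c))) - push (aug X) (push X c)
    & forall r c, far (D2 + r) c -> far r (k c)].
Proof.
move=> fillX dimX.
pose g : {additive chains (aug X) -> chains (aug X)} :=
  @push _ _ X (aug X) \o (((P \o Pbar) \- idfun) \o @push _ _ (aug X) X).
have gE c : g c = push (aug X) (P (Pbar (push X c)) - push X c) by [].
have gd i c : has_degree i c -> has_degree i (g c).
  move=> dc; rewrite gE; apply: has_degree_push; apply: has_degreeB; last exact: has_degree_push.
  have dp : has_degree i (push X c) by exact: has_degree_push.
  apply: (@P_degree _ (n%:Z - i)); first by rewrite opprB addrC subrK.
  by apply: Pbar_degree dp; rewrite opprB addrC subrK.
have X0 := @not_simplex0 _ _ X.
have g0 : g (generator (aug X) fset0) = 0.
  rewrite gE push_generator_in; last exact: aug0.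
  by rewrite (generator_out X0) !raddf0 ?addr0 ?raddf0.
have gb c : bd (g c) = g (bd c).
  move: c; apply: (@chain_span _ _ (aug X)) => [|s Xs|b c Hb Hc].
  - by rewrite !raddf0.
  (* In degree 0 the augmentation enters, through [bd_P_Pbar_vertex]; in positive degree extension
     by zero commutes with [bd]. *)
  - have [s1|s1] := leqP #|` s| 1.
      have [s0|[v sv]] := cardfs_le1 s1; subst s.
        by rewrite bd_generator0 // g0 !raddf0.
      rewrite bd_generator1 // g0 gE push_generator_in //; apply: bd_P_Pbar_vertex.
      by case: Xs => // /eqP; rewrite -cardfs_eq0 cardfs1.
    rewrite !gE push_drop_bd push_generator_in // P_Pbar_bd -raddfB.
    apply/esym/(@push_aug_bd _ _ _ ((#|` s|)%:Z - 1)); last by lia.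
    have ds := @has_degree_generator _ _ X s.
    apply: has_degreeB => //; apply: (@P_degree _ (n%:Z - (#|` s|%:Z - 1))).
      by rewrite opprB addrC subrK.
    by apply: Pbar_degree ds; rewrite opprB addrC subrK.
  - by rewrite !raddfB /= in Hb Hc *; rewrite Hb Hc.
have [k [kd kb k0 kt]] := exists_homotopy fillX dimX gd gb g0.
(* The displacement of [P Pbar] is bounded on all of X, so the trivial level yields a constant [D2]
   that does not depend on [r]. *)
have [|D2 HD] := kt (fun _ _ => True) _ 0%N.
  move=> _; exists (D + D)%N => s t v w Xs _; rewrite gE.
  move=> /coefs_push_neq0; rewrite push_generator_in; last by left.
  rewrite coefsB => H vs wt.
  have [E|E] := eqVneq (coefs (P (Pbar (generator X s))) t) 0; last first.
    have [t' [t1 t2]] := coefs_additive_neq0 E; have Xt' := coefs_in t1.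
    have [w' wt'] := simplex_vertex Xt'.
    by apply: near_trans (near_Pbar Xs t1 vs wt') _; exact: near_P Xt' t2 wt' wt.
  move: H; rewrite E sub0r oppr_eq0 => /coefs_generator_neq0[st _]; subst t.
  by apply: near_le (near_simplex Xs vs wt); rewrite /D; lia.
exists k, D2; split=> [//|c|r c fc t w H wt lw]; first by rewrite kb gE raddfB.
have [s [cs st]] := coefs_additive_neq0 H.
have [s0|s0] := eqVneq s fset0; first by rewrite s0 k0 coefs0 eqxx in st.
have Xs := aug_simplex (coefs_in cs) s0; have [v vs] := simplex_vertex Xs.
apply: (fc s v cs vs); apply: level_near lw _.
exact: (HD s t v w Xs).
Qed.

(** * Pullback of compactly supported cochains *)

Section Pullback.
Variable T : {additive chains (aug X) -> chains (aug X)}.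
Hypothesis tameT : tame id level T.

(* The transpose of [T], cut off at level [b] to have compact support. *)
Definition pull b (c : chains X) : chains X := mkchain X (fun s =>
  if pselect (level_set b s) then ev (coefs c) (T (generator (aug X) s)) else 0).

(** The cut-off function has finite support: on level [b] tameness has a constant [k], so a simplex
    whose image meets the finite support of [c] is within [k] of that support. *)
Lemma coefs_pull b c s : level_set b s ->
  coefs (pull b c) s = ev (coefs c) (T (generator (aug X) s)).
Proof.
move=> bs; rewrite /pull coefs_mkchain //; [by case: pselect| |by case: bs].
have [k Hk] := tameT b; have [l Hl] := chain_support c.
apply: (@sub_finite_set _ _ (\bigcup_(t in [set t | t \in l /\ simplices X t])
  \bigcup_(w in [set` t]) [set s | simplices X s /\ exists2 v, v \in s & near X k w v])).
  move=> a /= [Xa]; case: pselect => [ba|nba]; last by rewrite eqxx.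
  have [_ la] := ba.
  move=> /ev_neq0[t [at_ ct]]; have Xt := coefs_in ct.
  have [w wt] := simplex_vertex Xt; have [v va] := simplex_vertex Xa.
  exists t; first by split=> //; exact: Hl.
  exists w => //; split=> //; exists v => //; apply: near_sym.
  exact: (Hk a t v w).
apply: bigcup_finite.
  apply: (@sub_finite_set _ _ [set` l]); first by move=> t [].
  exact: finite_seq.
move=> t [_ Xt]; apply: bigcup_finite; first exact: finite_fset.
by move=> w wt; apply: finite_simplices_near; exact: vertex_simplex wt.
Qed.

Lemma coefs_pull_out b c s : ~ level_set b s -> coefs (pull b c) s = 0.
Proof.
move=> bs; apply/eqP; apply: contraT; rewrite /pull /mkchain coefs_sum => H.
suff /eqP : \sum_(a <- fset_set [set a : set_type X |
    (if pselect (level_set b (val a))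
     then ev (coefs c) (T (generator (aug X) (val a))) else 0) != 0])
  coefs ((if pselect (level_set b (val a))
     then ev (coefs c) (T (generator (aug X) (val a))) else 0)
     *: generator X (val a)) s = 0 by rewrite (negbTE H).
apply: big1 => a _; rewrite coefsZ; case: pselect => [ba|nba]; last exact: mul0r.
rewrite (_ : coefs _ s = 0) ?mulr0 //; apply/eqP; apply: contraT.
by move=> /coefs_generator_neq0[E _]; case: bs; rewrite -E.
Qed.

Lemma pull_degree e k b c : (forall i y, has_degree i y -> has_degree (i + e) (T y)) ->
  has_degree k c -> has_degree (k - e) (pull b c).
Proof.
move=> dT /has_degreeP dc; apply/has_degreeP => s H.
have bs : level_set b s.
  by apply: contrapT => bs; rewrite coefs_pull_out ?eqxx in H.
move: H; rewrite coefs_pull // => /ev_neq0[t [st ct]].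
have /has_degreeP := dT _ _ (@has_degree_generator _ _ (aug X) s).
by move=> /(_ t st); rewrite (dc t ct); lia.
Qed.

(** Level sets are closed under faces, so the cut-off is invisible in coboundaries evaluated inside
    them. The hypothesis on the empty simplex handles the additional face of a vertex. *)
Lemma ev_bd_pull b c s : ev (coefs c) (T (generator (aug X) fset0)) = 0 ->
  level_set b s -> ev (coefs (pull b c)) (bd (generator X s)) =
    ev (coefs c) (T (bd (generator (aug X) s))).
Proof.
move=> T0 bs; have [Xs ls] := bs; have Xs' : aug X s by left.
rewrite -(push_generator_in X Xs') -push_drop_bd ev_push => [|t]; last exact: coefs_out.
rewrite -ev_comp; apply: eq_ev => t /coefs_bd_neq0[s' [v [/coefs_generator_neq0[<- _] _ tE]]].
have [t0|t0] := eqVneq t fset0; first by rewrite t0 coefs_fset0 T0.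
have ts : (t `<=` s)%fset by rewrite tE fsubD1set.
apply: coefs_pull; split; first exact: face_simplex Xs ts t0.
by move=> u /(fsubsetP ts); exact: ls.
Qed.

End Pullback.

Variables (fill : int -> chains (aug X) -> chains (aug X)) (M : nat).
Hypotheses (fillX : filling (X := X) fill)
  (dimX : forall s, simplices X s -> (#|` s| <= M)%N).
Variables (Phi h : {additive chains (aug X) -> chains (aug X)}) (R0 : nat).
Hypotheses (Phi_degree : forall i c, has_degree i c -> has_degree i (Phi c))
  (Phi_bd : forall c, bd (Phi c) = Phi (bd c))
  (Phi_level : forall s t w, simplices X s ->
     coefs (Phi (generator (aug X) s)) t != 0 -> w \in t -> level R0 w)
  (Phi_tame : tame id level Phi)
  (h_degree : forall i c, has_degree i c -> has_degree (i + 1) (h c))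
  (h_homotopy : forall c, bd (h c) + h (bd c) = Phi c - c)
  (h0 : h (generator (aug X) fset0) = 0) (h_tame : tame id level h).

Lemma ev_vanishes r c (y : chains (aug X)) : vanishes r c ->
  (forall t w, coefs y t != 0 -> w \in t -> level r w) -> ev (coefs c) y = 0.
Proof.
move=> vc ly; apply/eqP; apply: contraT => /ev_neq0[t [yt /[dup] ct /negP[]]].
apply/eqP/vc; split; first exact: coefs_in ct.
by move=> w; exact: ly yt.
Qed.

Lemma ev_Phi0 (c : chains X) : ev (coefs c) (Phi (generator (aug X) fset0)) = 0.
Proof.
apply/eqP; apply: contraT => /ev_neq0[t [yt]].
have := @has_degree_generator _ _ (aug X) fset0; rewrite cardfs0 => /Phi_degree.
move=> /has_degreeP/(_ t yt) t0; have {t0} -> : t = fset0.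
  by apply/eqP; rewrite -cardfs_eq0; lia.
by rewrite coefs_fset0 eqxx.
Qed.

(** [Phi] is a chain map into level [R0], so the coboundary of the pullback only sees [cobd c]
    there. The level [b] is therefore arbitrary. *)
Lemma vanishes_cobd_pull b c : vanishes R0 (cobd c) -> vanishes b (cobd (pull Phi b c)).
Proof.
move=> vc s bs; have [Xs _] := bs; rewrite coefs_cobd //.
rewrite (ev_bd_pull Phi_tame (ev_Phi0 c) bs) -Phi_bd ev_bd.
by apply: ev_vanishes vc _ => t w; exact: Phi_level.
Qed.

Lemma vanishes_pull b c : vanishes R0 c -> pull Phi b c = 0.
Proof.
move=> vc; apply: coefs_ext => s; rewrite coefs0.
have [bs|bs] := pselect (level_set b s); last exact: coefs_pull_out.
rewrite coefs_pull //; apply: ev_vanishes vc _ => t w.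
by apply: Phi_level; case: bs.
Qed.

(** Transposing the homotopy formula, the difference left is the pullback of [cobd c] by [h]. It
    vanishes on level [r] because [h] takes that level set into level [R1]. *)
Lemma vanishes_pull_homotopy r R1 b c : (r <= b)%N ->
  (forall s t w, level_set r s -> coefs (h (generator (aug X) s)) t != 0 ->
     w \in t -> level R1 w) ->
  vanishes R1 (cobd c) -> vanishes r (pull Phi b c - c - cobd (pull h b c)).
Proof.
move=> rb hl vc s rs; have [Xs ls] := rs.
have bs : level_set b s by split=> // v /ls; exact: level_le.
have ev_h0 : ev (coefs c) (h (generator (aug X) fset0)) = 0 by rewrite h0 raddf0.
rewrite !coefsB coefs_pull // coefs_cobd // (ev_bd_pull h_tame ev_h0 bs).
have -> : coefs c s = ev (coefs c) (generator (aug X) s).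
  by rewrite ev_generator //; left.
rewrite -!raddfB -h_homotopy addrK /= ev_bd.
by apply: ev_vanishes vc _ => t w; exact: hl.
Qed.

(** The bound [r1] depends on [r] alone, while the cut-off [b] is free. Large [b] gives
    [cycles_lift]; when the pullback is 0, the same identity gives [boundaries_lift]. *)
Lemma shift_cycle r : exists r1, forall i z w b, 0 <= i -> has_degree i z ->
  has_degree (i + 1) w -> bd w = z -> far r1 z -> (r1 <= b)%N ->
  let c' := pull Phi (D + b) (Pbar (push X w)) in
  [/\ has_degree (i + 1) (push (aug X) (P c')),
    far b (bd (push (aug X) (P c')))
    & exists u, [/\ has_degree (i + 1) u, far r u
        & bd (push (aug X) (P c')) = z + bd u]].
Proof.
have [k [D2 [kd kb kf]]] := exists_duality_homotopy fillX dimX.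
(* [P] takes cochains vanishing on level [R2] to chains far from level [r]. The homotopy [h] maps
   level [R2] into level [l + R2], and the summand [R0] makes [R1] serve for [Phi] too. *)
pose R2 := (D + r)%N; have [l Hl] := h_tame R2; pose R1 := (R0 + (l + R2))%N.
(* [R1 + D] makes [Pbar z], the coboundary of [c], vanish on level [R1]; [D2 + r] keeps [k z] far
   from level [r]; and [r <= b] gives [R2 <= D + b]. *)
exists (R1 + D + D2 + r)%N => i z w b i0 dz dw bw fz r1b.
set c := Pbar (push X w) => c'; set kk := n%:Z - (i + 1).
have dc : has_degree kk c.
  by apply: (@Pbar_degree (i + 1)); [rewrite /kk; lia|exact: has_degree_push].
have dc' : has_degree kk c'.
  rewrite -[kk]subr0; apply: pull_degree dc => // j y dy.
  by rewrite addr0; exact: Phi_degree.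
have dP u : has_degree kk u -> has_degree (i + 1) (P u).
  by apply: P_degree; rewrite /kk; lia.
have bP u : has_degree kk u -> push (aug X) (bd (P u)) = bd (push (aug X) (P u)).
  by move=> /dP du; apply: push_aug_bd du _; lia.
have bz : bd z = 0 by rewrite -bw bd_bd //; exact: face_closed_augX.
have cc : cobd c = Pbar (push X z).
  by rewrite /c -pd_Pbar_cochain -push_drop_bd bw.
have v1 : vanishes R1 (cobd c).
  by rewrite cc; apply/vanishes_Pbar/far_push; apply: far_le fz; rewrite /R1; lia.
have v0 : vanishes R0 (cobd c).
  by move=> s [Xs ls]; apply: v1; split=> // v /ls; apply: level_le; rewrite /R1; lia.
split.
- exact/has_degree_push/dP.
- rewrite -bP // -pd_P_cochain; apply/far_push/far_P; exact: vanishes_cobd_pull.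
set e := pull h (D + b) c; pose q := c' - c - cobd e.
have de : has_degree (kk - 1) e by exact: pull_degree dc.
have hl s t v : level_set R2 s -> coefs (h (generator (aug X) s)) t != 0 ->
    v \in t -> level R1 v.
  move=> [Xs ls] st vt; have [u us] := simplex_vertex Xs.
  apply: level_le (level_near (ls u us) (near_sym (Hl s t u v Xs ls st us vt))).
  exact: leq_addl.
have vq : vanishes R2 q.
  by apply: (vanishes_pull_homotopy _ hl v1); rewrite /R2; lia.
have PqE : P q = P c' - P c - bd (P e) by rewrite !raddfB /= pd_P_cochain.
have dPq : has_degree (i + 1) (P q).
  rewrite PqE; apply: has_degreeB; first by apply: has_degreeB; exact: dP.
  by apply: has_degree_bd; apply: (P_degree _ de); rewrite /kk; lia.
exists (k z + push (aug X) (P q)); split.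
- by apply: has_degreeD; [exact: kd|exact: has_degree_push].
- apply: farD; last exact/far_push/far_P.
  by apply: kf; apply: far_le fz; lia.
rewrite -bP // raddfD /= addrA.
(* [k] compares [z] with [P (Pbar z)], that is [P (cobd c)], the boundary of [P c]. Afterwards [P q]
   differs from [P c' - P c] by the boundary of [P e], which [bd] kills. *)
have -> : z + bd (k z) = push (aug X) (bd (P c)).
  rewrite -pd_P_cochain cc.
  have := kb z; rewrite bz raddf0 addr0 (push_dropK dz i0) => ->.
  by rewrite addrC subrK.
rewrite -(push_aug_bd dPq) ?ltz_addr1 //; last by lia.
rewrite -raddfD /= PqE !raddfB /= bd_bd_simplices subr0.
by rewrite addrC subrK.
Qed.

(* The Mittag-Leffler condition for the homology of the complements of the level
   sets; [boundaries_lift] adds that the limit embeds in the homology of one of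
   them. *)
Definition cycles_lift (i : int) : Prop := forall r, exists2 r', (r <= r')%N &
  forall r'', (r' <= r'')%N -> forall z : chains (aug X),
  has_degree i z -> bd z = 0 -> carried (aug (closure_compl X (level_set r'))) z ->
  exists z' u, [/\ has_degree i z', bd z' = 0,
    carried (aug (closure_compl X (level_set r''))) z',
    has_degree (i + 1) u /\ carried (aug (closure_compl X (level_set r))) u
    & z - z' = bd u].

Definition boundaries_lift (i : int) : Prop := exists r0, forall r, exists2 r', (r0 <= r')%N &
  forall z w : chains (aug X), has_degree i z -> bd z = 0 ->
  carried (aug (closure_compl X (level_set r'))) z ->
  has_degree (i + 1) w -> carried (aug (closure_compl X (level_set r0))) w ->
  bd w = z -> exists u, [/\ has_degree (i + 1) u,
    carried (aug (closure_compl X (level_set r))) u & bd u = z].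

Lemma cycles_lift_ge0 i : 0 <= i -> cycles_lift i.
Proof.
move=> i0 r; have [r1 H] := shift_cycle r; exists (r + r1).+1; first by lia.
move=> r'' rr z dz bz /carried_far fz.
have [dw bw _] := fillX.1 i z i0 dz bz.
have fz1 : far r1 z by apply: far_le fz; exact: leq_addl.
have [dP fP [u [du fu E]]] := H i z _ (r'' + r1)%N i0 dz dw bw fz1 (leq_addl _ _).
exists (bd (push (aug X) (P (pull Phi (D + (r'' + r1)) (Pbar (push X (fill i z))))))), (- u).
split; rewrite ?bd_bd //; try exact: face_closed_augX.
- exact: has_degree_bd.
- by apply: far_carried; apply: far_le fP; exact: leq_addr.
- by split; [exact: has_degreeN|exact/far_carried/farN].
- by rewrite E opprD addNKr raddfN.
Qed.

(** The constant [r0] is such that [Pbar w] vanishes on level [R0]. Its pullback by [Phi] is then 0,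
    and [shift_cycle] reads [0 = z + bd u]. *)
Lemma boundaries_lift_ge0 i : 0 <= i -> boundaries_lift i.
Proof.
move=> i0; exists (D + R0).+1 => r; have [r1 H] := shift_cycle r.
exists (D + R0 + r1).+1; first by lia.
move=> z w dz bz /carried_far fz dw /carried_far fw bw.
have fz1 : far r1 z by apply: far_le fz; exact: leq_addl.
have [_ _ [u [du fu E]]] := H i z w r1 i0 dz dw bw fz1 (leqnn r1).
exists (- u); split; [exact: has_degreeN|exact/far_carried/farN|].
move: E; rewrite vanishes_pull; last exact/vanishes_Pbar/far_push.
by rewrite !raddf0 raddfN => /eqP; rewrite eq_sym addr_eq0 => /eqP ->.
Qed.

Lemma support_fset0 i (z : chains (aug X)) s : i < 0 -> has_degree i z ->
  coefs z s != 0 -> s = fset0.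
Proof.
move=> i0 /has_degreeP dz /dz H; apply/eqP; rewrite -cardfs_eq0; lia.
Qed.

(** Chains of negative degree are multiples of the empty simplex, which lies in every augmented
    complement. *)
Lemma cycles_lift_lt0 i : i < 0 -> cycles_lift i.
Proof.
move=> i0 r; exists r => // r'' _ z dz bz _; exists z, 0.
split; rewrite ?subrr ?raddf0 //; last by split; [exact: has_degree0|exact: carried0].
by apply/carriedP => s /(support_fset0 i0 dz) ->; right.
Qed.

(** If some level set is all of X, its complement is empty and [w] has zero boundary. Otherwise
    every complement has a vertex, whose boundary is the empty simplex. *)
Lemma boundaries_lift_lt0 i : i < 0 -> boundaries_lift i.
Proof.
move=> i0; have [[r0 Hr0]|N] := pselect (exists r0, simplices X `<=` level_set r0).
  exists r0 => r; exists r0 => // z w dz _ _ _ /carriedP cw bw; exists 0.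
  split; [exact: has_degree0|exact: carried0|rewrite raddf0 -bw].
  apply: coefs_ext => s; rewrite coefs0; apply/esym/eqP; apply: contraT.
  move=> /coefs_bd_neq0[t [v [/cw [[_ [t1 [Xt1 Lt1 _]]]|-> //] _ _]]].
  by case: Lt1; exact: Hr0.
exists 0%N => r; exists 0%N => // z w dz _ _ _ _ _.
have [s Xs ns] : exists2 s, simplices X s & ~ level_set r s.
  by apply: contrapT => H; apply: N; exists r => s Xs; apply: contrapT => ns; apply: H; exists s.
have [v vs] := simplex_vertex Xs; have Xv := vertex_simplex Xs vs.
exists (coefs z fset0 *: generator (aug X) [fset v]%fset); split.
- have [->|z0] := eqVneq (coefs z fset0) 0; first by rewrite scale0r; exact: has_degree0.
  have /has_degreeP/(_ _ z0) := dz; rewrite cardfs0 => <-.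
  apply: has_degreeZ; have := @has_degree_generator _ _ (aug X) [fset v]%fset.
  by rewrite cardfs1.
- apply/carriedP => t; rewrite coefsZ => H; left.
  have [<- _] : [fset v]%fset = t /\ aug X [fset v]%fset.
    by apply: coefs_generator_neq0; apply: contraNneq H => ->; rewrite mulr0.
  split; first by apply/fset0Pn; exists v; rewrite inE.
  by exists s; split=> //; rewrite fsub1set.
rewrite additive_scale /= bd_generator1; last by left.
apply: coefs_ext => t; rewrite coefsZ coefs_generator; last exact: aug0.
have [<-|t0] := eqVneq fset0 t; first by rewrite mulr1.
rewrite mulr0; apply/esym/eqP; apply: contraT => /(support_fset0 i0 dz) E.
by rewrite E eqxx in t0.
Qed.

Lemma cycles_liftP i : cycles_lift i.
Proof. by case: (leP 0 i) => [/cycles_lift_ge0|/cycles_lift_lt0]. Qed.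

Lemma boundaries_liftP i : boundaries_lift i.
Proof. by case: (leP 0 i) => [/boundaries_lift_ge0|/boundaries_lift_lt0]. Qed.

End Duality.

(** * Inverse limits of towers *)

Section CofinalTower.
(** The record [inverse_system] includes neither transitivity of the order nor functoriality of the
    bonds; both are hypotheses here. *)
Variables (s : inverse_system) (a : nat -> is_index s).
Hypotheses (a_le : forall r r', (r <= r')%N -> is_le (a r) (a r'))
  (a_cofinal : forall L, exists r, is_le L (a r))
  (le_trans : forall L L' L'' : is_index s, is_le L L' -> is_le L' L'' -> is_le L L'')
  (bond_comp : forall (L L' L'' : is_index s) (h : is_le L L') (h' : is_le L' L'')
     (h'' : is_le L L'') x, is_bond h (is_bond h' x) = is_bond h'' x).

Lemma limit_ext (x y : inverse_limit s) :
  (forall r, val x (a r) = val y (a r)) -> x = y.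
Proof.
move=> E; apply: val_inj; apply: functional_extensionality_dep => L.
by have [r h] := a_cofinal L; rewrite -!(bond_val h) E.
Qed.

Lemma limit_of_tower (x : forall r, is_group (a r)) :
  (forall r r' (h : (r <= r')%N), is_bond (a_le h) (x r') = x r) ->
  exists y : inverse_limit s, forall r, val y (a r) = x r.
Proof.
move=> cx.
have key L r r' (h : is_le L (a r)) (h' : is_le L (a r')) : is_bond h (x r) = is_bond h' (x r').
  have [le1 le2] := (leq_maxl r r', leq_maxr r r').
  rewrite -(cx _ _ le1) -(cx _ _ le2).
  have h1 := le_trans h (a_le le1).
  by rewrite !(bond_comp _ _ h1).
have [idx Hidx] := choice a_cofinal.
have cy L L' (h : is_le L L') :
    is_bond h (is_bond (Hidx L') (x (idx L'))) = is_bond (Hidx L) (x (idx L)).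
  by rewrite (bond_comp _ _ (le_trans h (Hidx L'))); exact: key.
exists (inverse_limit_of (x := fun L => is_bond (Hidx L) (x (idx L))) cy) => r /=.
by rewrite -[RHS](cx r r (leqnn r)); exact: key.
Qed.

Section MittagLeffler.
Variable E : forall r, is_group (a r) -> Prop.
Hypotheses (E_inhabited : forall r, exists x, E (r := r) x)
  (E_bond : forall r r' (h : (r <= r')%N) x, E x -> E (is_bond (a_le h) x))
  (E_stable : forall r, exists r' (h : (r <= r')%N),
     forall r'' (h' : (r' <= r'')%N) x, E (r := r') x -> exists2 x', E (r := r'') x'
       & is_bond (a_le (leq_trans h h')) x' = is_bond (a_le h) x).

Let stable r (x : is_group (a r)) : Prop :=
  forall r' (h : (r <= r')%N), exists2 x', E x' & is_bond (a_le h) x' = x.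

Let stable_image r : exists r' (h : (r <= r')%N),
  forall x, E (r := r') x -> stable (is_bond (a_le h) x).
Proof.
have [r' [h H]] := E_stable r; exists r', h => x Ex q hq.
have [x' Ex' E'] := H _ (leq_maxl r' q) x Ex.
exists (is_bond (a_le (leq_maxr r' q)) x'); first exact: E_bond.
by rewrite (bond_comp _ _ (a_le (leq_trans h (leq_maxl r' q)))) E'.
Qed.

Let stable0 : exists x, stable (r := 0%N) x.
Proof.
have [r [h H]] := stable_image 0%N; have [x Ex] := E_inhabited r.
by exists (is_bond (a_le h) x); exact: H.
Qed.

(** Lift [x] to a level [q] so high that all images in level [r.+1] of elements over [q] are stable,
    then project down. This allows lifts to be chosen one level at a time. *)
Let stable_lift r (x : is_group (a r)) : stable x ->
  exists2 y, stable (r := r.+1) y & is_bond (a_le (leqnSn r)) y = x.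
Proof.
move=> sx; have [q [h H]] := stable_image r.+1.
have [y Ey Exy] := sx q (leq_trans (leqnSn r) h).
exists (is_bond (a_le h) y); first exact: H.
by rewrite (bond_comp _ _ (a_le (leq_trans (leqnSn r) h))).
Qed.

Lemma mittag_leffler : exists y : inverse_limit s, forall r, E (val y (a r)).
Proof.
have [x0 sx0] := cid stable0.
have next r (x : {x | stable (r := r) x}) :
    {y : {y | stable (r := r.+1) y} | is_bond (a_le (leqnSn r)) (sval y) = sval x}.
  have [y sy Ey] := cid2 (stable_lift (svalP x)).
  by exists (exist _ y sy).
pose x := fix x r : {x | stable (r := r) x} :=
  if r is r'.+1 then sval (next r' (x r')) else exist _ x0 sx0.
have cx r r' (h : (r <= r')%N) : is_bond (a_le h) (sval (x r')) = sval (x r).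
  elim: r' h => [|r' IH] h.
    (* Reflexive bonds are not assumed to be identities. On a stable element, which is itself an
       image under such a bond, this follows from [bond_comp]. *)
    case: r h => // h; have [z _ <-] := svalP (x 0%N) 0%N (leqnn 0).
    exact: bond_comp.
  have [E'|E'] := eqVneq r r'.+1.
    subst r; have [z _ <-] := svalP (x r'.+1) r'.+1 (leqnn _).
    exact: bond_comp.
  have h' : (r <= r')%N by rewrite -ltnS ltn_neqAle E'.
  rewrite -(IH h') -(svalP (next r' (x r'))) -/(x r'.+1).
  exact/esym/bond_comp.
have [y Hy] := limit_of_tower cx; exists y => r; rewrite Hy.
have [z Ez <-] := svalP (x r) r (leqnn r); exact: E_bond.
Qed.

End MittagLeffler.

(* The fibres of [f] over [y] are cosets of the kernels of [f], so it is enough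
   that the tower of kernels satisfies the Mittag-Leffler condition. *)
Lemma limit_lift (G : nat -> zmodType) (f : forall r, is_group (a r) -> G r)
    (y : forall r, G r) : (forall r, zmod_morphism (f r)) ->
  (forall r, exists x, f r x = y r) ->
  (forall r r' (h : (r <= r')%N) x, f r' x = y r' -> f r (is_bond (a_le h) x) = y r) ->
  (forall r, exists r' (h : (r <= r')%N), forall r'' (h' : (r' <= r'')%N) x,
     f r' x = 0 -> exists2 x', f r'' x' = 0
       & is_bond (a_le (leq_trans h h')) x' = is_bond (a_le h) x) ->
  exists x : inverse_limit s, forall r, f r (val x (a r)) = y r.
Proof.
move=> fB fy f_bond f_stable.
apply: (mittag_leffler (E := fun r x => f r x = y r)) => // r.
have [r' [h H]] := f_stable r; exists r', h => r'' h' x fx.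
have [z fz] := fy r''.
(* The image of the deep point [z] differs from [x] by a kernel element; the deep kernel element [c]
   with the same image at level [r] corrects [z]. *)
have [|c fc Ec] := H r'' h' (x - is_bond (a_le h') z).
  by rewrite fB fx (f_bond _ _ h') // subrr.
have f0 : f r'' 0 = 0 by have := fB r'' 0 0; rewrite !subrr.
exists (c + z).
  by rewrite -{1}[z]opprK fB -[- z]sub0r fB fc f0 fz !sub0r opprK.
rewrite raddfD /= Ec raddfB /=.
by rewrite (bond_comp (a_le h) (a_le h') (a_le (leq_trans h h'))) subrK.
Qed.

End CofinalTower.

(** * The long exact sequence of a pair *)

Section LongExactSequence.
Context {d : Order.disp_t} {V : orderType d}.
Implicit Types (A B K L : set {fset V}) (i : int).

Lemma homology_class_eq0 (S T : set {fset V}) i z : cycles T i (z : chains S) ->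
  homology_class T i z = 0 <-> is_boundary T i z.
Proof.
move=> cz; rewrite -(homology_class0 S T i) homology_class_eq ?subr0 //.
exact: rpred0.
Qed.

Lemma homologyP (S T : set {fset V}) i (x : homology S T i) :
  exists2 z, cycles T i z & x = homology_class T i z.
Proof.
by exists (representative x); [exact: representative_cycle|rewrite representativeK].
Qed.

Lemma reduced_incl_comp K L M i (x : reduced_homology K i) :
  is_complex K -> is_complex L -> K `<=` L -> L `<=` M ->
  reduced_incl M (reduced_incl L x) = reduced_incl M x.
Proof.
move=> cK cL KL LM; have [z cz ->] := homologyP x.
have KM := subset_trans KL LM.
rewrite !reduced_inclE //; last exact: (respectful_reduced i cK KL).1.
by rewrite push_push //; exact: carried_sub (aug_sub KL).
Qed.

Lemma relative_incl_comp A B A' B' A'' B'' i (x : relative_homology A B i) :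
  is_complex A -> is_complex A' -> A `<=` A' -> A' `<=` A'' -> B `<=` B' -> B' `<=` B'' ->
  relative_incl A'' B'' (relative_incl A' B' x) = relative_incl A'' B'' x.
Proof.
move=> cA cA' AA' AA'' BB' BB''; have [z cz ->] := homologyP x.
have [A2 B2] := (subset_trans AA' AA'', subset_trans BB' BB'').
rewrite !relative_inclE //; last exact: (respectful_incl i cA AA' BB').1.
by rewrite push_push //; exact: carried_sub (aug_sub AA').
Qed.

Section Pair.
Variables (A B : set {fset V}) (i : int).
Hypotheses (cA : is_complex A) (cB : is_complex B) (BA : B `<=` A).

Lemma carried_push_self (S T : set {fset V}) (c : chains S) : carried S (push T c).
Proof. by apply: carried_push; apply: carried_sub. Qed.

Lemma bd_push_carried (c : chains (aug A)) : carried (aug B) c ->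
  bd (push (aug B) c) = push (aug B) (bd c).
Proof.
move=> cc; have sBA := aug_sub BA; rewrite -[c in RHS](carried_pushK cc).
by rewrite -(push_bd _ sBA) ?pushK //; exact: face_closed_aug.
Qed.

Lemma connecting_zmod : zmod_morphism (@connecting _ _ A B i).
Proof. exact/homology_map_is_zmod_morphism/respectful_connecting. Qed.

Lemma to_relative_zmod : zmod_morphism (@to_relative _ _ A B i).
Proof. exact/homology_map_is_zmod_morphism/respectful_to_relative. Qed.

Lemma reduced_incl_zmod : zmod_morphism (@reduced_incl _ _ B A i).
Proof. exact/homology_map_is_zmod_morphism/respectful_reduced. Qed.

Lemma exact_connecting_incl (y : reduced_homology B i) :
  reduced_incl A y = 0 <-> exists x : relative_homology A B (i + 1), connecting x = y.
Proof.
have [z cz ->] := homologyP y; have /asboolP[dz bz] := cz.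
have bz0 := carried_set0 bz; have sBA := aug_sub BA.
rewrite reduced_inclE // homology_class_eq0; last exact: (respectful_reduced i cB BA).1.
split=> [[w [t [dw _ /carried_set0 -> ]]]|[x]].
  rewrite addr0 => E; have cw : cycles (aug B) (i + 1) w.
    by apply/asboolP; split=> //; rewrite -E; exact: carried_push_self.
  by exists (homology_class (aug B) (i + 1) w); rewrite connectingE // -E pushK.
have [w cw ->] := homologyP x; have /asboolP[dw bw] := cw.
rewrite connectingE // => /homology_class_eq[||u [t [du _ /carried_set0 ->]]].
- exact: (respectful_connecting i cA cB BA).1.
- exact: cz.
rewrite addr0 => E; exists (w - push (aug A) u), 0; split.
- by apply: has_degreeB => //; exact: has_degree_push.
- exact: has_degree0.
- exact: carried0.
rewrite addr0 raddfB /= -push_bd //; last exact: face_closed_aug.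
by rewrite -E raddfB /= carried_pushK // opprB addrC subrK.
Qed.

Lemma exact_incl_relative (y : reduced_homology A i) :
  to_relative B y = 0 <-> exists x : reduced_homology B i, reduced_incl A x = y.
Proof.
have [z cz ->] := homologyP y; have /asboolP[dz bz] := cz.
have bz0 := carried_set0 bz; have sBA := aug_sub BA.
rewrite to_relativeE // homology_class_eq0; last first.
  by apply/asboolP; split=> //; rewrite bz0; exact: carried0.
split=> [[w [t [dw dt ct E]]]|[x]].
  have bt : bd t = 0.
    have := congr1 (@bd _ _ _) E; rewrite bz0 raddfD /= bd_bd ?add0r //.
    exact: face_closed_aug.
  have cpt : cycles set0 i (push (aug B) t).
    apply/asboolP; split; first exact: has_degree_push.
    by rewrite bd_push_carried // bt raddf0; exact: carried0.
  exists (homology_class set0 i (push (aug B) t)); rewrite reduced_inclE //.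
  apply/homology_class_eq => //; first exact: (respectful_reduced i cB BA).1.
  exists (- w), 0; split; [exact: has_degreeN|exact: has_degree0|exact: carried0|].
  by rewrite carried_pushK // E raddfN addr0 opprD addrCA subrr addr0.
have [u cu ->] := homologyP x; have /asboolP[du bu] := cu.
rewrite reduced_inclE // => /homology_class_eq[||w [t [dw _ /carried_set0 ->]]].
- exact: (respectful_reduced i cB BA).1.
- exact: cz.
rewrite addr0 => E; exists (- w), (push (aug A) u); split.
- exact: has_degreeN.
- exact: has_degree_push.
- exact: carried_push_self.
- by rewrite raddfN /= -E opprB subrK.
Qed.

Lemma exact_relative_connecting (y : relative_homology A B (i + 1)) :
  connecting y = 0 <-> exists x : reduced_homology A (i + 1), to_relative B x = y.
Proof.
have [z cz ->] := homologyP y; have /asboolP[dz bz] := cz.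
have sBA := aug_sub BA.
rewrite connectingE // homology_class_eq0; last exact: (respectful_connecting i cA cB BA).1.
split=> [[b [t [db _ /carried_set0 -> ]]]|[x]].
  rewrite addr0 => E; have cw : cycles set0 (i + 1) (z - push (aug A) b).
    apply/asboolP; split; first by apply: has_degreeB => //; exact: has_degree_push.
    rewrite raddfB /= -push_bd //; last exact: face_closed_aug.
    by rewrite -E carried_pushK // subrr; exact: carried0.
  exists (homology_class set0 (i + 1) (z - push (aug A) b)).
  rewrite to_relativeE //; apply/homology_class_eq => //.
    by apply/asboolP; have /asboolP[? /carried_set0 ->] := cw; split=> //; exact: carried0.
  exists 0, (- push (aug A) b); split.
  - exact: has_degree0.
  - exact/has_degreeN/has_degree_push.
  - by apply: carriedN; exact: carried_push_self.
  - by rewrite raddf0 add0r addrAC subrr add0r.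
have [u cu ->] := homologyP x; have /asboolP[du /carried_set0 bu] := cu.
rewrite to_relativeE // => /homology_class_eq[||w [t [dw dt ct]]].
- by apply/asboolP; rewrite bu; split=> //; exact: carried0.
- exact: cz.
move=> E; exists (- push (aug B) t), 0; split.
- exact/has_degreeN/has_degree_push.
- exact: has_degree0.
- exact: carried0.
rewrite addr0 raddfN /= bd_push_carried // -raddfN; congr (push _ _).
have := congr1 (@bd _ _ _) E; rewrite raddfB raddfD /= bu bd_bd; last exact: face_closed_aug.
by rewrite !add0r => <-; rewrite opprK.
Qed.

End Pair.
End LongExactSequence.

(** * Neighborhoods of the image of a coarse embedding *)

Section CoarseEstimates.
Context {R : realType}.

Lemma exists_nat_gt (x : R) : exists k : nat, x < k%:R.
Proof.
exists (Num.bound `|x|); apply: le_lt_trans (ler_norm x) _.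
exact: archi_boundP.
Qed.

Lemma dist_ge0 d (V : orderType d) (X : metric_complex V) (x y : V -> R) :
  0 <= dist X x y.
Proof.
rewrite /dist; set S := [set l | _].
have [->|/set0P S0] := eqVneq S set0; first by rewrite inf0.
by apply: lb_le_inf S0 _ => _ [p [_ _ ->]]; exact: path_length_ge0.
Qed.

Lemma coarse_embedding_upper (T U : Type) (A : set T) (dA : T -> T -> R)
    (B : set U) (dB : U -> U -> R) (f : T -> U) (k : R) :
  (forall x y, 0 <= dA x y) -> coarse_embedding A dA B dB f ->
  exists m, forall x y, A x -> A y -> dA x y <= k -> dB (f x) (f y) <= m.
Proof.
move=> dA0 [_ [rm [rp [_ [_ rp_mono _] H]]]]; exists (rp k) => x y Ax Ay xy.
by have /andP[_ /le_trans] := H x y Ax Ay; apply; exact: rp_mono.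
Qed.

Lemma coarse_embedding_lower (T U : Type) (A : set T) (dA : T -> T -> R)
    (B : set U) (dB : U -> U -> R) (f : T -> U) (k : R) :
  coarse_embedding A dA B dB f ->
  exists m, forall x y, A x -> A y -> dB (f x) (f y) <= k -> dA x y < m.
Proof.
(* [k + 1] makes the value of the lower control function at [t] strictly larger than [k]. *)
move=> [_ [rm [rp [[_ rm_mono rm_unb] _ H]]]]; have [t t0 tk] := rm_unb (k + 1).
exists t => x y Ax Ay xy; rewrite ltNge; apply/negP => tA.
have /andP[+ _] := H x y Ax Ay; have := rm_mono _ _ t0 tA; lra.
Qed.

Lemma near_dist_le d (V : orderType d) (X : metric_complex V) (r : R) :
  uniformly_acyclic R X -> exists k, forall u v, simplices X [fset u]%fset ->
    simplices X [fset v]%fset ->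
    dist X (vertex_point u) (vertex_point v) <= (r : R) -> near X k u v.
Proof.
move=> [m dimX _]; have [k rk] := exists_nat_gt r.
exists (2 * absz (m + 1)%R * k)%N => u v Xu Xv uv.
by apply: near_dist_lt dimX Xu _ _ Xv _; exact: le_lt_trans rk.
Qed.

Lemma uniformly_acyclic_dim d (V : orderType d) (X : metric_complex V) :
  uniformly_acyclic R X -> exists M, forall s, simplices X s -> (#|` s| <= M)%N.
Proof.
move=> [m [dimX _] _]; exists (absz (m + 1)) => s Xs.
by have := dimX s (or_introl Xs); lia.
Qed.

End CoarseEstimates.

Section VertexApproximation.
Context {R : realType} {d : Order.disp_t} {V : orderType d}.
Context {d' : Order.disp_t} {W : orderType d'}.
Variables (X : metric_complex V) (Z0 : metric_complex W) (f : (W -> R) -> (V -> R)).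
Hypothesis aX : uniformly_acyclic R X.
Hypothesis (hf : coarse_embedding (realization Z0) (dist Z0) (realization X) (dist X) f).

(** [f] maps vertices to arbitrary points of X; moving each to a vertex of a simplex containing it
    costs distance at most 1. *)
Definition approximates (F : W -> V) : Prop := forall z, simplices Z0 [fset z]%fset ->
  exists2 s, simplices X s & in_simplex s (f (vertex_point z)) /\ F z \in s.

Lemma exists_approximation (v0 : V) : exists F, approximates F.
Proof.
suff H z : exists v, simplices Z0 [fset z]%fset ->
    exists2 s, simplices X s & in_simplex s (f (vertex_point z)) /\ v \in s.
  by have [F HF] := choice H; exists F.
have [Zz|] := pselect (simplices Z0 [fset z]%fset); last by exists v0.
have [s Xs sx] := hf.1 _ (realization_vertex (R := R) Zz).
by have [v vs] := simplex_vertex Xs; exists v => _; exists s.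
Qed.

Variable F : W -> V.
Hypothesis HF : approximates F.

Lemma approx_vertex z : simplices Z0 [fset z]%fset -> simplices X [fset F z]%fset.
Proof. by move=> /HF[s Xs [_ Fs]]; exact: vertex_simplex Fs. Qed.

Lemma approx_dist z : simplices Z0 [fset z]%fset ->
  dist X (f (vertex_point z)) (vertex_point (F z)) <= 1 /\
  dist X (vertex_point (F z)) (f (vertex_point z)) <= 1.
Proof.
move=> /HF[s Xs [sx Fs]]; have sF := in_simplex_vertex (R := R) Fs.
by split; [exact: dist_simplex sx sF|exact: dist_simplex sF sx].
Qed.

Lemma realization_image x : realization Z0 x -> realization X (f x).
Proof. exact: hf.1. Qed.

Section Subcomplex.
(** [Z] will be [Z0] or [Z1]. The bound [Z_lower] is immediate for [Z0] and is the coarseness of the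
    inclusion for [Z1]. *)
Variable Z : metric_complex W.
Hypotheses (aZ : uniformly_acyclic R Z) (ZZ0 : Z `<=` Z0).
Hypothesis (Z_lower : forall k : R, exists m, forall x y, realization Z x ->
  realization Z y -> dist Z0 x y <= k -> dist Z x y < m).

Lemma realization_sub (x : W -> R) : realization Z x -> realization Z0 x.
Proof. by move=> [s Zs sx]; exists s => //; exact: ZZ0. Qed.

Lemma near_sub k y z : near Z k y z -> near Z0 k y z.
Proof.
move=> [p [pp lp sp]]; exists p; split=> //.
by apply: sub_path pp => u v /asboolP uv; apply/asboolP; exact: ZZ0.
Qed.

Lemma approx_coarse_vertex_map : coarse_vertex_map X Z F.
Proof.
split=> [z Zz|k|k]; first exact/approx_vertex/ZZ0.
- have [m Hm] := coarse_embedding_upper k%:R (dist_ge0 Z0) hf.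
  have [k' Hk'] := near_dist_le (1 + m + 1) aX; exists k' => y z Zy Zz nyz.
  have [Zy0 Zz0] := (ZZ0 Zy, ZZ0 Zz).
  have [Ry Rz] := (realization_vertex (R := R) Zy0, realization_vertex (R := R) Zz0).
  have [XFy XFz] := (approx_vertex Zy0, approx_vertex Zz0).
  apply: Hk' => //.
  have [_ d1] := approx_dist Zy0; have [d2 _] := approx_dist Zz0.
  have d3 := Hm _ _ Ry Rz (dist_near (R := R) (near_sub nyz)).
  have t1 := dist_triangle (realization_vertex (R := R) XFy) (realization_image Ry)
    (realization_vertex (R := R) XFz).
  have t2 := dist_triangle (realization_image Ry) (realization_image Rz)
    (realization_vertex (R := R) XFz).
  lra.
- have [m Hm] := coarse_embedding_lower (1 + k%:R + 1) hf.
  have [m' Hm'] := Z_lower m.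
  have [k' Hk'] := near_dist_le m' aZ; exists k' => y z Zy Zz nyz.
  have [Zy0 Zz0] := (ZZ0 Zy, ZZ0 Zz).
  have [Ry Rz] := (realization_vertex (R := R) Zy0, realization_vertex (R := R) Zz0).
  have [XFy XFz] := (approx_vertex Zy0, approx_vertex Zz0).
  apply: Hk' => //; apply/ltW/Hm'; [exact: realization_vertex|exact: realization_vertex|].
  apply/ltW/Hm => //.
  have [d1 _] := approx_dist Zy0; have [_ d2] := approx_dist Zz0.
  have d3 := dist_near (R := R) nyz.
  have t1 := dist_triangle (realization_image Ry) (realization_vertex (R := R) XFy)
    (realization_image Rz).
  have t2 := dist_triangle (realization_vertex (R := R) XFy)
    (realization_vertex (R := R) XFz) (realization_image Rz).
  lra.
Qed.

Local Notation A := (f @` realization Z).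

Lemma level_set_neighborhood r : neighborhood X A (level_set X Z F r).
Proof.
split; first split; first split.
- by move=> [/not_simplex0].
- move=> s t [Xs ls] ts t0; split; first exact: face_simplex Xs ts t0.
  by move=> v /(fsubsetP ts); exact: ls.
- by move=> s [].
(* From [x] to a vertex 1, on to [F z] at most [r], and to [f] of the vertex [z] again 1; the last
   unit makes the inequality strict. *)
exists (1 + r%:R + 2) => x [s [Xs ls] sx]; split; first by exists s.
have [u us] := simplex_vertex Xs; have [z [Zz nz]] := ls u us.
have Zz0 := ZZ0 Zz; have XF := approx_vertex Zz0.
have Rz := realization_vertex (R := R) Zz; have Rz0 := realization_sub Rz.
exists (f (vertex_point z)); first by exists (vertex_point z).
have [_ d1] := approx_dist Zz0.
have d2 := dist_near (R := R) nz.
have d3 := dist_simplex Xs sx (in_simplex_vertex us).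
have Rx : realization X x by exists s.
have Ru := realization_vertex (R := R) (vertex_simplex Xs us).
have t1 := dist_triangle Rx Ru (realization_image Rz0).
have t2 := dist_triangle Ru (realization_vertex (R := R) XF) (realization_image Rz0).
lra.
Qed.

Lemma neighborhood_level_set L : neighborhood X A L ->
  exists r, L `<=` level_set X Z F r.
Proof.
move=> [[cL LX] [r Lr]].
have [m Hm] := coarse_embedding_upper 1 (dist_ge0 Z0) hf.
(* The summands lead from the vertex [u] to [f y], from there to [f] of a vertex [z] of the simplex
   of [y], and finally to [F z]. *)
have [k Hk] := near_dist_le (r + m + 1) aX; exists k => s Ls.
split=> [|u us]; first exact: LX.
have Xs := LX _ Ls; have Xu := vertex_simplex Xs us.
have Lu : realization L (vertex_point u : V -> R).
  exists [fset u]%fset; last by apply: in_simplex_vertex; rewrite inE.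
  by apply: cL.2 Ls _ _; rewrite ?fsub1set //; apply/fset0Pn; exists u; rewrite inE.
have [Ru [_ [y [t Zt ty] <-] duy]] := Lr _ Lu.
have [z zt] := simplex_vertex Zt; have Zz := vertex_simplex Zt zt.
have Zz0 := ZZ0 Zz; have XF := approx_vertex Zz0.
exists z; split=> //; apply: Hk => //.
have Ry : realization Z0 y by exists t => //; exact: ZZ0.
have Rz := realization_vertex (R := R) Zz0.
have [d1 _] := approx_dist Zz0.
have d2 := Hm _ _ Ry Rz (dist_simplex (ZZ0 Zt) ty (in_simplex_vertex zt)).
have t1 := dist_triangle Ru (realization_image Ry) (realization_vertex (R := R) XF).
have t2 := dist_triangle (realization_image Ry) (realization_image Rz)
  (realization_vertex (R := R) XF).
lra.
Qed.

End Subcomplex.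
End VertexApproximation.

(** * Stability of the homology of the complements *)

Section Stability.
Context {R : realType} {d : Order.disp_t} {V : orderType d}.
Context {d' : Order.disp_t} {W : orderType d'}.
Variables (X : metric_complex V) (Z : metric_complex W) (F : W -> V).
Variables (n : nat) (hX : coarse_PD R n X) (aZ : uniformly_acyclic R Z).
Hypothesis FZ : coarse_vertex_map X Z F.

Local Notation outside r := (closure_compl X (level_set X Z F r)).

Lemma level_set_le r r' : (r <= r')%N -> level_set X Z F r `<=` level_set X Z F r'.
Proof. by move=> le s [Xs ls]; split=> // v /ls; exact: level_le. Qed.

Lemma outside_le r r' : (r <= r')%N -> outside r' `<=` outside r.
Proof. by move=> /level_set_le; exact: closure_compl_sub. Qed.

Lemma outside_sub r : outside r `<=` X.
Proof. by move=> s [s0 [t [Xt _ st]]]; exact: face_simplex st s0. Qed.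

Lemma outside_complex r : is_complex (outside r).
Proof. exact: closure_compl_complex. Qed.

(** The projection needs a vertex of [Z]. If [Z] is empty, the level sets do not depend on [r] and
    nothing has to be moved. *)
Lemma duality_lifts i : cycles_lift X Z F i /\ boundaries_lift X Z F i.
Proof.
have [Z0|Z0] := pselect (exists z, simplices Z [fset z]%fset).
  have [fX fillX] := acyclic_filling (pd_acyclic hX).
  have [fZ fillZ] := acyclic_filling aZ.
  have [MX dimX] := uniformly_acyclic_dim (pd_acyclic hX).
  have [MZ dimZ] := uniformly_acyclic_dim aZ.
  have [Phi [h [R0 [[Pd Pb Pl] Pt hd hh [h0 ht]]]]] :=
    exists_contraction fillX dimX fillZ dimZ FZ Z0.
  split; first exact: (cycles_liftP hX fillX dimX Pd Pb Pl Pt hd hh h0 ht).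
  exact: (boundaries_liftP hX fillX dimX Pd Pb Pl Pt hd hh h0 ht).
have E r r' : level_set X Z F r = level_set X Z F r'.
  by apply/seteqP; split=> s [Xs ls]; have [v /ls[z [Zz _]]] := simplex_vertex Xs;
    case: Z0; exists z.
split=> [r|].
  exists r => // r'' _ z dz bz cz; exists z, 0; rewrite (E r'' r).
  split=> //; first by split; [exact: has_degree0|exact: carried0].
  by rewrite subrr raddf0.
exists 0%N => r; exists 0%N => // z w _ _ _ dw cw bw; exists w.
by rewrite (E r 0%N).
Qed.

(** Classes of different complements become comparable when represented by chains of the whole
    augmented complex. *)
Lemma reduced_classP r i (x : reduced_homology (outside r) i) :
  exists c : chains (aug X), [/\ has_degree i c, bd c = 0, carried (aug (outside r)) c
    & x = homology_class set0 i (push (aug (outside r)) c)].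
Proof.
have [z /asboolP[dz /carried_set0 bz] ->] := homologyP x.
exists (push (aug X) z); split; [exact: has_degree_push| |exact: carried_push_self|].
  rewrite -push_bd ?bz ?raddf0 //; [exact/aug_sub/outside_sub|].
  exact/face_closed_aug/outside_complex.
by rewrite pushK //; exact/aug_sub/outside_sub.
Qed.

Lemma cycles_push r i (c : chains (aug X)) : has_degree i c -> bd c = 0 ->
  carried (aug (outside r)) c -> cycles set0 i (push (aug (outside r)) c).
Proof.
move=> dc bc cc; apply/asboolP; split; first exact: has_degree_push.
rewrite bd_push_carried ?bc ?raddf0 //; first exact: carried0.
- exact: outside_complex.
- exact: outside_sub.
Qed.

Lemma reduced_incl_push r r' i (c : chains (aug X)) : (r <= r')%N ->
  has_degree i c -> bd c = 0 -> carried (aug (outside r')) c ->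
  reduced_incl (outside r)
    (homology_class set0 i (push (aug (outside r')) c) : reduced_homology (outside r') i)
  = homology_class set0 i (push (aug (outside r)) c).
Proof.
move=> le dc bc cc; rewrite reduced_inclE; last exact: cycles_push.
- by rewrite push_push.
- exact: outside_complex.
- exact: outside_le.
Qed.

Lemma carried_le r r' (c : chains (aug X)) : (r <= r')%N ->
  carried (aug (outside r')) c -> carried (aug (outside r)) c.
Proof. by move=> le cc a /cc; apply: aug_sub; exact: outside_le. Qed.

Lemma push_class_eq0 r i (c : chains (aug X)) : has_degree i c -> bd c = 0 ->
  carried (aug (outside r)) c ->
  homology_class set0 i (push (aug (outside r)) c) = 0 <->
  exists u : chains (aug X), [/\ has_degree (i + 1) u, carried (aug (outside r)) u
    & bd u = c].
Proof.
move=> dc bc cc; rewrite homology_class_eq0; last exact: cycles_push.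
have sX := aug_sub (@outside_sub r); have fc := face_closed_aug (@outside_complex r).
split=> [[w [t [dw _ /carried_set0 ->]]]|[u [du cu <-]]].
  rewrite addr0 => E; exists (push (aug X) w).
  split; [exact: has_degree_push|exact: carried_push_self|].
  by rewrite -push_bd // -E carried_pushK.
exists (push (aug (outside r)) u), 0.
split; [exact: has_degree_push|exact: has_degree0|exact: carried0|].
by rewrite addr0 bd_push_carried //; [exact: outside_complex|exact: outside_sub].
Qed.

Lemma reduced_incl_stable i r : exists r' (h : (r <= r')%N), forall r'' (h' : (r' <= r'')%N)
    (x : reduced_homology (outside r') i), exists x'' : reduced_homology (outside r'') i,
  reduced_incl (outside r) x'' = reduced_incl (outside r) x.
Proof.
have [r' h H] := (duality_lifts i).1 r; exists r', h => r'' h' x.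
have [c [dc bc cc ->]] := reduced_classP x.
have [c' [u [dc' bc' cc' [du cu] E]]] := H r'' h' c dc bc cc.
have hh := leq_trans h h'.
exists (homology_class set0 i (push (aug (outside r'')) c')).
rewrite !reduced_incl_push //; apply/eqP; rewrite eq_sym -subr_eq0.
have [k1 k2] := (carried_le h cc, carried_le hh cc').
rewrite -homology_classB; [|exact: cycles_push|exact: cycles_push].
rewrite -raddfB; apply/eqP/push_class_eq0.
- exact: has_degreeB.
- by rewrite raddfB /= bc bc' subr0.
- exact: carriedB.
- by exists u.
Qed.

Lemma reduced_incl_reflects0 i : exists r0, forall r, exists r',
  [/\ (r0 <= r')%N, (r <= r')%N & forall x : reduced_homology (outside r') i,
  reduced_incl (outside r0) x = 0 -> reduced_incl (outside r) x = 0].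
Proof.
have [r0 H] := (duality_lifts i).2; exists r0 => r; have [r' h Hr] := H r.
exists (r' + r)%N; split; [exact: leq_trans (leq_addr _ _)|exact: leq_addl|move=> x].
have [c [dc bc cc ->]] := reduced_classP x.
have [le0 le1] : (r0 <= r' + r)%N /\ (r <= r' + r)%N.
  by split; [exact: leq_trans (leq_addr _ _)|exact: leq_addl].
rewrite !reduced_incl_push // !push_class_eq0 //; try exact: carried_le cc.
move=> [w [dw cw bw]]; apply: Hr dw cw bw => //.
exact: carried_le (leq_addr _ _) cc.
Qed.

End Stability.

(** * The sequence of inverse limits *)

Section CechSequence.
Context {R : realType} {d : Order.disp_t} {V : orderType d}.
Variables (X : metric_complex V).

Definition stable_tower (N : nat -> set {fset V}) i : Prop :=
  forall r, exists r' (h : (r <= r')%N), forall r'' (h' : (r' <= r'')%N)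
    (x : reduced_homology (closure_compl X (N r')) i),
  exists x'' : reduced_homology (closure_compl X (N r'')) i,
  reduced_incl (closure_compl X (N r)) x'' = reduced_incl (closure_compl X (N r)) x.

(** The kernels of the maps to level [r0] form a pro-zero tower. *)
Definition reflecting_tower (N : nat -> set {fset V}) i : Prop :=
  exists r0, forall r, exists r', [/\ (r0 <= r')%N, (r <= r')%N &
    forall x : reduced_homology (closure_compl X (N r')) i,
    reduced_incl (closure_compl X (N r0)) x = 0 ->
    reduced_incl (closure_compl X (N r)) x = 0].

Definition cofinal_tower (A : set (V -> R)) (N : nat -> set {fset V}) : Prop :=
  [/\ forall r, neighborhood X A (N r), forall r r', (r <= r')%N -> N r `<=` N r'
    & forall L, neighborhood X A L -> exists r, L `<=` N r].

Variables (A0 A1 : set (V -> R)) (A10 : A1 `<=` A0).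
Variables (N0 N1 : nat -> set {fset V}).
Hypotheses (N0_cofinal : cofinal_tower A0 N0) (N1_cofinal : cofinal_tower A1 N1)
  (N10 : forall r, N1 r `<=` N0 r).
Hypotheses (N0_stable : forall i, stable_tower N0 i)
  (N1_stable : forall i, stable_tower N1 i)
  (N1_reflecting : forall i, reflecting_tower N1 i).
Variable i : int.

Local Notation O0 r := (closure_compl X (N0 r)).
Local Notation O1 r := (closure_compl X (N1 r)).

Lemma O0_le r r' : (r <= r')%N -> O0 r' `<=` O0 r.
Proof. by case: N0_cofinal => _ H _ /H; exact: closure_compl_sub. Qed.

Lemma O1_le r r' : (r <= r')%N -> O1 r' `<=` O1 r.
Proof. by case: N1_cofinal => _ H _ /H; exact: closure_compl_sub. Qed.

Lemma O01 r : O0 r `<=` O1 r.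
Proof. exact: closure_compl_sub. Qed.

Lemma incl0_comp r r' q j (x : reduced_homology (O0 q) j) : (r <= r')%N -> (r' <= q)%N ->
  reduced_incl (O0 r) (reduced_incl (O0 r') x) = reduced_incl (O0 r) x.
Proof.
by move=> h h'; apply: reduced_incl_comp; try exact: closure_compl_complex; exact: O0_le.
Qed.

Lemma incl1_comp r r' q j (x : reduced_homology (O1 q) j) : (r <= r')%N -> (r' <= q)%N ->
  reduced_incl (O1 r) (reduced_incl (O1 r') x) = reduced_incl (O1 r) x.
Proof.
by move=> h h'; apply: reduced_incl_comp; try exact: closure_compl_complex; exact: O1_le.
Qed.

Lemma incl01_comp r q j (x : reduced_homology (O0 q) j) : (r <= q)%N ->
  reduced_incl (O1 r) (reduced_incl (O1 q) x) = reduced_incl (O1 r) (reduced_incl (O0 r) x).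
Proof.
move=> h; rewrite !reduced_incl_comp //; try exact: closure_compl_complex;
  first [exact: O01|exact: O1_le|exact: O0_le].
Qed.

Lemma reduced_incl0 (K L : set {fset V}) j : is_complex K -> K `<=` L ->
  reduced_incl L (0 : reduced_homology K j) = 0.
Proof. by move=> cK KL; have := @reduced_incl_zmod _ _ L K j cK KL 0 0; rewrite !subrr. Qed.

Lemma tower_pair_subproof r : neighborhood_pair X A0 A1 (N0 r, N1 r).
Proof.
by case: N0_cofinal N1_cofinal => [H0 _ _] [H1 _ _]; split; [exact: H0|exact: H1|exact: N10].
Qed.

Definition tower_pair r : neighborhood_pairs X A0 A1 := exist _ _ (tower_pair_subproof r).

Lemma reduced_bond_comp (A : set (V -> R)) j (L L' L'' : neighborhoods X A)
    (h : is_le (i := reduced_system X A j) L L') (h' : is_le (i := reduced_system X A j) L' L'')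
    (h'' : is_le (i := reduced_system X A j) L L'') x :
  is_bond h (is_bond h' x) = is_bond h'' x.
Proof.
by apply: reduced_incl_comp; try exact: closure_compl_complex; exact: closure_compl_sub.
Qed.

Lemma relative_bond_comp j (L L' L'' : neighborhood_pairs X A0 A1)
    (h : is_le (i := relative_system X A0 A1 j) L L')
    (h' : is_le (i := relative_system X A0 A1 j) L' L'')
    (h'' : is_le (i := relative_system X A0 A1 j) L L'') x :
  is_bond h (is_bond h' x) = is_bond h'' x.
Proof.
have [[h1 h2] [h1' h2']] := (h, h').
by apply: relative_incl_comp; try exact: closure_compl_complex; exact: closure_compl_sub.
Qed.

Lemma reduced_le_trans (A : set (V -> R)) j (L L' L'' : neighborhoods X A) :
  is_le (i := reduced_system X A j) L L' -> is_le (i := reduced_system X A j) L' L'' ->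
  is_le (i := reduced_system X A j) L L''.
Proof. exact: subset_trans. Qed.

Lemma relative_le_trans j (L L' L'' : neighborhood_pairs X A0 A1) :
  is_le (i := relative_system X A0 A1 j) L L' ->
  is_le (i := relative_system X A0 A1 j) L' L'' ->
  is_le (i := relative_system X A0 A1 j) L L''.
Proof. by move=> [h1 h2] [h1' h2']; split; [exact: subset_trans h1'|exact: subset_trans h2']. Qed.

Lemma first_le j r r' : (r <= r')%N ->
  is_le (i := reduced_system X A0 j) (first (tower_pair r)) (first (tower_pair r')).
Proof. by case: N0_cofinal => _ H _; exact: H. Qed.

Lemma second_le j r r' : (r <= r')%N ->
  is_le (i := reduced_system X A1 j) (second (tower_pair r)) (second (tower_pair r')).
Proof. by case: N1_cofinal => _ H _; exact: H. Qed.

Lemma pair_le j r r' : (r <= r')%N ->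
  is_le (i := relative_system X A0 A1 j) (tower_pair r) (tower_pair r').
Proof.
by case: N0_cofinal N1_cofinal => [_ H0 _] [_ H1 _] rr; split; [exact: H0|exact: H1].
Qed.

Lemma first_cofinal j L :
  exists r, is_le (i := reduced_system X A0 j) L (first (tower_pair r)).
Proof. by case: N0_cofinal => _ _ H; exact: (H _ (svalP L)). Qed.

Lemma second_cofinal j L :
  exists r, is_le (i := reduced_system X A1 j) L (second (tower_pair r)).
Proof. by case: N1_cofinal => _ _ H; exact: (H _ (svalP L)). Qed.

Lemma pair_cofinal j L :
  exists r, is_le (i := relative_system X A0 A1 j) L (tower_pair r).
Proof.
case: N0_cofinal N1_cofinal => [_ m0 H0] [_ m1 H1]; have [n0 n1 _] := svalP L.
have [r0 h0] := H0 _ n0; have [r1 h1] := H1 _ n1; exists (maxn r0 r1); split.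
  by apply: subset_trans h0 _; exact: m0 (leq_maxl _ _).
by apply: subset_trans h1 _; exact: m1 (leq_maxr _ _).
Qed.

(** The kernel of [connecting] at each level is the image of the reduced homology of [O1], so it
    inherits the stability of the tower [N1]. *)
Lemma cech_exact_reduced0 : exact_at (cech_connecting X A0 A1 i) (cech_incl X A10 i).
Proof.
move=> y; split=> [y0|[x <-]]; last first.
  apply: (limit_ext (s := reduced_system X A1 i) (@second_cofinal i)) => r.
  rewrite val_cech_incl val_cech_connecting raddf0.
  by apply/exact_connecting_incl; try exact: closure_compl_complex;
    [exact: O01|exists (val x (tower_pair r))].
have [x Hx] : exists x : inverse_limit (relative_system X A0 A1 (i + 1)),
    forall r, @connecting _ _ (O1 r) (O0 r) i (val x (tower_pair r)) =
      val y (first (tower_pair r)).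
  apply: (limit_lift (s := relative_system X A0 A1 (i + 1)) (a_le := @pair_le (i + 1))
    (@pair_cofinal _) (@relative_le_trans _) (@relative_bond_comp _)
    (G := fun r => reduced_homology (O0 r) i)
    (f := fun r => @connecting _ _ (O1 r) (O0 r) i)
    (y := fun r => val y (first (tower_pair r)))).
  - move=> r; apply: connecting_zmod; try exact: closure_compl_complex; exact: O01.
  - move=> r; apply/exact_connecting_incl; try exact: closure_compl_complex.
      exact: O01.
    have E := val_cech_incl A10 y (tower_pair r); rewrite y0 in E; exact: esym E.
  - move=> r r' h x fx; rewrite -(bond_val (first_le i h)) -fx.
    apply: connecting_incl; first [exact: closure_compl_complex
      |exact: O01|exact: O1_le|exact: O0_le].
  - move=> r; have [r' [h H]] := N1_stable (i + 1) r; exists r', h => r'' h' x.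
    move=> /exact_relative_connecting[|||b <-]; try exact: closure_compl_complex.
      exact: O01.
    have [b'' E] := H r'' h' b; exists (to_relative (O0 r'') b'').
      apply/exact_relative_connecting; try exact: closure_compl_complex.
        exact: O01.
      by exists b''.
    have hh := leq_trans h h'; rewrite /= /relative_bond.
    rewrite !to_relative_incl ?E //; try exact: closure_compl_complex;
      first [exact: O1_le|exact: O0_le].
exists x; apply: (limit_ext (s := reduced_system X A0 i) (@first_cofinal i)) => r.
by rewrite val_cech_connecting Hx.
Qed.

(** Stability of [N0] alone does not suffice: a deeper class with the right image in [O0] need not
    die in [O1]. By the reflecting property of [N1], it is enough to test this at the fixed level
    [r0]. *)
Lemma cech_exact_reduced1 : exact_at (cech_incl X A10 i) (cech_to_relative X A0 A1 i).
Proof.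
move=> y; split=> [y0|[x <-]]; last first.
  apply: (limit_ext (s := relative_system X A0 A1 i) (@pair_cofinal i)) => r.
  rewrite val_cech_to_relative val_cech_incl raddf0.
  by apply/exact_incl_relative; try exact: closure_compl_complex;
    [exact: O01|exists (val x (first (tower_pair r)))].
have [x Hx] : exists x : inverse_limit (reduced_system X A0 i),
    forall r, @reduced_incl _ _ (O0 r) (O1 r) i (val x (first (tower_pair r))) =
      val y (second (tower_pair r)).
  apply: (limit_lift (s := reduced_system X A0 i) (a_le := @first_le i)
    (@first_cofinal _) (@reduced_le_trans _ _) (@reduced_bond_comp _ _)
    (G := fun r => reduced_homology (O1 r) i)
    (f := fun r => @reduced_incl _ _ (O0 r) (O1 r) i)
    (y := fun r => val y (second (tower_pair r)))).
  - move=> r; apply: reduced_incl_zmod; try exact: closure_compl_complex; exact: O01.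
  - move=> r; apply/exact_incl_relative; try exact: closure_compl_complex.
      exact: O01.
    have E := val_cech_to_relative y (tower_pair r); rewrite y0 in E; exact: esym E.
  - move=> r r' h x fx; rewrite -(bond_val (second_le i h)) -fx.
    exact/esym/incl01_comp.
  - move=> r; have [r0 Hr0] := N1_reflecting i.
    (* At level [maxn r r0] stability provides a class that agrees with [a] both at [r], as
       required, and at [r0], where vanishing is tested. *)
    have [r' [h H]] := N0_stable i (maxn r r0); have [hr hr0] := (leq_maxl r r0, leq_maxr r r0).
    exists r', (leq_trans hr h) => r'' h' a a0; have [q [q0 q1 Hq]] := Hr0 r''.
    have [hq1 hq2] := (leq_maxl r' q, leq_maxr r' q).
    (* [b] lies beyond [q]; since its image in [O1 r0] equals that of [a], which is 0, its image in
       [O1 r''] is 0. *)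
    have [b E] := H _ hq1 a.
    have Eb t : (t <= maxn r r0)%N -> reduced_incl (O0 t) b = reduced_incl (O0 t) a.
      move=> ht; rewrite -(incl0_comp b ht (leq_trans h hq1)) E.
      exact: incl0_comp.
    have h'' := leq_trans q1 hq2.
    exists (reduced_incl (O0 r'') b).
      rewrite -incl01_comp // -(incl1_comp _ q1 hq2); apply: Hq.
      rewrite (incl1_comp _ q0 hq2) incl01_comp ?(leq_trans q0 hq2) // Eb //.
      rewrite -incl01_comp ?(leq_trans hr0 h) // a0 reduced_incl0 //.
        exact: closure_compl_complex.
      exact: O1_le (leq_trans hr0 h).
    have hh := leq_trans (leq_trans hr h) h'.
    by rewrite -[LHS]/(reduced_incl (O0 r) (reduced_incl (O0 r'') b)) incl0_comp // Eb.
exists x; apply: (limit_ext (s := reduced_system X A1 i) (@second_cofinal _)) => r.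
by rewrite val_cech_incl Hx.
Qed.

(** The kernel of [to_relative] at each level is the image of the reduced homology of [O0], so the
    tower [N0] provides stability. *)
Lemma cech_exact_relative :
  exact_at (cech_to_relative X A0 A1 (i + 1)) (cech_connecting X A0 A1 i).
Proof.
move=> y; split=> [y0|[x <-]]; last first.
  apply: (limit_ext (s := reduced_system X A0 i) (@first_cofinal i)) => r.
  rewrite val_cech_connecting val_cech_to_relative raddf0.
  by apply/exact_relative_connecting; try exact: closure_compl_complex;
    [exact: O01|exists (val x (second (tower_pair r)))].
have [x Hx] : exists x : inverse_limit (reduced_system X A1 (i + 1)),
    forall r, @to_relative _ _ (O1 r) (O0 r) (i + 1) (val x (second (tower_pair r))) =
      val y (tower_pair r).
  apply: (limit_lift (s := reduced_system X A1 (i + 1)) (a_le := @second_le (i + 1))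
    (@second_cofinal _) (@reduced_le_trans _ _) (@reduced_bond_comp _ _)
    (G := fun r => relative_homology (O1 r) (O0 r) (i + 1))
    (f := fun r => @to_relative _ _ (O1 r) (O0 r) (i + 1))
    (y := fun r => val y (tower_pair r))).
  - move=> r; apply: to_relative_zmod; exact: closure_compl_complex.
  - move=> r; apply/exact_relative_connecting; try exact: closure_compl_complex.
      exact: O01.
    have E := val_cech_connecting y (tower_pair r); rewrite y0 in E; exact: esym E.
  - move=> r r' h x fx; rewrite -(bond_val (pair_le (i + 1) h)) -fx.
    apply/esym/to_relative_incl; first [exact: closure_compl_complex
      |exact: O1_le|exact: O0_le].
  - move=> r; have [r' [h H]] := N0_stable (i + 1) r; exists r', h => r'' h' x.
    move=> /exact_incl_relative[|||b <-]; try exact: closure_compl_complex.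
      exact: O01.
    have [b'' E] := H r'' h' b; exists (reduced_incl (O1 r'') b'').
      apply/exact_incl_relative; try exact: closure_compl_complex.
        exact: O01.
      by exists b''.
    have hh := leq_trans h h'; rewrite /= /reduced_bond.
    by rewrite !incl01_comp // E.
exists x; apply: (limit_ext (s := relative_system X A0 A1 (i + 1)) (@pair_cofinal _)) => r.
by rewrite val_cech_to_relative Hx.
Qed.

End CechSequence.

(** Handles an empty vertex type for X, in which [F] would have no values to take. X has no
    simplices then, and the empty neighborhood is cofinal. *)
Lemma constant_tower (R : realType) d (V : orderType d) (X : metric_complex V)
    (A : set (V -> R)) (i : int) :
  (V -> False) ->
  [/\ cofinal_tower X A (fun=> set0), stable_tower X (fun=> set0) i
    & reflecting_tower X (fun=> set0) i].
Proof.
move=> V0; split.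
- split=> [r|r r' _|L [[_ LX] _]]; last 2 first.
  - exact: subset_refl.
  - by exists 0%N => s /LX/simplex_vertex[v _]; case: (V0 v).
  split; last by exists 0 => x [s []].
  by split; [split=> // s t []|exact: sub0set].
- by move=> r; exists r, (leqnn r) => r'' _ x; exists x.
- by exists 0%N => r; exists r.
Qed.

Theorem theorem1p1 (R : realType)
    (dZ : Order.disp_t) (VZ : orderType dZ) (Z0 Z1 : metric_complex VZ)
    (dX : Order.disp_t) (VX : orderType dX) (X : metric_complex VX)
    (n : nat) (f : (VZ -> R) -> (VX -> R))
    (hZ : coarse_pair R Z0 Z1)
    (hZ0 : bounded_geometry Z0) (hZ1 : bounded_geometry Z1)
    (aZ0 : uniformly_acyclic R Z0) (aZ1 : uniformly_acyclic R Z1)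
    (hX : coarse_PD R n X)
    (hf : coarse_embedding (realization Z0) (dist Z0)
                           (realization X) (dist X) f) :
  let A0 := f @` realization Z0 in
  let A1 := f @` realization Z1 in
  let A10 : A1 `<=` A0 := image_coarse_pair hZ in
  forall i : int,
  [/\ exact_at (cech_connecting X A0 A1 i) (cech_incl X A10 i),
      exact_at (cech_incl X A10 i) (cech_to_relative X A0 A1 i)
    & exact_at (cech_to_relative X A0 A1 (i + 1)) (cech_connecting X A0 A1 i)].
Proof.
move=> A0 A1 A10 i.
suff [N0 [N1 [[c0 c1 N10] [s0 s1 r1]]]] : exists N0 N1 : nat -> set {fset VX},
    [/\ cofinal_tower X A0 N0, cofinal_tower X A1 N1 & forall r, N1 r `<=` N0 r] /\
    [/\ forall j, stable_tower X N0 j, forall j, stable_tower X N1 j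
      & forall j, reflecting_tower X N1 j].
  split; [exact: (cech_exact_reduced0 A10 c0 c1 N10 s1)
         |exact: (cech_exact_reduced1 A10 c0 c1 N10 s0 r1)
         |exact: (cech_exact_relative c0 c1 N10 s0)].
have [[v0 _]|V0] := pselect (exists v : VX, True); last first.
  have {}V0 (v : VX) : False by apply: V0; exists v.
  have H (A : set (VX -> R)) j := constant_tower X A j V0.
  exists (fun=> set0), (fun=> set0); split; [split=> [||r]|split=> j].
  - by have [] := H A0 i.
  - by have [] := H A1 i.
  - exact: subset_refl.
  - by have [] := H A0 j.
  - by have [] := H A0 j.
  - by have [] := H A0 j.
have [F HF] := exists_approximation hf v0.
have aX := pd_acyclic hX; have Z10 := cp_sub hZ.
have low0 (k : R) : exists m, forall x y, realization Z0 x -> realization Z0 y ->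
    dist Z0 x y <= k -> dist Z0 x y < m.
  by exists (k + 1) => x y _ _ xy; apply: le_lt_trans xy _; rewrite ltrDl.
have low1 (k : R) := coarse_embedding_lower k (cp_coarse hZ).
have F0 := approx_coarse_vertex_map aX hf HF aZ0 (@subset_refl _ Z0) low0.
have F1 := approx_coarse_vertex_map aX hf HF aZ1 Z10 low1.
exists (level_set X Z0 F), (level_set X Z1 F); split; split.
- split=> [r|r r'|L]; last exact: (neighborhood_level_set aX hf HF (@subset_refl _ Z0)).
    exact: (level_set_neighborhood hf HF (@subset_refl _ Z0)).
  exact: level_set_le.
- split=> [r|r r'|L]; last exact: (neighborhood_level_set aX hf HF Z10).
    exact: (level_set_neighborhood hf HF Z10).
  exact: level_set_le.
(* The towers are nested because the same [F] defines both. *)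
- move=> r s [Xs ls]; split=> // v /ls[z [Zz nz]].
  by exists z; split=> //; exact: Z10.
- by move=> j; exact: (reduced_incl_stable hX aZ0 F0).
- by move=> j; exact: (reduced_incl_stable hX aZ1 F1).
- by move=> j; exact: (reduced_incl_reflects0 hX aZ1 F1).
Qed.
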